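(* For a generic $n$-tuple of positive lengths $(l_1,\dots,l_n)$, every cyclic polygon $P\in\mathbf L(l_1,\dots,l_n)$ is a nondegenerate critical point of $\mathcal A$, and $$\mu_P(\mathcal A)=e(P)-1-2\omega_P-\begin{cases}0,&\sum_{i=1}^n\varepsilon_i\tan\alpha_i>0,\\1,&\text{otherwise}.\end{cases}$$
   Context: $\mathbf L(l_1,\dots,l_n)$ is the space of planar polygons (closed broken lines with cyclically numbered vertices $v_1,\dots,v_n$) with $|v_iv_{i+1}|=l_i$, modulo translations and rotations; for generic lengths it is a smooth closed manifold. The oriented area is $\mathcal A=\frac12\sum_i(x_iy_{i+1}-x_{i+1}y_i)$ for $v_i=(x_i,y_i)$. A polygon is cyclic if all its vertices lie on a circle, with center $O$. $\omega_P$ is the winding number of $P$ around $O$. $\alpha_i$ is half of the unoriented positive angle between $\overrightarrow{Ov_i}$ and $\overrightarrow{Ov_{i+1}}$. $\varepsilon_i=1$ if $O$ lies to the left of $\overrightarrow{v_iv_{i+1}}$, and $-1$ if to the right. $e(P)$ is the number of $i$ with $\varepsilon_i=1$. $\mu_P(\mathcal A)$ is the number of negative eigenvalues of the Hessian of $\mathcal A$ at $P$. *)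

(* Defs.v *)
From Stdlib Require Import Reals Lra Lia Arith.
Open Scope R_scope.

Fixpoint rsum (k : nat) (f : nat -> R) : R :=
  match k with O => 0 | S k' => rsum k' f + f k' end.

Fixpoint ncount (k : nat) (p : nat -> bool) : nat :=
  match k with O => O | S k' => (ncount k' p + (if p k' then 1 else 0))%nat end.

Definition pt := (R * R)%type.
Definition psub (a b : pt) : pt := (fst a - fst b, snd a - snd b).
Definition dot (a b : pt) : R := fst a * fst b + snd a * snd b.
Definition cross (a b : pt) : R := fst a * snd b - snd a * fst b.
Definition norm (a : pt) : R := sqrt (dot a a).
Definition dist (a b : pt) : R := norm (psub a b).

(* A polygon with n vertices: v : nat -> pt, vertices v 0, ..., v (n-1),
   indices taken cyclically (vertex n = vertex 0).  Edge i goes from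
   v i to v (i+1 mod n) and has length l i. *)
Definition nxt (n i : nat) : nat := ((i + 1) mod n)%nat.

Definition area (n : nat) (v : nat -> pt) : R :=
  / 2 * rsum n (fun i => fst (v i) * snd (v (nxt n i)) - fst (v (nxt n i)) * snd (v i)).

(* The polygon space L(l_1..l_n) = {closed polygons with |v_i v_{i+1}| = l_i}
   modulo translations and rotations.  Since l_0 > 0, every class has a unique
   normalized representative with v 0 = (0,0) and v 1 = (l 0, 0); we identify
   L(l) with the set of these representatives (a global slice of the free
   action of orientation-preserving isometries). *)
Definition InL (n : nat) (l : nat -> R) (v : nat -> pt) : Prop :=
  v 0%nat = (0, 0) /\ v 1%nat = (l 0%nat, 0) /\
  forall i, (i < n)%nat -> dist (v i) (v (nxt n i)) = l i.

(* ---------- calculus in R^k (vectors x : nat -> R supported on 0..k-1) ---------- *)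
Definition zerov : nat -> R := fun _ => 0.
Definition shiftk (x : nat -> R) (j : nat) (t : R) : nat -> R :=
  fun m => if Nat.eqb m j then x m + t else x m.

Definition has_partial (g : (nat -> R) -> R) (j : nat) (x : nat -> R) (d : R) : Prop :=
  derivable_pt_lim (fun t => g (shiftk x j t)) 0 d.

Definition InBox (k : nat) (r : R) (x : nat -> R) : Prop :=
  (forall m, (k <= m)%nat -> x m = 0) /\ (forall m, (m < k)%nat -> Rabs (x m) < r).

Definition cont_on (k : nat) (r : R) (g : (nat -> R) -> R) : Prop :=
  forall x, InBox k r x -> forall eps, 0 < eps -> exists delta, 0 < delta /\
    forall y, InBox k r y -> (forall m, (m < k)%nat -> Rabs (y m - x m) < delta) ->
      Rabs (g y - g x) < eps.

Definition C2data (k : nat) (r : R) (g : (nat -> R) -> R)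
    (D1 : nat -> (nat -> R) -> R) (D2 : nat -> nat -> (nat -> R) -> R) : Prop :=
  cont_on k r g /\
  (forall i x, (i < k)%nat -> InBox k r x -> has_partial g i x (D1 i x)) /\
  (forall i, (i < k)%nat -> cont_on k r (D1 i)) /\
  (forall i j x, (i < k)%nat -> (j < k)%nat -> InBox k r x ->
      has_partial (D1 i) j x (D2 i j x)) /\
  (forall i j, (i < k)%nat -> (j < k)%nat -> cont_on k r (D2 i j)).

Definition IsC2 (k : nat) (r : R) (g : (nat -> R) -> R) : Prop :=
  exists D1 D2, C2data k r g D1 D2.

Definition GradHessAt0 (k : nat) (g : (nat -> R) -> R) (Gr : nat -> R) (H : nat -> nat -> R) : Prop :=
  exists r D1 D2, 0 < r /\ C2data k r g D1 D2 /\
    (forall i, (i < k)%nat -> D1 i zerov = Gr i) /\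
    (forall i j, (i < k)%nat -> (j < k)%nat -> D2 i j zerov = H i j).

Definition SymEigenvalues (k : nat) (H : nat -> nat -> R) (lam : nat -> R) : Prop :=
  exists Q : nat -> nat -> R,
    (forall i j, (i < k)%nat -> (j < k)%nat ->
        rsum k (fun m => Q m i * Q m j) = if Nat.eqb i j then 1 else 0) /\
    (forall i j, (i < k)%nat -> (j < k)%nat ->
        H i j = rsum k (fun m => Q i m * lam m * Q j m)).

Definition num_neg (k : nat) (lam : nat -> R) : nat :=
  ncount k (fun m => if Rlt_dec (lam m) 0 then true else false).

Definition ChartAt (n : nat) (l : nat -> R) (P : nat -> pt)
    (r : R) (phi : (nat -> R) -> nat -> pt) : Prop :=
  let k := (n - 3)%nat in
  0 < r /\
  (forall i, (i < n)%nat -> phi zerov i = P i) /\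
  (forall x, InBox k r x -> InL n l (phi x)) /\
  (forall i, (i < n)%nat ->
     IsC2 k r (fun x => fst (phi x i)) /\ IsC2 k r (fun x => snd (phi x i))) /\
  (exists Dphi : nat -> nat -> pt,
     (forall j i, (j < k)%nat -> (i < n)%nat ->
        has_partial (fun x => fst (phi x i)) j zerov (fst (Dphi j i)) /\
        has_partial (fun x => snd (phi x i)) j zerov (snd (Dphi j i))) /\
     (forall c : nat -> R,
        (forall i, (i < n)%nat ->
           rsum k (fun j => c j * fst (Dphi j i)) = 0 /\
           rsum k (fun j => c j * snd (Dphi j i)) = 0) ->
        forall j, (j < k)%nat -> c j = 0)) /\
  (exists eps, 0 < eps /\ forall Q, InL n l Q ->
     (forall i, (i < n)%nat -> dist (Q i) (P i) < eps) ->
     exists x, InBox k r x /\ forall i, (i < n)%nat -> phi x i = Q i).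

Definition NondegCritIndex (n : nat) (l : nat -> R) (P : nat -> pt) (mu : nat) : Prop :=
  exists r phi Gr H lam,
    ChartAt n l P r phi /\
    GradHessAt0 (n - 3) (fun x => area n (phi x)) Gr H /\
    (forall i, (i < n - 3)%nat -> Gr i = 0) /\
    SymEigenvalues (n - 3) H lam /\
    (forall m, (m < n - 3)%nat -> lam m <> 0) /\
    num_neg (n - 3) lam = mu.

Definition OnCircle (n : nat) (v : nat -> pt) (O : pt) (Rad : R) : Prop :=
  0 < Rad /\ forall i, (i < n)%nat -> dist (v i) O = Rad.

Definition epsi (n : nat) (v : nat -> pt) (O : pt) (i : nat) : R :=
  if Rlt_dec 0 (cross (psub (v (nxt n i)) (v i)) (psub O (v i))) then 1 else -1.

Definition alphai (n : nat) (v : nat -> pt) (O : pt) (i : nat) : R :=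
  / 2 * acos (dot (psub (v i) O) (psub (v (nxt n i)) O) /
              (norm (psub (v i) O) * norm (psub (v (nxt n i)) O))).

Definition eP (n : nat) (v : nat -> pt) (O : pt) : nat :=
  ncount n (fun i => if Rlt_dec 0 (cross (psub (v (nxt n i)) (v i)) (psub O (v i)))
                     then true else false).

(* winding number of P around O: (1/2pi) * sum of the oriented angles
   from O v_i to O v_{i+1}; the oriented angle is eps_i * 2 alpha_i. *)
Definition windingP (n : nat) (v : nat -> pt) (O : pt) : R :=
  rsum n (fun i => epsi n v O i * (2 * alphai n v O i)) / (2 * PI).

Definition tanSum (n : nat) (v : nat -> pt) (O : pt) : R :=
  rsum n (fun i => epsi n v O i * tan (alphai n v O i)).

Definition OpenDensePos (n : nat) (U : (nat -> R) -> Prop) : Prop :=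
  (forall l, U l -> exists delta, 0 < delta /\
     forall l', (forall i, (i < n)%nat -> Rabs (l' i - l i) < delta) -> U l') /\
  (forall l, (forall i, (i < n)%nat -> 0 < l i) -> forall eps, 0 < eps ->
     exists l', U l' /\ forall i, (i < n)%nat -> Rabs (l' i - l i) < eps).

(* Main.v *)
(** Write [a_k] for vertex [k] relative to the centre, [b_k] for the signed half central angle of
    edge [k] and [t_k = tan b_k].  On polygons with the given edge lengths the area is, up to a
    constant, [1/2 sum_k (cross (w_k, w_{k+1}) - 1/2 cot b_k |w_{k+1} - w_k|^2)] in the displacement
    [w], because the linear part telescopes to zero; this form is the Hessian.  For tangent vectors
    [w_k = p_k J a_k - q_k a_k] with [p_{k+1} - p_k = t_k (q_k + q_{k+1})] it becomes
    [1/2 sum_k (t_k (q_k + q_{k+1})^2 - (q_{k+1} - q_k)^2 / t_k)].  A generic linear functional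
    [s_k] of [a_k] lies in its kernel, so [q_k = s_k h_k] makes it diagonal in
    [d_k = h_{k+1} - h_k], with coefficients [c_k = - s_k s_{k+1} / sin (2 b_k)].  Counting half
    turns, [e(P) - 2 w] of the [c_k] are negative.  The tangent space consists of the [d] orthogonal
    to the isotropic vector [1/c_k] and to a vector of square [2 sum_k t_k], modulo the former, and
    Sylvester's law of inertia gives the index.

    Genericity must exclude edges through the centre and [sum_k t_k = 0].  In the second case,
    moving one length by [x] moves the inverse diameter by at least the order of [sqrt x] (an
    envelope argument), so by the pigeonhole principle the bad lengths are nowhere dense. *)
From Stdlib Require Import Reals Lra Lia Arith ZArith List Classical FunctionalExtensionality.
Require Import Defs.
Import ListNotations.
Open Scope R_scope.

(** * Finite sums and counting *)

(** The index is defined through an actual chart: twice continuously differentiable, with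
    independent partial derivatives, covering every nearby polygon. It is written down explicitly.
    All edges but two neighbouring ones turn by angles linear in the parameters, and these two close
    the polygon as sides of a triangle, so they must not be parallel. The angles are chosen so that
    the partial derivatives at the origin are a prescribed basis of tangent vectors; with the basis
    that diagonalises the Hessian the eigenvalues are visible. As the area is exactly a constant
    plus a quadratic form in displacements that vanish at the origin, second derivatives of the
    chart drop out.

    In the genericity part, a vanishing sum of the signed tangents says that
    [sum eps_k asin (s l_k)] has zero derivative in the inverse diameter [s]. The relation between
    [s] and a single length then has a fold, the source of the square root. Uniform constants
    require two more exclusions: ties for the longest edge, and vanishing signed sums of lengths. *)

Lemma rsum_ext (m : nat) (f g : nat -> R) :
  (forall i, (i < m)%nat -> f i = g i) -> rsum m f = rsum m g.
Proof.
  induction m as [|m IH]; simpl; intros H; auto.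
  rewrite IH, H by (intros; auto with arith). reflexivity.
Qed.

Lemma rsum_plus (m : nat) (f g : nat -> R) :
  rsum m (fun i => f i + g i) = rsum m f + rsum m g.
Proof. induction m as [|m IH]; simpl; [lra|rewrite IH; lra]. Qed.

Lemma rsum_minus (m : nat) (f g : nat -> R) :
  rsum m (fun i => f i - g i) = rsum m f - rsum m g.
Proof. induction m as [|m IH]; simpl; [lra|rewrite IH; lra]. Qed.

Lemma rsum_scal (m : nat) (c : R) (f : nat -> R) :
  rsum m (fun i => c * f i) = c * rsum m f.
Proof. induction m as [|m IH]; simpl; [lra|rewrite IH; lra]. Qed.

Lemma rsum_scal_r (m : nat) (c : R) (f : nat -> R) :
  rsum m (fun i => f i * c) = rsum m f * c.
Proof. induction m as [|m IH]; simpl; [lra|rewrite IH; lra]. Qed.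

Lemma rsum_zero (m : nat) (f : nat -> R) :
  (forall i, (i < m)%nat -> f i = 0) -> rsum m f = 0.
Proof.
  induction m as [|m IH]; simpl; intros H; auto.
  rewrite IH, H by (intros; auto with arith). lra.
Qed.

Lemma rsum_swap (m k : nat) (f : nat -> nat -> R) :
  rsum m (fun i => rsum k (fun j => f i j)) = rsum k (fun j => rsum m (fun i => f i j)).
Proof.
  induction m as [|m IH]; simpl.
  - symmetry; apply rsum_zero; auto.
  - rewrite IH, <- rsum_plus. reflexivity.
Qed.

Lemma rsum_le (m : nat) (f g : nat -> R) :
  (forall i, (i < m)%nat -> f i <= g i) -> rsum m f <= rsum m g.
Proof.
  induction m as [|m IH]; simpl; intros H; [lra|].
  apply Rplus_le_compat; auto with arith.
Qed.

Lemma rsum_nonneg (m : nat) (f : nat -> R) :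
  (forall i, (i < m)%nat -> 0 <= f i) -> 0 <= rsum m f.
Proof.
  intros H. rewrite <- (rsum_zero m (fun _ => 0)) by auto. now apply rsum_le.
Qed.

Lemma rsum_term_le (m j : nat) (f : nat -> R) :
  (j < m)%nat -> (forall i, (i < m)%nat -> 0 <= f i) -> f j <= rsum m f.
Proof.
  induction m as [|m IH]; simpl; intros Hj H; [lia|].
  destruct (Nat.eq_dec j m) as [->|Hne].
  - assert (0 <= rsum m f) by (apply rsum_nonneg; auto with arith). lra.
  - assert (f j <= rsum m f) by (apply IH; [lia|auto with arith]).
    specialize (H m (Nat.lt_succ_diag_r m)). lra.
Qed.

Lemma rsum_pos (m j : nat) (f : nat -> R) :
  (j < m)%nat -> 0 < f j -> (forall i, (i < m)%nat -> 0 <= f i) -> 0 < rsum m f.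
Proof. intros Hj H0 H. pose proof (rsum_term_le m j f Hj H). lra. Qed.

Lemma rsum_Rabs (m : nat) (f : nat -> R) : Rabs (rsum m f) <= rsum m (fun i => Rabs (f i)).
Proof.
  induction m as [|m IH]; simpl; [rewrite Rabs_R0; lra|].
  eapply Rle_trans; [apply Rabs_triang|lra].
Qed.

Lemma rsum_const (m : nat) (c : R) : rsum m (fun _ => c) = INR m * c.
Proof. induction m as [|m IH]; [simpl; lra|rewrite S_INR; simpl; rewrite IH; lra]. Qed.

Lemma rsum_telescope (m : nat) (f : nat -> R) :
  rsum m (fun i => f (S i) - f i) = f m - f 0%nat.
Proof. induction m as [|m IH]; simpl; [lra|rewrite IH; lra]. Qed.

Lemma rsum_app (a b : nat) (f : nat -> R) :
  rsum (a + b) f = rsum a f + rsum b (fun i => f (a + i)%nat).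
Proof.
  induction b as [|b IH]; simpl; [rewrite Nat.add_0_r; lra|].
  rewrite Nat.add_succ_r; simpl. rewrite IH. lra.
Qed.

Definition unitv (k : nat) : nat -> R := fun i => if Nat.eqb i k then 1 else 0.

Lemma rsum_unitv (m k : nat) (f : nat -> R) :
  (k < m)%nat -> rsum m (fun i => f i * unitv k i) = f k.
Proof.
  unfold unitv. induction m as [|m IH]; simpl; intros H; [lia|].
  destruct (Nat.eqb_spec m k) as [->|Hne].
  - rewrite rsum_zero; [lra|]. intros i Hi.
    destruct (Nat.eqb_spec i k); [lia|lra].
  - rewrite IH by lia. lra.
Qed.

Lemma ncount_ext (m : nat) (p q : nat -> bool) :
  (forall i, (i < m)%nat -> p i = q i) -> ncount m p = ncount m q.
Proof.
  induction m as [|m IH]; simpl; intros H; auto.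
  rewrite IH, H by (intros; auto with arith). reflexivity.
Qed.

Lemma ncount_app (a b : nat) (p : nat -> bool) :
  ncount (a + b) p = (ncount a p + ncount b (fun i => p (a + i)%nat))%nat.
Proof.
  induction b as [|b IH]; simpl; [rewrite Nat.add_0_r; lia|].
  rewrite Nat.add_succ_r; simpl. rewrite IH. lia.
Qed.

Lemma ncount_rsum (m : nat) (p : nat -> bool) :
  INR (ncount m p) = rsum m (fun i => if p i then 1 else 0).
Proof.
  induction m as [|m IH]; simpl; auto.
  rewrite plus_INR, IH. destruct (p m); simpl; lra.
Qed.

Lemma ncount_compl (m : nat) (p : nat -> bool) :
  (ncount m p + ncount m (fun i => negb (p i)) = m)%nat.
Proof. induction m as [|m IH]; simpl; auto. destruct (p m); simpl; lia. Qed.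

Lemma filter_seq_length (m : nat) (p : nat -> bool) :
  length (filter p (seq 0 m)) = ncount m p.
Proof.
  induction m as [|m IH]; auto.
  rewrite seq_S, filter_app, length_app, IH. simpl. destruct (p m); simpl; lia.
Qed.

(** Elimination of the last unknown by means of an equation that contains it. This dimension count
    supplies the existence statements of the linear algebra below: orthogonal vectors, the
    inequality of inertia, the solution of square systems. *)
Lemma hom_system (m : nat) : forall E : list (nat -> R), (length E < m)%nat ->
  exists x, (exists i, (i < m)%nat /\ x i <> 0) /\
    forall e, In e E -> rsum m (fun i => e i * x i) = 0.
Proof.
  induction m as [|m IH]; intros E HE; [lia|].
  destruct (Forall_Exists_dec (fun e : nat -> R => e m = 0)
              (fun e => Req_EM_T (e m) 0) E) as [H0|H1].
  - exists (unitv m). split.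
    + exists m. split; [lia|]. unfold unitv. rewrite Nat.eqb_refl. lra.
    + intros e He. rewrite rsum_unitv by lia.
      rewrite Forall_forall in H0; auto.
  - apply Exists_exists in H1. destruct H1 as [e0 [He0 Hm]].
    apply in_split in He0. destruct He0 as [E1 [E2 ->]].
    set (red := fun (e : nat -> R) i => e i - e m / e0 m * e0 i).
    destruct (IH (map red (E1 ++ E2))) as [x [[i [Hi Hx]] Hz]].
    { rewrite length_map. rewrite length_app in *. simpl in HE. lia. }
    set (z := - rsum m (fun i => e0 i * x i) / e0 m).
    exists (fun i => if Nat.eqb i m then z else x i). split.
    + exists i. split; [lia|]. destruct (Nat.eqb_spec i m); [lia|auto].
    + assert (Hs : forall e, rsum (S m) (fun i => e i * (if Nat.eqb i m then z else x i))
                = rsum m (fun i => e i * x i) + e m * z).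
      { intros e. simpl. rewrite Nat.eqb_refl. f_equal. apply rsum_ext.
        intros j Hj. destruct (Nat.eqb_spec j m); [lia|auto]. }
      intros e He. rewrite Hs.
      assert (Hc : e = e0 \/ In e (E1 ++ E2)).
      { apply in_app_or in He. destruct He as [He|[He|He]]; auto;
          right; apply in_or_app; auto. }
      destruct Hc as [->|Hc].
      * unfold z. field; auto.
      * specialize (Hz (red e) (in_map red _ _ Hc)). unfold red in Hz.
        rewrite (rsum_ext m _ (fun i => e i * x i - e m / e0 m * (e0 i * x i))) in Hz
          by (intros; ring).
        rewrite rsum_minus, rsum_scal in Hz.
        unfold z. replace (rsum m (fun i => e i * x i)) with
          (e m / e0 m * rsum m (fun i => e0 i * x i)) by lra. field; auto.
Qed.

(** * Diagonal bilinear forms and the law of inertia *)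

Definition dform (n : nat) (c x y : nat -> R) : R := rsum n (fun k => c k * x k * y k).

Lemma dform_sym (n : nat) (c x y : nat -> R) : dform n c x y = dform n c y x.
Proof. apply rsum_ext; intros; ring. Qed.

Lemma dform_comb (n : nat) (c x y z : nat -> R) (r : R) :
  dform n c x (fun k => y k + r * z k) = dform n c x y + r * dform n c x z.
Proof.
  unfold dform. rewrite <- rsum_scal, <- rsum_plus. apply rsum_ext; intros; ring.
Qed.

Lemma dform_rsum (n m : nat) (c x r : nat -> R) (g : nat -> nat -> R) :
  dform n c x (fun k => rsum m (fun j => r j * g j k)) = rsum m (fun j => r j * dform n c x (g j)).
Proof.
  unfold dform.
  rewrite (rsum_ext n _ (fun k => rsum m (fun j => c k * x k * (r j * g j k))))
    by (intros; rewrite rsum_scal; reflexivity).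
  rewrite rsum_swap. apply rsum_ext. intros j _. rewrite <- rsum_scal.
  apply rsum_ext; intros; ring.
Qed.

Lemma dform_unitv (n : nat) (c x : nat -> R) (k : nat) :
  (k < n)%nat -> dform n c x (unitv k) = c k * x k.
Proof. intros H. unfold dform. exact (rsum_unitv n k (fun i => c i * x i) H). Qed.

Definition orth_family (n : nat) (c : nat -> R) (r : nat) (g : nat -> nat -> R) : Prop :=
  (forall i j, (i < r)%nat -> (j < r)%nat -> i <> j -> dform n c (g i) (g j) = 0) /\
  (forall i, (i < r)%nat -> dform n c (g i) (g i) <> 0).

Lemma orth_sum (n : nat) (c : nat -> R) (r : nat) (g : nat -> nat -> R) (x : nat -> R) (i : nat) :
  orth_family n c r g -> (i < r)%nat ->
  rsum r (fun j => x j * dform n c (g i) (g j)) = x i * dform n c (g i) (g i).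
Proof.
  intros [H _] Hi.
  rewrite (rsum_ext r _ (fun j => x j * dform n c (g i) (g i) * unitv i j)).
  - apply (rsum_unitv r i (fun j => x j * dform n c (g i) (g i)) Hi).
  - intros j Hj. unfold unitv. destruct (Nat.eqb_spec j i) as [->|Hne]; [ring|].
    rewrite H by auto. ring.
Qed.

(** A nonzero [z] orthogonal to the family exists by counting, but the form is indefinite and [z]
    may be isotropic. With [z i <> 0], the projection [y] of the unit vector [i] pairs with [z] to
    [c i * z i <> 0]; if [y] is isotropic too, [z + y] has twice this number as its square. *)
Lemma orth_extend_one (n : nat) (c : nat -> R) (r : nat) (g : nat -> nat -> R) :
  (forall k, (k < n)%nat -> c k <> 0) -> (r < n)%nat -> orth_family n c r g ->
  exists z, (forall j, (j < r)%nat -> dform n c (g j) z = 0) /\ dform n c z z <> 0.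
Proof.
  intros Hc Hr Hg.
  destruct (hom_system n (map (fun j k => c k * g j k) (seq 0 r))) as [z [[i [Hi Hzi]] Hz]].
  { rewrite length_map, length_seq; auto. }
  assert (Hgz : forall j, (j < r)%nat -> dform n c (g j) z = 0).
  { intros j Hj. apply (Hz (fun k => c k * g j k)).
    apply (in_map (fun j k => c k * g j k)). apply in_seq. lia. }
  destruct (Req_EM_T (dform n c z z) 0) as [H0|H0]; [|exists z; auto].
  set (y := fun k => unitv i k +
              (-1) * rsum r (fun j => dform n c (g j) (unitv i) / dform n c (g j) (g j) * g j k)).
  assert (Hy : forall j, (j < r)%nat -> dform n c (g j) y = 0).
  { intros j Hj. unfold y. rewrite dform_comb, dform_rsum, orth_sum by auto.
    destruct Hg as [_ Hg]. field. auto. }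
  assert (Hzy : dform n c z y = c i * z i).
  { unfold y. rewrite dform_comb, dform_rsum, dform_unitv by auto.
    rewrite (rsum_zero r); [ring|]. intros j Hj. rewrite (dform_sym n c z), Hgz by auto. ring. }
  assert (Hne : c i * z i <> 0).
  { apply Rmult_integral_contrapositive_currified; auto. }
  destruct (Req_EM_T (dform n c y y) 0) as [Hyy|Hyy]; [|exists y; auto].
  exists (fun k => z k + 1 * y k). split.
  - intros j Hj. rewrite dform_comb, Hgz, Hy by auto. ring.
  - rewrite dform_comb, (dform_sym n c _ z), (dform_sym n c _ y), !dform_comb.
    rewrite H0, Hyy, (dform_sym n c y z), Hzy. lra.
Qed.

Lemma orth_extend (n : nat) (c : nat -> R) (r : nat) (g : nat -> nat -> R) :
  (forall k, (k < n)%nat -> c k <> 0) -> (r <= n)%nat -> orth_family n c r g ->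
  exists g', (forall i, (i < r)%nat -> g' i = g i) /\ orth_family n c n g'.
Proof.
  intros Hc. remember (n - r)%nat as m eqn:Em. revert r g Em.
  induction m as [|m IH]; intros r g Em Hr Hg.
  - replace n with r in Hg |- * at 3 by lia. exists g. split; auto.
    replace n with r at 2 by lia. auto.
  - destruct (orth_extend_one n c r g Hc) as [z [Hz1 Hz2]]; auto; [lia|].
    set (g1 := fun i => if Nat.eqb i r then z else g i).
    assert (Hlt : forall i, (i < r)%nat -> g1 i = g i).
    { intros i Hi. unfold g1. destruct (Nat.eqb_spec i r); [lia|auto]. }
    assert (Heq : g1 r = z) by (unfold g1; rewrite Nat.eqb_refl; auto).
    destruct (IH (S r) g1) as [g' [H1 H2]]; [lia|lia| |].
    + destruct Hg as [Ho Hn]. split.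
      * intros i j Hi Hj Hij.
        destruct (Nat.eq_dec i r) as [->|Hir]; destruct (Nat.eq_dec j r) as [->|Hjr]; try lia.
        -- rewrite Heq, Hlt, dform_sym by lia. apply Hz1; lia.
        -- rewrite Heq, Hlt by lia. apply Hz1; lia.
        -- rewrite !Hlt by lia. apply Ho; lia.
      * intros i Hi. destruct (Nat.eq_dec i r) as [->|Hir].
        -- rewrite Heq; auto.
        -- rewrite Hlt by lia. apply Hn; lia.
    + exists g'. split; auto. intros i Hi. rewrite H1, Hlt by lia. auto.
Qed.

Definition is_neg (x : R) : bool := if Rlt_dec x 0 then true else false.

Lemma is_neg_opp (x : R) : x <> 0 -> is_neg (- x) = negb (is_neg x).
Proof.
  unfold is_neg. intros H.
  destruct (Rlt_dec (- x) 0); destruct (Rlt_dec x 0); simpl; auto; lra.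
Qed.

(** If more of the [g i] were negative than of the [c k], counting would give a nontrivial
    combination [z] of the negative [g i] that vanishes at every coordinate with [c k < 0]. Its
    square would be nonnegative by coordinates and negative by orthogonality. *)
Lemma sylvester_le (n : nat) (c : nat -> R) (g : nat -> nat -> R) :
  (forall k, (k < n)%nat -> c k <> 0) -> orth_family n c n g ->
  (ncount n (fun i => is_neg (dform n c (g i) (g i))) <= ncount n (fun k => is_neg (c k)))%nat.
Proof.
  intros Hc Hg.
  set (pg := fun i => is_neg (dform n c (g i) (g i))).
  set (pc := fun k => is_neg (c k)).
  apply Nat.nlt_ge. intros Hlt.
  destruct (hom_system n (map (fun j => unitv j) (filter (fun i => negb (pg i)) (seq 0 n)) ++
                          map (fun k j => g j k) (filter pc (seq 0 n)))) as [x [[i [Hi Hx]] Hz]].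
  { rewrite length_app, !length_map, !filter_seq_length.
    pose proof (ncount_compl n pg). lia. }
  set (z := fun k => rsum n (fun j => x j * g j k)).
  assert (Hx0 : forall j, (j < n)%nat -> pg j = false -> x j = 0).
  { intros j Hj Hp. rewrite <- (rsum_unitv n j x Hj).
    rewrite <- (Hz (unitv j)).
    - apply rsum_ext; intros; ring.
    - apply in_or_app; left. apply in_map. apply filter_In.
      rewrite Hp. split; auto. apply in_seq; lia. }
  assert (Hz0 : forall k, (k < n)%nat -> pc k = true -> z k = 0).
  { intros k Hk Hp. rewrite <- (Hz (fun j => g j k)).
    - apply rsum_ext; intros; ring.
    - apply in_or_app; right. apply (in_map (fun k j => g j k)). apply filter_In.
      split; auto. apply in_seq; lia. }
  assert (H1 : dform n c z z = rsum n (fun i => x i * x i * dform n c (g i) (g i))).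
  { unfold z at 2. rewrite dform_rsum. apply rsum_ext. intros j Hj.
    rewrite dform_sym. unfold z. rewrite dform_rsum, orth_sum by auto. ring. }
  assert (H2 : 0 <= dform n c z z).
  { apply rsum_nonneg. intros k Hk. destruct (pc k) eqn:E.
    - rewrite Hz0 by auto. lra.
    - unfold pc, is_neg in E. destruct (Rlt_dec (c k) 0); [discriminate|].
      pose proof (Rle_0_sqr (z k)). unfold Rsqr in *. nra. }
  assert (Hneg : forall j, (j < n)%nat -> x j <> 0 -> dform n c (g j) (g j) < 0).
  { intros j Hj Hxj. destruct (pg j) eqn:E.
    - unfold pg, is_neg in E. destruct (Rlt_dec (dform n c (g j) (g j)) 0); [auto|discriminate].
    - exfalso; auto. }
  assert (H3 : 0 < rsum n (fun i => - (x i * x i * dform n c (g i) (g i)))).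
  { apply (rsum_pos n i); auto.
    - specialize (Hneg i Hi Hx). assert (0 < x i * x i) by (apply Rsqr_pos_lt; auto). nra.
    - intros j Hj. destruct (Req_EM_T (x j) 0) as [->|Hne]; [lra|].
      specialize (Hneg j Hj Hne). assert (0 < x j * x j) by (apply Rsqr_pos_lt; auto). nra. }
  rewrite (rsum_ext n _ (fun i => (-1) * (x i * x i * dform n c (g i) (g i)))) in H3
    by (intros; ring).
  rewrite rsum_scal in H3. lra.
Qed.

(** The opposite inequality is the same bound for [- c], which counts the complements because no
    square is zero in either family. *)
Lemma sylvester (n : nat) (c : nat -> R) (g : nat -> nat -> R) :
  (forall k, (k < n)%nat -> c k <> 0) -> orth_family n c n g ->
  ncount n (fun i => is_neg (dform n c (g i) (g i))) = ncount n (fun k => is_neg (c k)).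
Proof.
  intros Hc Hg. apply Nat.le_antisymm; [apply sylvester_le; auto|].
  assert (Hb : forall x y, dform n (fun k => - c k) x y = - dform n c x y).
  { intros x y. unfold dform. rewrite <- (Rmult_1_l (rsum n _)) at 1.
    replace (- rsum n (fun k => c k * x k * y k))
      with ((-1) * rsum n (fun k => c k * x k * y k)) by ring.
    rewrite <- !rsum_scal. apply rsum_ext; intros; ring. }
  assert (Hle : (ncount n (fun i => is_neg (dform n (fun k => - c k) (g i) (g i)))
                 <= ncount n (fun k => is_neg (- c k)))%nat).
  { apply (sylvester_le n (fun k => - c k)).
    - intros k Hk. specialize (Hc k Hk). lra.
    - destruct Hg as [H1 H2]. split; intros.
      + rewrite Hb, H1 by auto. ring.
      + rewrite Hb. specialize (H2 i H). lra. }
  rewrite (ncount_ext n _ (fun i => negb (is_neg (dform n c (g i) (g i))))) in Hle.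
  2:{ intros i Hi. rewrite Hb. apply is_neg_opp. apply Hg; auto. }
  rewrite (ncount_ext n (fun k => is_neg (- c k)) (fun k => negb (is_neg (c k)))) in Hle
    by (intros; apply is_neg_opp; auto).
  pose proof (ncount_compl n (fun i => is_neg (dform n c (g i) (g i)))).
  pose proof (ncount_compl n (fun k => is_neg (c k))). lia.
Qed.

(* An isotropic [u] splits off a hyperbolic plane, spanned by [gp] and [gm] with
   [u = gp - gm], which carries exactly one negative square. *)
Lemma index_reduction (n : nat) (c a u : nat -> R) :
  (3 <= n)%nat -> (forall k, (k < n)%nat -> c k <> 0) ->
  u 0%nat <> 0 -> dform n c u u = 0 -> dform n c a u = 0 -> dform n c a a <> 0 ->
  exists b : nat -> nat -> R, orth_family n c (n - 3) b /\
    (forall i, (i < n - 3)%nat -> dform n c a (b i) = 0 /\ dform n c u (b i) = 0) /\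
    ncount n (fun k => is_neg (c k)) =
      ((if is_neg (dform n c a a) then 1 else 0) + 1 +
       ncount (n - 3) (fun i => is_neg (dform n c (b i) (b i))))%nat.
Proof.
  intros Hn Hc Hu0 Huu Hau Haa.
  assert (Hcu : c 0%nat * u 0%nat <> 0).
  { apply Rmult_integral_contrapositive_currified; auto. apply Hc; lia. }
  set (y0 := fun k => unitv 0 k + (- (dform n c a (unitv 0) / dform n c a a)) * a k).
  assert (Hay0 : dform n c a y0 = 0) by (unfold y0; rewrite dform_comb; field; auto).
  assert (Huy0 : dform n c u y0 = c 0%nat * u 0%nat).
  { unfold y0. rewrite dform_comb, dform_unitv, (dform_sym n c u a), Hau by lia. ring. }
  set (y := fun k => 0 + / (c 0%nat * u 0%nat) * y0 k).
  assert (Hz : forall x, dform n c x (fun _ => 0) = 0)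
    by (intros; apply rsum_zero; intros; ring).
  assert (Hay : dform n c a y = 0) by (unfold y; rewrite dform_comb, Hay0, Hz; ring).
  assert (Huy : dform n c u y = 1) by (unfold y; rewrite dform_comb, Huy0, Hz; field; split; auto; apply Hc; lia).
  set (yy := dform n c y y).
  (* As [u] is isotropic and pairs to [1] with [y], adding [r * u] to [y] raises its square by
     [2 * r]; these two values of [r] produce the squares [1] and [-1]. *)
  set (gp := fun k => y k + (1 - yy) / 2 * u k).
  set (gm := fun k => y k + (-1 - yy) / 2 * u k).
  assert (Hagp : dform n c a gp = 0) by (unfold gp; rewrite dform_comb, Hay, Hau; ring).
  assert (Hagm : dform n c a gm = 0) by (unfold gm; rewrite dform_comb, Hay, Hau; ring).
  assert (Hygp : dform n c y gp = (1 + yy) / 2).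
  { unfold gp; rewrite dform_comb, (dform_sym n c y u), Huy. fold yy. field. }
  assert (Hygm : dform n c y gm = (yy - 1) / 2).
  { unfold gm; rewrite dform_comb, (dform_sym n c y u), Huy. fold yy. field. }
  assert (Hugp : dform n c u gp = 1) by (unfold gp; rewrite dform_comb, Huy, Huu; ring).
  assert (Hugm : dform n c u gm = 1) by (unfold gm; rewrite dform_comb, Huy, Huu; ring).
  assert (Hpp : dform n c gp gp = 1).
  { unfold gp at 2. rewrite dform_comb, (dform_sym n c gp y), (dform_sym n c gp u), Hygp, Hugp. field. }
  assert (Hmm : dform n c gm gm = -1).
  { unfold gm at 2. rewrite dform_comb, (dform_sym n c gm y), (dform_sym n c gm u), Hygm, Hugm. field. }
  assert (Hpm : dform n c gp gm = 0).
  { unfold gm. rewrite dform_comb, (dform_sym n c gp y), (dform_sym n c gp u), Hygp, Hugp. field. }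
  set (g0 := fun i => match i with O => a | S O => gp | _ => gm end).
  destruct (orth_extend n c 3 g0 Hc Hn) as [g [Hg0 Hg]].
  { split.
    - intros i j Hi Hj Hij.
      destruct i as [|[|[|i]]]; try lia; destruct j as [|[|[|j]]]; try lia; unfold g0;
        auto; rewrite dform_sym; auto.
    - intros i Hi. destruct i as [|[|[|i]]]; try lia; unfold g0; auto; lra. }
  assert (E0 : g 0%nat = a) by (apply (Hg0 0%nat); lia).
  assert (E1 : g 1%nat = gp) by (apply (Hg0 1%nat); lia).
  assert (E2 : g 2%nat = gm) by (apply (Hg0 2%nat); lia).
  exists (fun i => g (3 + i)%nat). split; [|split].
  - destruct Hg as [H1 H2]. split; intros; [apply H1|apply H2]; lia.
  - intros i Hi. destruct Hg as [H1 _].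
    assert (Ha := H1 0%nat (3 + i)%nat ltac:(lia) ltac:(lia) ltac:(lia)).
    assert (Hp := H1 (3 + i)%nat 1%nat ltac:(lia) ltac:(lia) ltac:(lia)).
    assert (Hm := H1 (3 + i)%nat 2%nat ltac:(lia) ltac:(lia) ltac:(lia)).
    rewrite E0 in Ha. rewrite E1 in Hp. rewrite E2 in Hm. split; auto.
    replace u with (fun k => gp k + (-1) * gm k).
    + rewrite dform_sym, dform_comb, Hp, Hm. ring.
    + apply functional_extensionality. intros k. unfold gp, gm. field.
  - rewrite <- (sylvester n c g Hc Hg).
    replace n with (3 + (n - 3))%nat at 1 by lia. rewrite ncount_app.
    simpl ncount at 1. rewrite E0, E1, E2, Hpp, Hmm. f_equal.
    assert (X1 : is_neg 1 = false) by (unfold is_neg; destruct (Rlt_dec 1 0); auto; lra).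
    assert (X2 : is_neg (-1) = true) by (unfold is_neg; destruct (Rlt_dec (-1) 0); auto; lra).
    rewrite X1, X2. lia.
Qed.

(** * Second order jets on a box *)

Lemma shiftk_0 (x : nat -> R) (j : nat) : shiftk x j 0 = x.
Proof.
  apply functional_extensionality. intros m. unfold shiftk.
  destruct (Nat.eqb m j); lra.
Qed.

Lemma InBox_shiftk (k : nat) (r : R) (x : nat -> R) (j : nat) :
  (j < k)%nat -> InBox k r x ->
  exists d, 0 < d /\ forall t, Rabs t < d -> InBox k r (shiftk x j t).
Proof.
  intros Hj [H0 H1]. exists (r - Rabs (x j)). split.
  - specialize (H1 j Hj). lra.
  - intros t Ht. unfold shiftk. split; intros m Hm; destruct (Nat.eqb_spec m j) as [->|Hne]; auto.
    + lia.
    + eapply Rle_lt_trans; [apply Rabs_triang|]. lra.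
Qed.

Lemma InBox_zerov (k : nat) (r : R) : 0 < r -> InBox k r zerov.
Proof. intros H. split; intros; unfold zerov; auto. rewrite Rabs_R0; auto. Qed.

Lemma InBox_le (k : nat) (r r' : R) (x : nat -> R) : r' <= r -> InBox k r' x -> InBox k r x.
Proof. intros H [H0 H1]. split; auto. intros m Hm. specialize (H1 m Hm). lra. Qed.

Section Box.
Variables (k : nat) (r : R).

Lemma has_partial_ext (g g' : (nat -> R) -> R) (j : nat) (x : nat -> R) (d : R) :
  (j < k)%nat -> InBox k r x -> (forall y, InBox k r y -> g y = g' y) ->
  has_partial g' j x d -> has_partial g j x d.
Proof.
  intros Hj Hx Hg Hd eps Heps.
  destruct (InBox_shiftk k r x j Hj Hx) as [d0 [Hd0 Hb]].
  destruct (Hd eps Heps) as [d1 H1].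
  assert (Hm : 0 < Rmin d0 d1) by (apply Rmin_pos; [auto|apply cond_pos]).
  exists (mkposreal _ Hm). simpl. intros h Hh0 Hh.
  pose proof (Rmin_l d0 d1). pose proof (Rmin_r d0 d1).
  rewrite (Hg (shiftk x j (0 + h))), (Hg (shiftk x j 0)).
  - apply H1; auto. lra.
  - apply Hb. rewrite Rabs_R0; auto.
  - apply Hb. rewrite Rplus_0_l. lra.
Qed.

Lemma has_partial_plus (f g : (nat -> R) -> R) (j : nat) (x : nat -> R) (a b : R) :
  has_partial f j x a -> has_partial g j x b -> has_partial (fun y => f y + g y) j x (a + b).
Proof. intros Hf Hg. exact (derivable_pt_lim_plus _ _ _ _ _ Hf Hg). Qed.

Lemma has_partial_mult (f g : (nat -> R) -> R) (j : nat) (x : nat -> R) (a b : R) :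
  has_partial f j x a -> has_partial g j x b ->
  has_partial (fun y => f y * g y) j x (a * g x + f x * b).
Proof.
  intros Hf Hg. pose proof (derivable_pt_lim_mult _ _ _ _ _ Hf Hg) as H.
  cbv beta in H. rewrite shiftk_0 in H. exact H.
Qed.

Lemma has_partial_comp (h : R -> R) (g : (nat -> R) -> R) (j : nat) (x : nat -> R) (a b : R) :
  has_partial g j x a -> derivable_pt_lim h (g x) b ->
  has_partial (fun y => h (g y)) j x (b * a).
Proof.
  intros Hg Hh. apply (derivable_pt_lim_comp (fun t => g (shiftk x j t)) h); auto.
  rewrite shiftk_0; auto.
Qed.

Lemma has_partial_const (c : R) (j : nat) (x : nat -> R) : has_partial (fun _ => c) j x 0.
Proof. apply (derivable_pt_lim_const c). Qed.

Lemma has_partial_coord (i j : nat) (x : nat -> R) :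
  has_partial (fun y => y i) j x (unitv j i).
Proof.
  unfold has_partial, unitv, shiftk. destruct (Nat.eqb i j).
  - replace 1 with (0 + 1) by ring.
    apply (derivable_pt_lim_plus (fun _ => x i) id).
    + apply derivable_pt_lim_const.
    + apply derivable_pt_lim_id.
  - apply (derivable_pt_lim_const (x i)).
Qed.

Lemma cont_on_ext (g g' : (nat -> R) -> R) :
  (forall y, InBox k r y -> g y = g' y) -> cont_on k r g' -> cont_on k r g.
Proof.
  intros Hg H x Hx eps He. destruct (H x Hx eps He) as [d [Hd H1]].
  exists d. split; auto. intros y Hy Hyx. rewrite !Hg by auto. auto.
Qed.

Lemma cont_on_const (c : R) : cont_on k r (fun _ => c).
Proof.
  intros x _ eps He. exists 1. split; [lra|]. intros. rewrite Rminus_diag, Rabs_R0; auto.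
Qed.

Lemma cont_on_coord (i : nat) : cont_on k r (fun y => y i).
Proof.
  intros x [Hx _] eps He. exists eps. split; auto. intros y [Hy _] H.
  destruct (Nat.lt_ge_cases i k) as [Hi|Hi]; auto.
  rewrite Hx, Hy, Rminus_diag, Rabs_R0; auto.
Qed.

Lemma cont_on_comp (h : R -> R) (g : (nat -> R) -> R) :
  cont_on k r g -> (forall x, InBox k r x -> continuity_pt h (g x)) ->
  cont_on k r (fun y => h (g y)).
Proof.
  intros Hg Hh x Hx eps He.
  destruct (Hh x Hx eps He) as [a [Ha H1]].
  destruct (Hg x Hx a Ha) as [d [Hd H2]].
  exists d. split; auto. intros y Hy Hyx.
  destruct (Req_EM_T (g x) (g y)) as [E|E].
  - rewrite E, Rminus_diag, Rabs_R0; auto.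
  - apply (H1 (g y)). split; [split; [exact I|auto]|]. apply H2; auto.
Qed.

Lemma cont_on_plus (f g : (nat -> R) -> R) :
  cont_on k r f -> cont_on k r g -> cont_on k r (fun y => f y + g y).
Proof.
  intros Hf Hg x Hx eps He.
  destruct (Hf x Hx (eps / 2)) as [d1 [Hd1 H1]]; [lra|].
  destruct (Hg x Hx (eps / 2)) as [d2 [Hd2 H2]]; [lra|].
  exists (Rmin d1 d2). split; [apply Rmin_pos; auto|].
  intros y Hy Hyx.
  pose proof (Rmin_l d1 d2). pose proof (Rmin_r d1 d2).
  specialize (H1 y Hy). specialize (H2 y Hy).
  replace (f y + g y - (f x + g x)) with ((f y - f x) + (g y - g x)) by ring.
  eapply Rle_lt_trans; [apply Rabs_triang|].
  assert (Rabs (f y - f x) < eps / 2) by (apply H1; intros m Hm; specialize (Hyx m Hm); lra).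
  assert (Rabs (g y - g x) < eps / 2) by (apply H2; intros m Hm; specialize (Hyx m Hm); lra).
  lra.
Qed.

Lemma cont_on_scal (c : R) (g : (nat -> R) -> R) :
  cont_on k r g -> cont_on k r (fun y => c * g y).
Proof.
  intros Hg. apply (cont_on_comp (fun z => c * z)); auto.
  intros x _. reg.
Qed.

(* [f g] is half of [(f+g)^2 - f^2 - g^2], so continuity of products reduces to squaring. *)
Lemma cont_on_mult (f g : (nat -> R) -> R) :
  cont_on k r f -> cont_on k r g -> cont_on k r (fun y => f y * g y).
Proof.
  intros Hf Hg.
  assert (Hsq : forall h, cont_on k r h -> cont_on k r (fun y => h y * h y)).
  { intros h Hh. apply (cont_on_comp (fun z => z * z)); auto. intros x _. reg. }
  apply (cont_on_ext _ (fun y => / 2 * ((f y + g y) * (f y + g y) +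
           ((-1) * (f y * f y) + (-1) * (g y * g y))))).
  - intros y _. field.
  - apply cont_on_scal. apply cont_on_plus.
    + apply (Hsq (fun y => f y + g y)). apply cont_on_plus; auto.
    + apply cont_on_plus; apply cont_on_scal; auto.
Qed.

(** Regularity on the whole box together with value, gradient and Hessian at the origin. The rules
    below propagate both at once, so the smoothness of the chart and its derivatives come out of the
    same composition. *)
Definition Jet (f : (nat -> R) -> R) (f0 : R) (f1 : nat -> R) (f2 : nat -> nat -> R) : Prop :=
  exists D1 D2, C2data k r f D1 D2 /\ f zerov = f0 /\
    (forall i, (i < k)%nat -> D1 i zerov = f1 i) /\
    (forall i j, (i < k)%nat -> (j < k)%nat -> D2 i j zerov = f2 i j).

Lemma Jet_ext (f g : (nat -> R) -> R) (f0 : R) (f1 : nat -> R) (f2 : nat -> nat -> R) :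
  0 < r -> (forall y, InBox k r y -> f y = g y) -> Jet g f0 f1 f2 -> Jet f f0 f1 f2.
Proof.
  intros Hr H [D1 [D2 [[H1 [H2 [H3 [H4 H5]]]] [H6 H7]]]].
  exists D1, D2. split; [|split; [rewrite H; auto; apply InBox_zerov; auto|auto]].
  repeat split; auto.
  - apply (cont_on_ext _ g); auto.
  - intros i x Hi Hx. apply (has_partial_ext f g); auto.
Qed.

Lemma Jet_val (f : (nat -> R) -> R) f0 f1 f2 f0' f1' f2' :
  Jet f f0 f1 f2 -> f0 = f0' -> (forall i, (i < k)%nat -> f1 i = f1' i) ->
  (forall i j, (i < k)%nat -> (j < k)%nat -> f2 i j = f2' i j) -> Jet f f0' f1' f2'.
Proof.
  intros [D1 [D2 [H [H0 [H1 H2]]]]] E0 E1 E2. exists D1, D2. repeat split; try apply H.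
  - congruence.
  - intros i Hi. rewrite H1, E1; auto.
  - intros i j Hi Hj. rewrite H2, E2; auto.
Qed.

Lemma Jet_const (c : R) : Jet (fun _ => c) c (fun _ => 0) (fun _ _ => 0).
Proof.
  exists (fun _ _ => 0), (fun _ _ _ => 0). repeat split; auto; intros;
    first [apply cont_on_const | apply has_partial_const].
Qed.

Lemma Jet_coord (i : nat) :
  Jet (fun y => y i) 0 (fun j => unitv j i) (fun _ _ => 0).
Proof.
  exists (fun j _ => unitv j i), (fun _ _ _ => 0). repeat split; auto; intros;
    first [apply cont_on_const | apply cont_on_coord | apply has_partial_const
          | apply has_partial_coord].
Qed.

Lemma Jet_plus (f g : (nat -> R) -> R) f0 f1 f2 g0 g1 g2 :
  Jet f f0 f1 f2 -> Jet g g0 g1 g2 ->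
  Jet (fun y => f y + g y) (f0 + g0) (fun i => f1 i + g1 i) (fun i j => f2 i j + g2 i j).
Proof.
  intros [D1 [D2 [[H1 [H2 [H3 [H4 H5]]]] [H6 [H7 H8]]]]]
         [E1 [E2 [[K1 [K2 [K3 [K4 K5]]]] [K6 [K7 K8]]]]].
  exists (fun i x => D1 i x + E1 i x), (fun i j x => D2 i j x + E2 i j x).
  repeat split; intros.
  - apply cont_on_plus; auto.
  - apply has_partial_plus; auto.
  - apply cont_on_plus; auto.
  - apply has_partial_plus; auto.
  - apply cont_on_plus; auto.
  - congruence.
  - rewrite H7, K7; auto.
  - rewrite H8, K8; auto.
Qed.

Lemma Jet_mult (f g : (nat -> R) -> R) f0 f1 f2 g0 g1 g2 :
  Jet f f0 f1 f2 -> Jet g g0 g1 g2 ->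
  Jet (fun y => f y * g y) (f0 * g0) (fun i => f1 i * g0 + f0 * g1 i)
    (fun i j => (f2 i j * g0 + f1 i * g1 j) + (f1 j * g1 i + f0 * g2 i j)).
Proof.
  intros [D1 [D2 [[H1 [H2 [H3 [H4 H5]]]] [H6 [H7 H8]]]]]
         [E1 [E2 [[K1 [K2 [K3 [K4 K5]]]] [K6 [K7 K8]]]]].
  exists (fun i x => D1 i x * g x + f x * E1 i x),
    (fun i j x => (D2 i j x * g x + D1 i x * E1 j x) + (D1 j x * E1 i x + f x * E2 i j x)).
  repeat split; intros.
  - apply cont_on_mult; auto.
  - apply has_partial_mult; auto.
  - apply cont_on_plus; apply cont_on_mult; auto.
  - apply has_partial_plus; apply has_partial_mult; auto.
  - repeat apply cont_on_plus; apply cont_on_mult; auto.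
  - congruence.
  - rewrite H7, K7, H6, K6; auto.
  - rewrite H8, K8, !H7, !K7, H6, K6; auto.
Qed.

Lemma Jet_comp (h h1 h2 : R -> R) (g : (nat -> R) -> R) g0 g1 g2 :
  Jet g g0 g1 g2 ->
  (forall x, InBox k r x -> derivable_pt_lim h (g x) (h1 (g x)) /\
     derivable_pt_lim h1 (g x) (h2 (g x)) /\ continuity_pt h2 (g x)) ->
  Jet (fun y => h (g y)) (h g0) (fun i => h1 g0 * g1 i)
    (fun i j => (h2 g0 * g1 j) * g1 i + h1 g0 * g2 i j).
Proof.
  intros [E1 [E2 [[K1 [K2 [K3 [K4 K5]]]] [K6 [K7 K8]]]]] Hh.
  assert (C1 : cont_on k r (fun y => h1 (g y))).
  { apply (cont_on_comp h1); auto. intros x Hx. apply derivable_continuous_pt.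
    exists (h2 (g x)). apply Hh; auto. }
  exists (fun i x => h1 (g x) * E1 i x),
    (fun i j x => (h2 (g x) * E1 j x) * E1 i x + h1 (g x) * E2 i j x).
  repeat split; intros.
  - apply (cont_on_comp h); auto. intros x Hx. apply derivable_continuous_pt.
    exists (h1 (g x)). apply Hh; auto.
  - apply (has_partial_comp h); auto. apply Hh; auto.
  - apply cont_on_mult; auto.
  - apply (has_partial_mult (fun y => h1 (g y)) (E1 i)); auto.
    apply (has_partial_comp h1); auto. apply Hh; auto.
  - apply cont_on_plus; apply cont_on_mult; auto. apply cont_on_mult; auto.
    apply (cont_on_comp h2); auto. intros x Hx. apply Hh; auto.
  - congruence.
  - rewrite K6, K7; auto.
  - rewrite K6, !K7, K8; auto.
Qed.

Lemma Jet_scal (c : R) (g : (nat -> R) -> R) g0 g1 g2 :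
  Jet g g0 g1 g2 -> Jet (fun y => c * g y) (c * g0) (fun i => c * g1 i) (fun i j => c * g2 i j).
Proof.
  intros Hg. eapply Jet_val; [apply (Jet_mult _ _ _ _ _ _ _ _ (Jet_const c) Hg)| | |];
    intros; simpl; ring.
Qed.

Lemma Jet_minus (f g : (nat -> R) -> R) f0 f1 f2 g0 g1 g2 :
  Jet f f0 f1 f2 -> Jet g g0 g1 g2 ->
  Jet (fun y => f y - g y) (f0 - g0) (fun i => f1 i - g1 i) (fun i j => f2 i j - g2 i j).
Proof.
  intros Hf Hg. pose proof (Jet_plus _ _ _ _ _ _ _ _ Hf (Jet_scal (-1) _ _ _ _ Hg)) as H.
  replace (fun y => f y - g y) with (fun y => f y + -1 * g y)
    by (apply functional_extensionality; intros; ring).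
  eapply Jet_val; [exact H| | |]; intros; simpl; ring.
Qed.

Lemma Jet_rsum (m : nat) (f : nat -> (nat -> R) -> R) f0 f1 f2 :
  (forall i, (i < m)%nat -> Jet (f i) (f0 i) (f1 i) (f2 i)) ->
  Jet (fun y => rsum m (fun i => f i y)) (rsum m f0) (fun a => rsum m (fun i => f1 i a))
    (fun a b => rsum m (fun i => f2 i a b)).
Proof.
  induction m as [|m IH]; intros H; simpl.
  - apply (Jet_const 0).
  - apply (Jet_plus _ _ _ _ _ _ _ _ (IH (fun i Hi => H i (Nat.lt_lt_succ_r _ _ Hi)))
             (H m (Nat.lt_succ_diag_r m))).
Qed.

Lemma Jet_cos (g : (nat -> R) -> R) g0 g1 g2 : Jet g g0 g1 g2 ->
  exists f2, Jet (fun y => cos (g y)) (cos g0) (fun i => - sin g0 * g1 i) f2.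
Proof.
  intros Hg. eexists.
  apply (Jet_comp cos (fun z => - sin z) (fun z => - cos z) g g0 g1 g2 Hg).
  intros x _. split; [|split].
  - apply derivable_pt_lim_cos.
  - apply (derivable_pt_lim_opp sin). apply derivable_pt_lim_sin.
  - apply (continuity_pt_opp cos). apply continuity_cos.
Qed.

Lemma Jet_sin (g : (nat -> R) -> R) g0 g1 g2 : Jet g g0 g1 g2 ->
  exists f2, Jet (fun y => sin (g y)) (sin g0) (fun i => cos g0 * g1 i) f2.
Proof.
  intros Hg. eexists.
  apply (Jet_comp sin cos (fun z => - sin z) g g0 g1 g2 Hg).
  intros x _. split; [|split].
  - apply derivable_pt_lim_sin.
  - apply derivable_pt_lim_cos.
  - apply (continuity_pt_opp sin). apply continuity_sin.
Qed.

Lemma Jet_inv (g : (nat -> R) -> R) g0 g1 g2 : Jet g g0 g1 g2 ->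
  (forall x, InBox k r x -> g x <> 0) ->
  exists f1 f2, Jet (fun y => / g y) (/ g0) f1 f2.
Proof.
  intros Hg Hne. eexists _, _.
  apply (Jet_comp (fun z => / z) (fun z => - (/ z * / z))
           (fun z => 2 * (/ z * / z * / z)) g g0 g1 g2 Hg).
  intros x Hx. specialize (Hne x Hx).
  assert (Hi : derivable_pt_lim (fun z => / z) (g x) (- (/ g x * / g x))).
  { replace (- (/ g x * / g x)) with ((0 * g x - 1 * 1) / Rsqr (g x))
      by (unfold Rsqr; field; auto).
    apply (derivable_pt_lim_ext (fun z => 1 / z)).
    - intros z. unfold Rdiv. ring.
    - apply (derivable_pt_lim_div (fun _ => 1) id); auto.
      + apply derivable_pt_lim_const.
      + apply derivable_pt_lim_id. }
  split; [auto|split].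
  - replace (2 * (/ g x * / g x * / g x))
      with (- (- (/ g x * / g x) * / g x + / g x * - (/ g x * / g x))) by ring.
    apply (derivable_pt_lim_opp (fun z => / z * / z)).
    apply (derivable_pt_lim_mult (fun z => / z) (fun z => / z)); auto.
  - reg; auto.
Qed.

Lemma Jet_sqrt (g : (nat -> R) -> R) g0 g1 g2 : Jet g g0 g1 g2 ->
  (forall x, InBox k r x -> 0 < g x) ->
  exists f1 f2, Jet (fun y => sqrt (g y)) (sqrt g0) f1 f2.
Proof.
  intros Hg Hpos. eexists _, _.
  apply (Jet_comp sqrt (fun z => / 2 * / sqrt z)
           (fun z => / 2 * (- (/ (2 * sqrt z) / (sqrt z * sqrt z)))) g g0 g1 g2 Hg).
  intros x Hx. specialize (Hpos x Hx).
  assert (Hs : 0 < sqrt (g x)) by (apply sqrt_lt_R0; auto).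
  split; [|split].
  - replace (/ 2 * / sqrt (g x)) with (/ (2 * sqrt (g x))) by (field; lra).
    apply derivable_pt_lim_sqrt; auto.
  - apply (derivable_pt_lim_ext (fun z => (/ 2) * (1 / sqrt z))).
    { intros z. unfold Rdiv. ring. }
    apply (derivable_pt_lim_scal (fun z => 1 / sqrt z)).
    replace (- (/ (2 * sqrt (g x)) / (sqrt (g x) * sqrt (g x))))
      with ((0 * sqrt (g x) - / (2 * sqrt (g x)) * 1) / Rsqr (sqrt (g x)))
      by (unfold Rsqr; field; lra).
    apply (derivable_pt_lim_div (fun _ => 1) sqrt).
    + apply derivable_pt_lim_const.
    + apply derivable_pt_lim_sqrt; auto.
    + lra.
  - assert (Hc : continuity_pt sqrt (g x)) by (apply continuity_pt_sqrt; lra).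
    apply (continuity_pt_mult (fun _ => / 2)); [apply continuity_pt_const; intros ? ?; auto|].
    apply (continuity_pt_opp (fun z => / (2 * sqrt z) / (sqrt z * sqrt z))).
    apply (continuity_pt_div (fun z => / (2 * sqrt z)) (fun z => sqrt z * sqrt z)).
    + apply (continuity_pt_inv (fun z => 2 * sqrt z)); [|lra].
      apply (continuity_pt_mult (fun _ => 2)); auto.
      apply continuity_pt_const; intros ? ?; auto.
    + apply (continuity_pt_mult sqrt sqrt); auto.
    + nra.
Qed.

End Box.

Lemma Jet_le (k : nat) (r r' : R) f f0 f1 f2 : r' <= r ->
  Jet k r f f0 f1 f2 -> Jet k r' f f0 f1 f2.
Proof.
  intros Hr [D1 [D2 [[H1 [H2 [H3 [H4 H5]]]] H6]]].
  assert (Hc : forall g, cont_on k r g -> cont_on k r' g).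
  { intros g Hg x Hx eps He.
    destruct (Hg x (InBox_le k r r' x Hr Hx) eps He) as [d [Hd H]].
    exists d. split; auto. intros y Hy. apply H. apply (InBox_le k r r'); auto. }
  exists D1, D2. split; auto. repeat split; auto; intros.
  - apply H2; auto. apply (InBox_le k r r'); auto.
  - apply H4; auto. apply (InBox_le k r r'); auto.
Qed.

Lemma Jet_pos_near (k : nat) (r : R) f f0 f1 f2 : 0 < r ->
  Jet k r f f0 f1 f2 -> 0 < f0 ->
  exists r', 0 < r' <= r /\ forall x, InBox k r' x -> 0 < f x.
Proof.
  intros Hr [D1 [D2 [[H1 _] [H6 _]]]] Hf0.
  destruct (H1 zerov (InBox_zerov k r Hr) f0 Hf0) as [d [Hd H]].
  exists (Rmin r d). split.
  - split; [apply Rmin_pos; auto|apply Rmin_l].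
  - intros x Hx.
    assert (Hlt : Rabs (f x - f zerov) < f0).
    { apply H.
      - apply (InBox_le k r (Rmin r d)); auto. apply Rmin_l.
      - intros m Hm. unfold zerov. rewrite Rminus_0_r. destruct Hx as [_ Hx].
        specialize (Hx m Hm). pose proof (Rmin_r r d). lra. }
    rewrite H6 in Hlt. apply Rabs_def2 in Hlt. lra.
Qed.

Lemma Jet_IsC2 (k : nat) (r : R) f f0 f1 f2 : Jet k r f f0 f1 f2 -> IsC2 k r f.
Proof. intros [D1 [D2 [H _]]]. exists D1, D2. exact H. Qed.

Lemma Jet_partial (k : nat) (r : R) f f0 f1 f2 (j : nat) : 0 < r -> (j < k)%nat ->
  Jet k r f f0 f1 f2 -> has_partial f j zerov (f1 j).
Proof.
  intros Hr Hj [D1 [D2 [[_ [H _]] [_ [H1 _]]]]]. rewrite <- H1 by auto.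
  apply H; auto. apply InBox_zerov; auto.
Qed.

(** The Hessian is left existential: it has to exist, but only the gradients of the chart enter the
    Hessian of the area. *)
Definition Jet1 (k : nat) (r : R) (f : (nat -> R) -> R) (f0 : R) (f1 : nat -> R) : Prop :=
  exists f2, Jet k r f f0 f1 f2.

Lemma Jet1_ext (k : nat) (r : R) (f g : (nat -> R) -> R) f0 f1 : 0 < r ->
  (forall y, InBox k r y -> f y = g y) -> Jet1 k r g f0 f1 -> Jet1 k r f f0 f1.
Proof. intros Hr H [f2 Hg]. exists f2. apply (Jet_ext k r f g); auto. Qed.

Lemma Jet1_val (k : nat) (r : R) (f : (nat -> R) -> R) f0 f1 f0' f1' :
  Jet1 k r f f0 f1 -> f0 = f0' -> (forall i, (i < k)%nat -> f1 i = f1' i) ->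
  Jet1 k r f f0' f1'.
Proof. intros [f2 Hf] E0 E1. exists f2. eapply Jet_val; eauto. Qed.

Lemma Jet1_const (k : nat) (r c : R) : Jet1 k r (fun _ => c) c (fun _ => 0).
Proof. eexists; apply Jet_const. Qed.

Lemma Jet1_plus (k : nat) (r : R) (f g : (nat -> R) -> R) f0 f1 g0 g1 :
  Jet1 k r f f0 f1 -> Jet1 k r g g0 g1 ->
  Jet1 k r (fun y => f y + g y) (f0 + g0) (fun i => f1 i + g1 i).
Proof. intros [f2 Hf] [g2 Hg]. eexists. apply Jet_plus; eassumption. Qed.

Lemma Jet1_minus (k : nat) (r : R) (f g : (nat -> R) -> R) f0 f1 g0 g1 :
  Jet1 k r f f0 f1 -> Jet1 k r g g0 g1 ->
  Jet1 k r (fun y => f y - g y) (f0 - g0) (fun i => f1 i - g1 i).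
Proof. intros [f2 Hf] [g2 Hg]. eexists. apply Jet_minus; eassumption. Qed.

Lemma Jet1_mult (k : nat) (r : R) (f g : (nat -> R) -> R) f0 f1 g0 g1 :
  Jet1 k r f f0 f1 -> Jet1 k r g g0 g1 ->
  Jet1 k r (fun y => f y * g y) (f0 * g0) (fun i => f1 i * g0 + f0 * g1 i).
Proof. intros [f2 Hf] [g2 Hg]. eexists. apply Jet_mult; eassumption. Qed.

Lemma Jet1_scal (k : nat) (r c : R) (f : (nat -> R) -> R) f0 f1 :
  Jet1 k r f f0 f1 -> Jet1 k r (fun y => c * f y) (c * f0) (fun i => c * f1 i).
Proof. intros [f2 Hf]. eexists. apply Jet_scal; eassumption. Qed.

Lemma Jet1_rsum (k : nat) (r : R) (m : nat) (f : nat -> (nat -> R) -> R) f0 f1 :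
  (forall i, (i < m)%nat -> Jet1 k r (f i) (f0 i) (f1 i)) ->
  Jet1 k r (fun y => rsum m (fun i => f i y)) (rsum m f0) (fun a => rsum m (fun i => f1 i a)).
Proof.
  induction m as [|m IH]; intros H; simpl.
  - apply (Jet1_const k r 0).
  - apply Jet1_plus; [apply IH; auto with arith|apply H; auto].
Qed.

Lemma Jet1_le (k : nat) (r r' : R) f f0 f1 : r' <= r -> Jet1 k r f f0 f1 -> Jet1 k r' f f0 f1.
Proof. intros Hr [f2 Hf]. exists f2. apply (Jet_le k r); auto. Qed.

(** Makes implicit differentiation possible: a function known to be constant on the box has zero
    gradient, whatever formula produced its jet. *)
Lemma Jet1_unique (k : nat) (r : R) f f0 f1 g0 g1 (j : nat) : 0 < r -> (j < k)%nat ->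
  Jet1 k r f f0 f1 -> Jet1 k r f g0 g1 -> f1 j = g1 j.
Proof.
  intros Hr Hj [f2 Hf] [g2 Hg].
  apply (uniqueness_limite (fun t => f (shiftk zerov j t)) 0).
  - apply (Jet_partial k r f f0 f1 f2); auto.
  - apply (Jet_partial k r f g0 g1 g2); auto.
Qed.

Lemma Jet1_f0 (k : nat) (r : R) f f0 f1 : Jet1 k r f f0 f1 -> f zerov = f0.
Proof. intros [f2 [D1 [D2 [_ [H _]]]]]. exact H. Qed.

(** * Planar vectors, triangles and finite families *)

Definition rot90 (a : pt) : pt := (- snd a, fst a).

Lemma dist_eq_iff (a b : pt) (l : R) : 0 < l ->
  (dist a b = l <-> dot (psub a b) (psub a b) = l * l).
Proof.
  intros Hl. unfold dist, norm.
  assert (H : 0 <= dot (psub a b) (psub a b)) by (unfold dot; nra).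
  split; intros E.
  - rewrite <- E. symmetry. apply sqrt_sqrt; auto.
  - rewrite E. apply sqrt_square; lra.
Qed.

Lemma dot_psub_sym (a b : pt) : dot (psub a b) (psub a b) = dot (psub b a) (psub b a).
Proof. unfold dot, psub; simpl. ring. Qed.

Lemma dist_coords (a b : pt) (eps : R) : dist a b < eps ->
  Rabs (fst a - fst b) < eps /\ Rabs (snd a - snd b) < eps.
Proof.
  unfold dist, norm, dot, psub; simpl. set (x := fst a - fst b). set (y := snd a - snd b).
  intros H. split; eapply Rle_lt_trans; try exact H.
  - rewrite <- (sqrt_Rsqr_abs x). apply sqrt_le_1_alt. unfold Rsqr. nra.
  - rewrite <- (sqrt_Rsqr_abs y). apply sqrt_le_1_alt. unfold Rsqr. nra.
Qed.

(** Reading the end index modulo [n] includes [i = n], where the telescoping sum vanishes because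
    the polygon closes. *)
Lemma rsum_edges (n i : nat) (f : nat -> R) : (i <= n)%nat -> (0 < n)%nat ->
  rsum i (fun m => f (nxt n m) - f m) = f (i mod n)%nat - f 0%nat.
Proof.
  intros Hi Hn. induction i as [|i IH]; simpl.
  - rewrite Nat.Div0.mod_0_l. lra.
  - rewrite IH by lia. rewrite (Nat.mod_small i n) by lia.
    unfold nxt. rewrite Nat.add_1_r. lra.
Qed.

Lemma nxt_lt (n i : nat) : (0 < n)%nat -> (nxt n i < n)%nat.
Proof. intros. apply Nat.mod_upper_bound. lia. Qed.

(* The third vertex of a triangle with base [d] and sides [lp], [lq]. *)
Lemma circle_inter (d v : pt) (lp lq sg : R) :
  dot v v = lp * lp -> dot (psub d v) (psub d v) = lq * lq ->
  sg * sg = 1 -> 0 < sg * cross d v ->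
  let D := / dot d d in let Ac := / 2 + (lp * lp - lq * lq) / 2 * D in
  0 < dot d d /\ 0 < lp * lp * D - Ac * Ac /\
  v = (Ac * fst d - sg * sqrt (lp * lp * D - Ac * Ac) * snd d,
       Ac * snd d + sg * sqrt (lp * lp * D - Ac * Ac) * fst d).
Proof.
  destruct d as [d1 d2]; destruct v as [v1 v2]. unfold dot, psub, cross; simpl.
  intros Hp Hq Hs Hc.
  assert (HD : 0 < d1 * d1 + d2 * d2).
  { destruct (Req_dec d1 0) as [->|]; [|nra]. destruct (Req_dec d2 0) as [->|]; [lra|nra]. }
  set (DD := d1 * d1 + d2 * d2) in *.
  set (B := (d1 * v2 - d2 * v1) / DD).
  assert (HA : / 2 + (lp * lp - lq * lq) / 2 * / DD = (d1 * v1 + d2 * v2) / DD).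
  { rewrite <- Hp, <- Hq. unfold DD. field. unfold DD in HD. lra. }
  rewrite HA.
  assert (HB : lp * lp * / DD - (d1 * v1 + d2 * v2) / DD * ((d1 * v1 + d2 * v2) / DD)
               = (sg * B) * (sg * B)).
  { replace (sg * B * (sg * B)) with ((sg * sg) * (B * B)) by ring. rewrite Hs.
    rewrite <- Hp. unfold B, DD. field. unfold DD in HD. lra. }
  assert (HsB : 0 < sg * B).
  { unfold B. replace (sg * ((d1 * v2 - d2 * v1) / DD))
      with ((sg * (d1 * v2 - d2 * v1)) / DD) by (field; lra).
    apply Rdiv_lt_0_compat; auto. }
  rewrite HB. split; [auto|split; [nra|]].
  rewrite sqrt_square by lra.
  replace (sg * (sg * B)) with ((sg * sg) * B) by ring. rewrite Hs.
  unfold B, DD. f_equal; field; unfold DD in HD; lra.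
Qed.

Lemma fin_choice {A : Type} (a0 : A) (m : nat) (Rl : nat -> A -> Prop) :
  (forall i, (i < m)%nat -> exists y, Rl i y) ->
  exists Y : nat -> A, forall i, (i < m)%nat -> Rl i (Y i).
Proof.
  induction m as [|m IH]; intros H.
  - exists (fun _ => a0). intros; lia.
  - destruct IH as [Y HY]; [auto with arith|]. destruct (H m) as [y Hy]; [auto|].
    exists (fun i => if Nat.eqb i m then y else Y i). intros i Hi.
    destruct (Nat.eqb_spec i m) as [->|]; auto. apply HY; lia.
Qed.

Lemma fin_eps (m : nat) (A : nat -> R -> Prop) :
  (forall i, (i < m)%nat -> exists e, 0 < e /\ forall e', 0 < e' <= e -> A i e') ->
  exists e, 0 < e /\ forall e', 0 < e' <= e -> forall i, (i < m)%nat -> A i e'.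
Proof.
  induction m as [|m IH]; intros H.
  - exists 1. split; [lra|]. intros; lia.
  - destruct IH as [e1 [He1 H1]]; [auto with arith|]. destruct (H m) as [e2 [He2 H2]]; [auto|].
    exists (Rmin e1 e2). split; [apply Rmin_pos; auto|].
    intros e' He' i Hi. pose proof (Rmin_l e1 e2). pose proof (Rmin_r e1 e2).
    destruct (Nat.eq_dec i m) as [->|]; [apply H2; lra|apply H1; [lra|lia]].
Qed.

(** Homogenisation: the right side [y] becomes the coefficient of an extra unknown [x k]. With one
    unknown too many there is a nonzero solution, and injectivity forces [x k <> 0], by which the
    solution is divided. *)
Lemma square_system (k : nat) (M : nat -> nat -> R) :
  (forall c, (forall i, (i < k)%nat -> rsum k (fun j => c j * M j i) = 0) ->
     forall j, (j < k)%nat -> c j = 0) ->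
  forall y : nat -> R, exists x, forall i, (i < k)%nat -> rsum k (fun j => x j * M j i) = y i.
Proof.
  intros Hinj y.
  destruct (hom_system (S k) (map (fun i j => if Nat.eqb j k then - y i else M j i) (seq 0 k)))
    as [x [[i0 [Hi0 Hx0]] Hx]].
  { rewrite length_map, length_seq; auto. }
  assert (H : forall i, (i < k)%nat -> rsum k (fun j => x j * M j i) = x k * y i).
  { intros i Hi.
    assert (E := Hx _ (in_map (fun i j => if Nat.eqb j k then - y i else M j i) _ i
                       (proj2 (in_seq k 0 i) (conj (Nat.le_0_l i) Hi)))).
    cbv beta in E. simpl in E. rewrite Nat.eqb_refl in E.
    rewrite (rsum_ext k _ (fun j => x j * M j i)) in E; [lra|].
    intros j Hj. destruct (Nat.eqb_spec j k); [lia|ring]. }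
  assert (Hk : x k <> 0).
  { intros Hk. apply Hx0. destruct (Nat.eq_dec i0 k) as [->|]; auto.
    apply Hinj; [|lia]. intros i Hi. rewrite H, Hk by auto. ring. }
  exists (fun j => / x k * x j). intros i Hi.
  rewrite (rsum_ext k _ (fun j => / x k * (x j * M j i))) by (intros; ring).
  rewrite rsum_scal, H by auto. field; auto.
Qed.

(** * A chart of the polygon space *)

Lemma asin_small (rho : R) : 0 < rho ->
  exists d, 0 < d /\ forall z, Rabs z < d -> Rabs (asin z) < rho.
Proof.
  intros Hr.
  destruct (derivable_continuous_pt asin 0 (derivable_pt_asin 0 ltac:(lra)) rho Hr)
    as [d [Hd H]].
  exists d. split; auto. intros z Hz.
  destruct (Req_EM_T 0 z) as [<-|Hne].
  - rewrite asin_0, Rabs_R0; auto.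
  - specialize (H z). simpl in H. unfold Rdist in H. rewrite asin_0, !Rminus_0_r in H.
    apply H. split; [split; [exact I|auto]|auto].
Qed.

(** The positive scalar product keeps the turning angle strictly within a quarter turn, where it is
    the arcsine of the normalised cross product. *)
Lemma rotation_angle (e f : pt) (l : R) : 0 < l ->
  dot e e = l * l -> dot f f = l * l -> 0 < dot e f ->
  let t := asin (cross e f / (l * l)) in
  fst f = fst e * cos t - snd e * sin t /\ snd f = snd e * cos t + fst e * sin t.
Proof.
  intros Hl He Hf Hd t.
  assert (Hll : 0 < l * l) by nra.
  set (z := cross e f / (l * l)) in *.
  set (w := dot e f / (l * l)).
  assert (Hw : 0 < w) by (apply Rdiv_lt_0_compat; auto).
  assert (Hzw : z * z + w * w = 1).
  { unfold z, w, cross, dot in *.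
    transitivity ((fst e * fst e + snd e * snd e) * (fst f * fst f + snd f * snd f)
                  / ((l * l) * (l * l))); [field; lra|].
    rewrite He, Hf. field. lra. }
  assert (Hz : -1 <= z <= 1) by nra.
  assert (Hsin : sin t = z) by (apply sin_asin; auto).
  assert (Hcos : cos t = w).
  { unfold t. rewrite cos_asin by auto.
    replace (1 - z²) with (w * w) by (unfold Rsqr; lra). apply sqrt_square; lra. }
  rewrite Hsin, Hcos. unfold z, w, cross, dot in *.
  assert (Hne : l * l <> 0) by lra.
  split; apply (Rmult_eq_reg_r (l * l)); auto.
  - transitivity (fst f * (fst e * fst e + snd e * snd e)); [rewrite He; ring|]. field. lra.
  - transitivity (snd f * (fst e * fst e + snd e * snd e)); [rewrite He; ring|]. field. lra.
Qed.

Lemma cross_dot_near (u v : pt) (d : R) : 0 < d -> exists e0, 0 < e0 /\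
  forall e u' v', 0 < e <= e0 ->
    Rabs (fst u' - fst u) < 2 * e -> Rabs (snd u' - snd u) < 2 * e ->
    Rabs (fst v' - fst v) < 2 * e -> Rabs (snd v' - snd v) < 2 * e ->
    Rabs (cross u' v' - cross u v) < d /\ Rabs (dot u' v' - dot u v) < d.
Proof.
  intros Hd. set (B := Rabs (fst u) + Rabs (snd u) + Rabs (fst v) + Rabs (snd v)).
  assert (HB : 0 <= B) by (unfold B; repeat apply Rplus_le_le_0_compat; apply Rabs_pos).
  assert (Hq : 0 < d / (2 * B + 8)) by (apply Rdiv_lt_0_compat; lra).
  (* For [e <= 1] a product [a * b] changes by less than [2 * e * (Rabs a + Rabs b) + 4 * e]. Both
     [cross] and [dot] contain two products, which adds up to [e * (2 * B + 8)]. *)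
  exists (Rmin 1 (d / (2 * B + 8))). split; [apply Rmin_pos; lra|].
  intros e u' v' [He0 He] A1 A2 B1 B2.
  assert (He1 : e <= 1) by (eapply Rle_trans; [exact He|apply Rmin_l]).
  assert (He2 : e * (2 * B + 8) <= d).
  { apply (Rle_trans _ (d / (2 * B + 8) * (2 * B + 8))); [|right; field; lra].
    apply Rmult_le_compat_r; [lra|]. eapply Rle_trans; [exact He|apply Rmin_r]. }
  assert (Hp : forall a b a' b', Rabs (a' - a) < 2 * e -> Rabs (b' - b) < 2 * e ->
            Rabs (a' * b' - a * b) < 2 * e * (Rabs a + Rabs b) + 4 * e).
  { intros a b a' b' Ha Hb.
    replace (a' * b' - a * b) with ((a' - a) * (b' - b) + (a * (b' - b) + (a' - a) * b)) by ring.
    eapply Rle_lt_trans; [apply Rabs_triang|].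
    eapply Rle_lt_trans; [apply Rplus_le_compat_l, Rabs_triang|]. rewrite !Rabs_mult.
    pose proof (Rabs_pos a). pose proof (Rabs_pos b).
    pose proof (Rabs_pos (a' - a)). pose proof (Rabs_pos (b' - b)).
    assert (Rabs (a' - a) * Rabs (b' - b) < 2 * e * (2 * e)) by (apply Rmult_le_0_lt_compat; auto).
    nra. }
  pose proof (Hp _ _ _ _ A1 B1). pose proof (Hp _ _ _ _ A2 B2).
  pose proof (Hp _ _ _ _ A1 B2). pose proof (Hp _ _ _ _ A2 B1).
  assert (He3 : 2 * e * B + 8 * e <= d) by lra. unfold B in He3.
  unfold cross, dot. split; apply Rabs_def1;
    repeat match goal with H : Rabs (_ * _ - _) < _ |- _ => apply Rabs_def2 in H end; lra.
Qed.

Section Chart.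
Variables (n : nat) (l : nat -> R) (P : nat -> pt) (p : nat) (T : nat -> nat -> pt).

Let k := (n - 3)%nat.
Let e (m : nat) : pt := psub (P (nxt n m)) (P m).
Let dT (j m : nat) : pt := psub (T j (nxt n m)) (T j m).

Hypothesis Hn : (3 <= n)%nat.
Hypothesis Hl : forall i, (i < n)%nat -> 0 < l i.
Hypothesis HP : InL n l P.
Hypothesis Hp1 : (1 <= p)%nat.
Hypothesis Hp2 : (p + 2 <= n)%nat.
Hypothesis Hcr : cross (e p) (e (S p)) <> 0.
Hypothesis HT0 : forall j, (j < k)%nat -> T j 0%nat = (0, 0).
Hypothesis HT1 : forall j, (j < k)%nat -> T j 1%nat = (0, 0).
Hypothesis HTe : forall j m, (j < k)%nat -> (m < n)%nat -> dot (e m) (dT j m) = 0.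
Hypothesis HTi : forall c : nat -> R,
  (forall i, (i < n)%nat -> rsum k (fun j => c j * fst (T j i)) = 0 /\
                            rsum k (fun j => c j * snd (T j i)) = 0) ->
  forall j, (j < k)%nat -> c j = 0.

(** Preserved lengths make [dT j m] orthogonal to the edge [e m], hence equal to [xi j m] times its
    quarter turn: [xi] is the angular velocity of the edge. Turning the edge by the linear angle
    [Th m x] therefore reproduces [dT j m] to first order. *)
Let xi (j m : nat) : R := cross (e m) (dT j m) / dot (e m) (e m).
Let Th (m : nat) (x : nat -> R) : R := rsum k (fun j => x j * xi j m).
Let Ex (m : nat) (x : nat -> R) : R := fst (e m) * cos (Th m x) - snd (e m) * sin (Th m x).
Let Ey (m : nat) (x : nat -> R) : R := snd (e m) * cos (Th m x) + fst (e m) * sin (Th m x).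
Let Sx (i : nat) (x : nat -> R) : R := rsum i (fun m => Ex m x).
Let Sy (i : nat) (x : nat -> R) : R := rsum i (fun m => Ey m x).

Lemma chart_edge_sq (m : nat) : (m < n)%nat -> dot (e m) (e m) = l m * l m.
Proof.
  intros Hm. unfold e. rewrite dot_psub_sym. apply dist_eq_iff; auto. apply HP; auto.
Qed.

Lemma chart_edge_pos (m : nat) : (m < n)%nat -> 0 < dot (e m) (e m).
Proof. intros Hm. rewrite chart_edge_sq by auto. specialize (Hl m Hm). nra. Qed.

Lemma chart_dT (j m : nat) : (j < k)%nat -> (m < n)%nat ->
  fst (dT j m) = - snd (e m) * xi j m /\ snd (dT j m) = fst (e m) * xi j m.
Proof.
  intros Hj Hm. pose proof (HTe j m Hj Hm) as H. pose proof (chart_edge_pos m Hm) as Hp.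
  unfold xi. revert H Hp. generalize (e m) (dT j m). intros [a b] [u v].
  unfold dot, cross; simpl. intros H Hp.
  assert (Hne : a * a + b * b <> 0) by lra.
  split; apply (Rmult_eq_reg_r (a * a + b * b)); auto.
  - transitivity (- b * (a * v - b * u)); [|field; auto].
    replace u with ((a * a + b * b) * u / (a * a + b * b)) at 1 by (field; auto).
    transitivity (a * (a * u) + b * b * u); [field; auto|].
    replace (a * u) with (- (b * v)) by lra. ring.
  - transitivity (a * (a * v - b * u)); [|field; auto].
    transitivity (a * a * v + b * (b * v)); [ring|].
    replace (b * v) with (- (a * u)) by lra. ring.
Qed.

Lemma chart_xi0 (j : nat) : (j < k)%nat -> xi j 0%nat = 0.
Proof.
  intros Hj. unfold xi, dT, nxt. rewrite (Nat.mod_small (0 + 1) n) by lia.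
  change (0 + 1)%nat with 1%nat.
  rewrite HT0, HT1 by auto. unfold cross, psub; simpl. unfold Rdiv. ring.
Qed.

Lemma chart_Th_jet (r : R) (m : nat) : Jet1 k r (Th m) 0 (fun j => xi j m).
Proof.
  eapply Jet1_val.
  - apply (Jet1_rsum k r k (fun j x => x j * xi j m)
             (fun j => 0 * xi j m) (fun j i => unitv i j * xi j m + 0 * 0)).
    intros j Hj. apply (Jet1_mult k r (fun x => x j) (fun _ => xi j m)).
    + eexists; apply Jet_coord.
    + apply Jet1_const.
  - apply rsum_zero; intros; ring.
  - intros i Hi. cbv beta.
    rewrite <- (rsum_unitv k i (fun j => xi j m) Hi). apply rsum_ext; intros; ring.
Qed.

Lemma chart_E_jet (r : R) (m : nat) :
  Jet1 k r (Ex m) (fst (e m)) (fun j => - snd (e m) * xi j m) /\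
  Jet1 k r (Ey m) (snd (e m)) (fun j => fst (e m) * xi j m).
Proof.
  destruct (chart_Th_jet r m) as [f2 Hf].
  pose proof (Jet_cos k r _ _ _ _ Hf) as Hc. pose proof (Jet_sin k r _ _ _ _ Hf) as Hs.
  rewrite cos_0, sin_0 in *.
  split.
  - eapply Jet1_val.
    + apply (Jet1_minus k r _ _ _ _ _ _ (Jet1_scal k r (fst (e m)) _ _ _ Hc)
               (Jet1_scal k r (snd (e m)) _ _ _ Hs)).
    + ring.
    + intros; simpl; ring.
  - eapply Jet1_val.
    + apply (Jet1_plus k r _ _ _ _ _ _ (Jet1_scal k r (snd (e m)) _ _ _ Hc)
               (Jet1_scal k r (fst (e m)) _ _ _ Hs)).
    + ring.
    + intros; simpl; ring.
Qed.

Lemma chart_P0 : P 0%nat = (0, 0).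
Proof. apply HP. Qed.

Lemma chart_S_jet (r : R) (i : nat) : (i <= n)%nat ->
  Jet1 k r (Sx i) (fst (P (i mod n)%nat)) (fun j => fst (T j (i mod n)%nat)) /\
  Jet1 k r (Sy i) (snd (P (i mod n)%nat)) (fun j => snd (T j (i mod n)%nat)).
Proof.
  intros Hi.
  assert (Hgen : forall (c : pt -> R) F F1, c (0, 0) = 0 -> (forall u v, c (psub u v) = c u - c v) ->
     (forall m, Jet1 k r (F m) (c (e m)) (F1 m)) ->
     (forall m j, (m < n)%nat -> (j < k)%nat -> F1 m j = c (dT j m)) ->
     Jet1 k r (fun x => rsum i (fun m => F m x)) (c (P (i mod n)%nat)) (fun j => c (T j (i mod n)%nat))).
  { intros c F F1 Hc0 Hc HF HF1.
    assert (Hsum : forall V, V 0%nat = (0, 0) ->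
              rsum i (fun m => c (psub (V (nxt n m)) (V m))) = c (V (i mod n)%nat)).
    { intros V HV0.
      pose proof (rsum_edges n i (fun m => c (V m)) Hi ltac:(lia)) as H. cbv beta in H.
      rewrite HV0, Hc0, Rminus_0_r in H. rewrite <- H. apply rsum_ext. intros; apply Hc. }
    eapply Jet1_val; [apply (Jet1_rsum k r i F (fun m => c (e m)) F1); auto| |].
    - apply Hsum, chart_P0.
    - intros j Hj. rewrite <- (Hsum (T j) (HT0 j Hj)). apply rsum_ext. intros; apply HF1; lia. }
  split; [apply (Hgen fst Ex (fun m j => - snd (e m) * xi j m))
         |apply (Hgen snd Ey (fun m j => fst (e m) * xi j m))];
    auto; try (intros; apply chart_E_jet); intros; symmetry; apply chart_dT; auto.
Qed.

(** The turned edges close up only to first order, because each [T j] is a closed family of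
    displacements. Exact closing is left to the triangle with apex [S p]. *)
Lemma chart_Sn_jet (r : R) :
  Jet1 k r (Sx n) 0 (fun _ => 0) /\ Jet1 k r (Sy n) 0 (fun _ => 0).
Proof.
  destruct (chart_S_jet r n (Nat.le_refl n)) as [H1 H2].
  rewrite Nat.Div0.mod_same, chart_P0 in *. simpl in *.
  split; (eapply Jet1_val; [eassumption|reflexivity|]); intros j Hj; cbv beta;
    rewrite HT0 by auto; reflexivity.
Qed.

Let sg : R := if Rlt_dec 0 (cross (e (S p)) (e p)) then 1 else -1.
Let dx (x : nat -> R) : R := Sx (p + 2) x - Sx n x - Sx p x.
Let dy (x : nat -> R) : R := Sy (p + 2) x - Sy n x - Sy p x.
Let lp := l p.
Let lq := l (S p).
Let DD (x : nat -> R) : R := dx x * dx x + dy x * dy x.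
Let Ac (x : nat -> R) : R := / 2 + (lp * lp - lq * lq) / 2 * / DD x.
Let rad (x : nat -> R) : R := lp * lp * / DD x - Ac x * Ac x.
Let Mx (x : nat -> R) : R := Sx p x + (Ac x * dx x - sg * sqrt (rad x) * dy x).
Let My (x : nat -> R) : R := Sy p x + (Ac x * dy x + sg * sqrt (rad x) * dx x).

(** Vertices up to [p] are reached forwards from vertex [0], those from [p + 2] on backwards, since
    [Sx n - Sx i] sums the edges from [i] on. The turned copies of the edges [p] and [S p] thus
    cancel. Vertex [S p] is the apex of the triangle over the remaining gap [(dx, dy)], and [sg]
    selects the side of the gap on which it lies in [P]. *)
Definition chart_phi (x : nat -> R) (i : nat) : pt :=
  if Nat.leb i p then (Sx i x, Sy i x)
  else if Nat.eqb i (S p) then (Mx x, My x)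
  else (Sx i x - Sx n x, Sy i x - Sy n x).

Lemma chart_sg_sq : sg * sg = 1.
Proof. unfold sg. destruct (Rlt_dec 0 (cross (e (S p)) (e p))); ring. Qed.

Lemma cross_anti (a b : pt) : cross a b = - cross b a.
Proof. unfold cross; ring. Qed.

Lemma chart_sg_cross : 0 < sg * cross (e (S p)) (e p).
Proof.
  pose proof (cross_anti (e (S p)) (e p)) as H.
  unfold sg. destruct (Rlt_dec 0 (cross (e (S p)) (e p))); lra.
Qed.

Lemma Sp2_mod : ((p + 2) mod n)%nat = nxt n (S p).
Proof. unfold nxt. f_equal. lia. Qed.

Lemma nxt_p : nxt n p = S p.
Proof. unfold nxt. rewrite Nat.mod_small; lia. Qed.

Lemma chart_d_jet (r : R) :
  Jet1 k r dx (fst (P (nxt n (S p))) - fst (P p))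
    (fun j => fst (T j (nxt n (S p))) - fst (T j p)) /\
  Jet1 k r dy (snd (P (nxt n (S p))) - snd (P p))
    (fun j => snd (T j (nxt n (S p))) - snd (T j p)).
Proof.
  destruct (chart_S_jet r (p + 2) ltac:(lia)) as [A1 A2].
  destruct (chart_S_jet r p ltac:(lia)) as [B1 B2].
  destruct (chart_Sn_jet r) as [C1 C2].
  rewrite Sp2_mod in A1, A2. rewrite (Nat.mod_small p n) in B1, B2 by lia.
  split; (eapply Jet1_val;
    [apply Jet1_minus; [apply Jet1_minus|]; eassumption|ring|intros; simpl; ring]).
Qed.

Lemma chart_at0 : let d := psub (P (nxt n (S p))) (P p) in
  dx zerov = fst d /\ dy zerov = snd d /\ 0 < DD zerov /\ 0 < rad zerov /\
  Mx zerov = fst (P (S p)) /\ My zerov = snd (P (S p)).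
Proof.
  intros d.
  destruct (chart_d_jet 1) as [D1 D2]. apply Jet1_f0 in D1, D2.
  destruct (chart_S_jet 1 p ltac:(lia)) as [B1 B2]. apply Jet1_f0 in B1, B2.
  rewrite (Nat.mod_small p n) in B1, B2 by lia.
  assert (Hep : e p = psub (P (S p)) (P p)) by (unfold e; rewrite nxt_p; auto).
  assert (Heq : e (S p) = psub d (e p)).
  { rewrite Hep. unfold e, d, psub; simpl. f_equal; ring. }
  destruct (circle_inter d (e p) lp lq sg) as [K1 [K2 K3]].
  - apply chart_edge_sq; lia.
  - rewrite <- Heq. apply chart_edge_sq; lia.
  - apply chart_sg_sq.
  - replace (cross d (e p)) with (cross (e (S p)) (e p)).
    + apply chart_sg_cross.
    + rewrite Heq. unfold cross, psub; simpl. ring.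
  - split; [exact D1|]. split; [exact D2|].
    assert (HD : DD zerov = dot d d) by (unfold DD, dot; rewrite D1, D2; reflexivity).
    assert (HA : Ac zerov = / 2 + (lp * lp - lq * lq) / 2 * / dot d d)
      by (unfold Ac; rewrite HD; reflexivity).
    assert (HR : rad zerov = lp * lp * / dot d d -
       (/ 2 + (lp * lp - lq * lq) / 2 * / dot d d) * (/ 2 + (lp * lp - lq * lq) / 2 * / dot d d))
      by (unfold rad; rewrite HD, HA; reflexivity).
    split; [rewrite HD; auto|]. split; [rewrite HR; auto|].
    cbv zeta in K3. rewrite Hep in K3. unfold psub at 1 in K3. injection K3 as K3 K4.
    unfold Mx, My. rewrite HR, HA, D1, D2, B1, B2.
    split; [rewrite <- K3|rewrite <- K4]; ring.
Qed.

(** The box is shrunk twice, to keep the denominator [DD] and then the radicand positive. The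
    gradient of the apex stays unspecified here; [chart_jets] reads it off from the two side
    lengths. *)
Lemma chart_M_jet : exists r, 0 < r /\
  (forall x, InBox k r x -> 0 < DD x /\ 0 < rad x) /\
  exists X Y, Jet1 k r Mx (fst (P (S p))) X /\ Jet1 k r My (snd (P (S p))) Y.
Proof.
  destruct chart_at0 as [_ [_ [HD [HR [HMx HMy]]]]].
  destruct (chart_d_jet 1) as [D1 D2].
  assert (JD : exists a b, Jet1 k 1 DD a b).
  { eexists _, _. apply (Jet1_plus k 1 (fun x => dx x * dx x) (fun x => dy x * dy x));
      apply Jet1_mult; eassumption. }
  destruct JD as [a [b JD]]. pose proof (Jet1_f0 _ _ _ _ _ JD) as Ea.
  destruct JD as [b2 JD].
  destruct (Jet_pos_near k 1 DD a b b2) as [r1 [Hr1 Hpos1]]; auto; [lra|rewrite <- Ea; auto|].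
  assert (JI : exists a' b', Jet1 k r1 (fun x => / DD x) a' b').
  { destruct (Jet_inv k r1 DD a b b2) as [f1 [f2 H]].
    - apply (Jet_le k 1); [lra|auto].
    - intros x Hx. specialize (Hpos1 x Hx). lra.
    - exists (/ a), f1, f2. exact H. }
  destruct JI as [a' [b' JI]].
  assert (JA : exists a b, Jet1 k r1 Ac a b).
  { eexists _, _. apply (Jet1_plus k r1 (fun _ => / 2)); [apply Jet1_const|].
    apply Jet1_scal. exact JI. }
  destruct JA as [aA [bA JA]].
  assert (JR : exists a b, Jet1 k r1 rad a b).
  { eexists _, _. apply (Jet1_minus k r1 (fun x => lp * lp * / DD x) (fun x => Ac x * Ac x)).
    - apply Jet1_scal; exact JI.
    - apply Jet1_mult; exact JA. }
  destruct JR as [aR [bR JR]]. pose proof (Jet1_f0 _ _ _ _ _ JR) as EaR.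
  destruct JR as [b3 JR].
  destruct (Jet_pos_near k r1 rad aR bR b3) as [r2 [Hr2 Hpos2]]; auto; [lra|rewrite <- EaR; auto|].
  exists r2. split; [lra|]. split.
  { intros x Hx. split; auto. apply Hpos1. apply (InBox_le k r1 r2); auto. lra. }
  destruct (Jet_sqrt k r2 rad aR bR b3) as [f1 [f2 JS]]; auto.
  { apply (Jet_le k r1); [lra|auto]. }
  assert (JS1 : Jet1 k r2 (fun x => sg * sqrt (rad x)) (sg * sqrt aR) (fun i => sg * f1 i)).
  { apply Jet1_scal. exists f2. exact JS. }
  apply (Jet1_le k r1 r2) in JA; [|lra].
  destruct (chart_d_jet r2) as [D1' D2'].
  destruct (chart_S_jet r2 p ltac:(lia)) as [B1 B2].
  assert (XX : exists a X, Jet1 k r2 Mx a X).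
  { eexists _, _. apply (Jet1_plus k r2 (Sx p)); [exact B1|].
    apply (Jet1_minus k r2 (fun x => Ac x * dx x) (fun x => sg * sqrt (rad x) * dy x));
      apply Jet1_mult; eassumption. }
  assert (YY : exists a Y, Jet1 k r2 My a Y).
  { eexists _, _. apply (Jet1_plus k r2 (Sy p)); [exact B2|].
    apply (Jet1_plus k r2 (fun x => Ac x * dy x) (fun x => sg * sqrt (rad x) * dx x));
      apply Jet1_mult; eassumption. }
  destruct XX as [aX [X XX]]. destruct YY as [aY [Y YY]].
  exists X, Y. rewrite <- HMx, <- HMy.
  rewrite (Jet1_f0 _ _ _ _ _ XX), (Jet1_f0 _ _ _ _ _ YY). auto.
Qed.

Lemma chart_M_sides (x : nat -> R) : 0 < DD x -> 0 < rad x ->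
  (Mx x - Sx p x) * (Mx x - Sx p x) + (My x - Sy p x) * (My x - Sy p x) = lp * lp /\
  (Sx (p + 2) x - Sx n x - Mx x) * (Sx (p + 2) x - Sx n x - Mx x) +
  (Sy (p + 2) x - Sy n x - My x) * (Sy (p + 2) x - Sy n x - My x) = lq * lq.
Proof.
  intros HD HR.
  assert (Hs : sg * sqrt (rad x) * (sg * sqrt (rad x)) = rad x).
  { replace (sg * sqrt (rad x) * (sg * sqrt (rad x)))
      with ((sg * sg) * (sqrt (rad x) * sqrt (rad x))) by ring.
    rewrite chart_sg_sq, sqrt_sqrt by lra. ring. }
  set (q := sg * sqrt (rad x)) in *.
  assert (E1 : Mx x - Sx p x = Ac x * dx x - q * dy x) by (unfold Mx; fold q; ring).
  assert (E2 : My x - Sy p x = Ac x * dy x + q * dx x) by (unfold My; fold q; ring).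
  assert (E3 : Sx (p + 2) x - Sx n x - Mx x = (1 - Ac x) * dx x + q * dy x)
    by (unfold Mx, dx; fold q; unfold dx; ring).
  assert (E4 : Sy (p + 2) x - Sy n x - My x = (1 - Ac x) * dy x - q * dx x)
    by (unfold My, dy; fold q; unfold dy; ring).
  rewrite E1, E2, E3, E4.
  assert (F1 : (Ac x * Ac x + q * q) * DD x = lp * lp).
  { rewrite Hs. unfold rad. field. lra. }
  split.
  - rewrite <- F1. unfold DD. ring.
  - transitivity ((Ac x * Ac x + q * q) * DD x + (1 - 2 * Ac x) * DD x); [unfold DD; ring|].
    rewrite F1. unfold Ac. field. lra.
Qed.

Lemma chart_E_sq (m : nat) (x : nat -> R) : (m < n)%nat ->
  Ex m x * Ex m x + Ey m x * Ey m x = l m * l m.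
Proof.
  intros Hm. rewrite <- chart_edge_sq by auto. unfold Ex, Ey, dot.
  pose proof (sin2_cos2 (Th m x)) as H. unfold Rsqr in H.
  transitivity ((fst (e m) * fst (e m) + snd (e m) * snd (e m)) *
     (sin (Th m x) * sin (Th m x) + cos (Th m x) * cos (Th m x))); [ring|].
  rewrite H. ring.
Qed.

Lemma chart_Th0 (x : nat -> R) : Th 0%nat x = 0.
Proof. apply rsum_zero. intros j Hj. rewrite chart_xi0 by auto. ring. Qed.

Lemma chart_phi_le (x : nat -> R) (i : nat) : (i <= p)%nat -> chart_phi x i = (Sx i x, Sy i x).
Proof. intros H. unfold chart_phi. rewrite (proj2 (Nat.leb_le i p) H). auto. Qed.

Lemma chart_phi_M (x : nat -> R) : chart_phi x (S p) = (Mx x, My x).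
Proof.
  unfold chart_phi. rewrite Nat.eqb_refl.
  destruct (Nat.leb_spec (S p) p); [lia|auto].
Qed.

Lemma chart_phi_ge (x : nat -> R) (i : nat) : (p + 2 <= i)%nat ->
  chart_phi x i = (Sx i x - Sx n x, Sy i x - Sy n x).
Proof.
  intros H. unfold chart_phi. destruct (Nat.leb_spec i p); [lia|].
  destruct (Nat.eqb_spec i (S p)); [lia|auto].
Qed.

Lemma chart_phi_nxt (x : nat -> R) (i : nat) : (i < n)%nat ->
  chart_phi x (nxt n i) = chart_phi x (S i).
Proof.
  intros Hi. unfold nxt. rewrite Nat.add_1_r.
  destruct (Nat.eq_dec (S i) n) as [E|E].
  - rewrite E, Nat.Div0.mod_same, (chart_phi_le x 0) by lia. rewrite chart_phi_ge by lia.
    unfold Sx at 1, Sy at 1; simpl. f_equal; ring.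
  - rewrite Nat.mod_small by lia. auto.
Qed.

Lemma chart_InL (x : nat -> R) : 0 < DD x -> 0 < rad x -> InL n l (chart_phi x).
Proof.
  intros HD HR. split; [|split].
  - rewrite chart_phi_le by lia. reflexivity.
  - rewrite chart_phi_le by lia. unfold Sx, Sy; simpl. unfold Ex, Ey.
    rewrite chart_Th0, cos_0, sin_0.
    assert (He : e 0%nat = (l 0%nat, 0)).
    { unfold e, nxt. rewrite Nat.mod_small by lia. simpl (0 + 1)%nat.
      destruct HP as [H0 [H1 _]]. rewrite H0, H1. unfold psub; simpl. f_equal; ring. }
    rewrite He; simpl. f_equal; ring.
  - intros i Hi. rewrite chart_phi_nxt by auto. apply dist_eq_iff; auto.
    rewrite dot_psub_sym.
    destruct (chart_M_sides x HD HR) as [M1 M2].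
    destruct (Nat.lt_trichotomy i p) as [Hip|[->|Hip]].
    + rewrite !chart_phi_le by lia. rewrite <- (chart_E_sq i x Hi).
      unfold dot, psub, Sx, Sy; simpl. ring.
    + rewrite chart_phi_M, chart_phi_le by lia. unfold dot, psub; simpl. exact M1.
    + destruct (Nat.eq_dec i (S p)) as [->|Hne].
      * rewrite chart_phi_M. replace (S (S p)) with (p + 2)%nat by lia.
        rewrite chart_phi_ge by lia. unfold dot, psub; simpl fst; simpl snd. exact M2.
      * rewrite !chart_phi_ge by lia. rewrite <- (chart_E_sq i x Hi).
        unfold dot, psub, Sx, Sy; simpl. ring.
Qed.

Lemma chart_jets : exists r, 0 < r /\
  (forall x, InBox k r x -> 0 < DD x /\ 0 < rad x) /\
  forall i, (i < n)%nat ->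
    Jet1 k r (fun x => fst (chart_phi x i)) (fst (P i)) (fun j => fst (T j i)) /\
    Jet1 k r (fun x => snd (chart_phi x i)) (snd (P i)) (fun j => snd (T j i)).
Proof.
  destruct chart_M_jet as [r [Hr [Hpos [X [Y [JX JY]]]]]].
  exists r. split; auto. split; auto. intros i Hi.
  destruct (Nat.lt_trichotomy i (S p)) as [Hip|[->|Hip]].
  - destruct (chart_S_jet r i ltac:(lia)) as [A1 A2].
    rewrite (Nat.mod_small i n) in A1, A2 by auto.
    split; (eapply Jet1_ext; [auto| |eassumption]); intros x _; rewrite chart_phi_le by lia; auto.
  (* Differentiating the two constant side lengths gives two linear equations for the gradient of
     the apex. [T j (S p)] satisfies the same equations, and their determinant is
     [cross (e p) (e (S p))], so the two agree. *)
  - assert (HXY : forall j, (j < k)%nat -> X j = fst (T j (S p)) /\ Y j = snd (T j (S p))).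
    { intros j Hj.
      destruct (chart_S_jet r p ltac:(lia)) as [B1 B2].
      rewrite (Nat.mod_small p n) in B1, B2 by lia.
      destruct (chart_S_jet r (p + 2) ltac:(lia)) as [A1 A2].
      destruct (chart_Sn_jet r) as [C1 C2]. rewrite Sp2_mod in A1, A2.
      pose proof (Jet1_minus _ _ _ _ _ _ _ _ JX B1) as U1.
      pose proof (Jet1_minus _ _ _ _ _ _ _ _ JY B2) as U2.
      pose proof (Jet1_plus _ _ _ _ _ _ _ _ (Jet1_mult _ _ _ _ _ _ _ _ U1 U1)
                    (Jet1_mult _ _ _ _ _ _ _ _ U2 U2)) as U.
      apply (Jet1_ext k r (fun _ => lp * lp)) in U; auto.
      2:{ intros x Hx. symmetry. apply chart_M_sides; apply Hpos; auto. }
      pose proof (Jet1_minus _ _ _ _ _ _ _ _ (Jet1_minus _ _ _ _ _ _ _ _ A1 C1) JX) as V1.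
      pose proof (Jet1_minus _ _ _ _ _ _ _ _ (Jet1_minus _ _ _ _ _ _ _ _ A2 C2) JY) as V2.
      pose proof (Jet1_plus _ _ _ _ _ _ _ _ (Jet1_mult _ _ _ _ _ _ _ _ V1 V1)
                    (Jet1_mult _ _ _ _ _ _ _ _ V2 V2)) as V.
      apply (Jet1_ext k r (fun _ => lq * lq)) in V; auto.
      2:{ intros x Hx. symmetry. apply chart_M_sides; apply Hpos; auto. }
      pose proof (Jet1_unique k r _ _ _ _ _ j Hr Hj U (Jet1_const k r (lp * lp))) as EU.
      pose proof (Jet1_unique k r _ _ _ _ _ j Hr Hj V (Jet1_const k r (lq * lq))) as EV.
      cbv beta in EU, EV.
      pose proof (HTe j p Hj ltac:(lia)) as K1.
      pose proof (HTe j (S p) Hj ltac:(lia)) as K2.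
      unfold e, dT in *. rewrite nxt_p in K1, Hcr. unfold dot, cross, psub in *. simpl in *.
      set (a1 := fst (P (S p)) - fst (P p)) in *. set (a2 := snd (P (S p)) - snd (P p)) in *.
      set (b1 := fst (P (nxt n (S p))) - fst (P (S p))) in *.
      set (b2 := snd (P (nxt n (S p))) - snd (P (S p))) in *.
      set (u := X j - fst (T j (S p))). set (v := Y j - snd (T j (S p))).
      assert (Z1 : a1 * u + a2 * v = 0) by (unfold u, v; lra).
      assert (Z2 : b1 * u + b2 * v = 0).
      { unfold u, v. unfold b1, b2 in *. lra. }
      assert (u = 0).
      { apply (Rmult_eq_reg_l (a1 * b2 - a2 * b1)); auto.
        transitivity (b2 * (a1 * u + a2 * v) - a2 * (b1 * u + b2 * v)); [ring|].
        rewrite Z1, Z2; ring. }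
      assert (v = 0).
      { apply (Rmult_eq_reg_l (a1 * b2 - a2 * b1)); auto.
        transitivity (a1 * (b1 * u + b2 * v) - b1 * (a1 * u + a2 * v)); [ring|].
        rewrite Z1, Z2; ring. }
      unfold u, v in *. lra. }
    split.
    + apply (Jet1_ext k r _ Mx); auto; [intros; rewrite chart_phi_M; auto|].
      eapply Jet1_val; [exact JX|auto|]. intros j Hj. apply HXY; auto.
    + apply (Jet1_ext k r _ My); auto; [intros; rewrite chart_phi_M; auto|].
      eapply Jet1_val; [exact JY|auto|]. intros j Hj. apply HXY; auto.
  - destruct (chart_S_jet r i ltac:(lia)) as [A1 A2].
    rewrite (Nat.mod_small i n) in A1, A2 by auto.
    destruct (chart_Sn_jet r) as [C1 C2].
    split.
    + apply (Jet1_ext k r _ (fun x => Sx i x - Sx n x)); auto;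
        [intros; rewrite chart_phi_ge by lia; auto|].
      eapply Jet1_val; [apply (Jet1_minus _ _ _ _ _ _ _ _ A1 C1)|ring|intros; simpl; ring].
    + apply (Jet1_ext k r _ (fun x => Sy i x - Sy n x)); auto;
        [intros; rewrite chart_phi_ge by lia; auto|].
      eapply Jet1_val; [apply (Jet1_minus _ _ _ _ _ _ _ _ A2 C2)|ring|intros; simpl; ring].
Qed.

(* Enumerates the edges other than [0], [p], [S p]. *)
Let fr (i : nat) : nat := if Nat.ltb (S i) p then S i else (i + 3)%nat.

Lemma free_edge_spec (m : nat) : (m < n)%nat -> m <> 0%nat -> m <> p -> m <> S p ->
  exists i, (i < k)%nat /\ fr i = m.
Proof.
  intros Hm H0 H1 H2. unfold fr, k. destruct (Nat.lt_ge_cases m p) as [H|H].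
  - exists (m - 1)%nat. split; [lia|].
    destruct (Nat.ltb_spec (S (m - 1)) p); lia.
  - exists (m - 3)%nat. split; [lia|].
    destruct (Nat.ltb_spec (S (m - 3)) p); lia.
Qed.

Lemma free_edge_range (i : nat) : (i < k)%nat ->
  (fr i < n)%nat /\ fr i <> 0%nat /\ fr i <> p /\ fr i <> S p.
Proof.
  unfold fr, k. intros Hi. destruct (Nat.ltb_spec (S i) p); lia.
Qed.

(** If a combination gives no angular velocity to the free edges, walking from vertex [0] in both
    directions shows that every vertex but [S p] is at rest. Then [S p] rests too, since its two
    edges are not parallel, and the independence of the [T j] applies. *)
Lemma chart_xi_inj (c : nat -> R) :
  (forall i, (i < k)%nat -> rsum k (fun j => c j * xi j (fr i)) = 0) ->
  forall j, (j < k)%nat -> c j = 0.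
Proof.
  intros H. apply HTi.
  set (tx := fun i => rsum k (fun j => c j * fst (T j i))).
  set (ty := fun i => rsum k (fun j => c j * snd (T j i))).
  assert (Hxi : forall m, (m < n)%nat -> m <> p -> m <> S p ->
            rsum k (fun j => c j * xi j m) = 0).
  { intros m Hm H1 H2. destruct (Nat.eq_dec m 0) as [->|H0].
    - apply rsum_zero. intros j Hj. rewrite chart_xi0 by auto. ring.
    - destruct (free_edge_spec m) as [i [Hi <-]]; auto. }
  assert (Hd : forall m, (m < n)%nat ->
     tx (nxt n m) - tx m = - snd (e m) * rsum k (fun j => c j * xi j m) /\
     ty (nxt n m) - ty m = fst (e m) * rsum k (fun j => c j * xi j m)).
  { intros m Hm. unfold tx, ty. rewrite <- !rsum_minus, <- !rsum_scal.
    split; apply rsum_ext; intros j Hj; destruct (chart_dT j m Hj Hm) as [E1 E2].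
    - transitivity (c j * fst (dT j m)); [unfold dT, psub; simpl; ring|]. rewrite E1; ring.
    - transitivity (c j * snd (dT j m)); [unfold dT, psub; simpl; ring|]. rewrite E2; ring. }
  assert (H00 : tx 0%nat = 0 /\ ty 0%nat = 0).
  { unfold tx, ty. split; apply rsum_zero; intros j Hj; rewrite HT0 by auto; simpl; ring. }
  assert (Hstep : forall m, (m < n)%nat -> m <> p -> m <> S p ->
            tx (nxt n m) = tx m /\ ty (nxt n m) = ty m).
  { intros m Hm H1 H2. destruct (Hd m Hm) as [E1 E2]. rewrite (Hxi m Hm H1 H2) in E1, E2. lra. }
  assert (Hlow : forall i, (i <= p)%nat -> tx i = 0 /\ ty i = 0).
  { induction i as [|i IH]; intros Hi; auto.
    destruct (Hstep i ltac:(lia) ltac:(lia) ltac:(lia)) as [E1 E2].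
    destruct IH as [I1 I2]; [lia|]. unfold nxt in E1, E2.
    rewrite Nat.mod_small, Nat.add_1_r in E1, E2 by lia. lra. }
  assert (Hhigh : forall d i, (i + d = n)%nat -> (p + 2 <= i)%nat ->
            tx (i mod n) = 0 /\ ty (i mod n) = 0).
  { induction d as [|d IH]; intros i Hi Hpi.
    - replace i with n by lia. rewrite Nat.Div0.mod_same. auto.
    - destruct (IH (S i)) as [I1 I2]; [lia|lia|].
      destruct (Hstep i ltac:(lia) ltac:(lia) ltac:(lia)) as [E1 E2].
      unfold nxt in E1, E2. rewrite Nat.add_1_r in E1, E2.
      rewrite (Nat.mod_small i n) by lia. lra. }
  assert (Hmid : tx (S p) = 0 /\ ty (S p) = 0).
  { destruct (Hd p ltac:(lia)) as [E1 E2]. rewrite nxt_p in E1, E2.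
    destruct (Hd (S p) ltac:(lia)) as [E3 E4].
    destruct (Hlow p ltac:(lia)) as [L1 L2].
    destruct (Hhigh (n - (p + 2))%nat (p + 2)%nat ltac:(lia) ltac:(lia)) as [G1 G2].
    rewrite Sp2_mod in G1, G2. rewrite L1 in E1. rewrite L2 in E2. rewrite G1 in E3.
    rewrite G2 in E4.
    set (A := rsum k (fun j => c j * xi j p)) in *.
    set (B := rsum k (fun j => c j * xi j (S p))) in *.
    unfold cross in Hcr.
    assert (A = 0).
    { apply (Rmult_eq_reg_l (fst (e p) * snd (e (S p)) - snd (e p) * fst (e (S p)))); auto.
      transitivity (snd (e (S p)) * (fst (e p) * A) + fst (e (S p)) * (- snd (e p) * A));
        [ring|]. rewrite <- E1, <- E2. 
      transitivity (snd (e (S p)) * (- (0 - ty (S p))) + fst (e (S p)) * (- (0 - tx (S p)))); [ring|].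
      rewrite E3, E4. ring. }
    rewrite H0 in E1, E2. lra. }
  intros i Hi. destruct (Nat.lt_trichotomy i (S p)) as [Hip|[->|Hip]].
  - apply Hlow; lia.
  - exact Hmid.
  - rewrite <- (Nat.mod_small i n Hi). apply (Hhigh (n - i)%nat i); lia.
Qed.

Let fq (Q : nat -> pt) (m : nat) : pt := psub (Q (nxt n m)) (Q m).

(** The inputs of [rotation_angle] and [circle_inter] for a polygon [Q] near [P]: edges turned by
    less than a quarter turn, and a triangle on the same side. *)
Lemma chart_edges_near (d : R) : 0 < d -> exists eps, 0 < eps /\
  forall Q, (forall i, (i < n)%nat -> dist (Q i) (P i) < eps) ->
    (forall m, (m < n)%nat -> Rabs (cross (e m) (fq Q m) / (l m * l m)) < d /\
                              0 < dot (e m) (fq Q m)) /\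
    0 < sg * cross (fq Q (S p)) (fq Q p).
Proof.
  intros Hd.
  assert (Hclose : forall eps Q m, (m < n)%nat ->
            (forall i, (i < n)%nat -> dist (Q i) (P i) < eps) ->
            Rabs (fst (fq Q m) - fst (e m)) < 2 * eps /\
            Rabs (snd (fq Q m) - snd (e m)) < 2 * eps).
  { intros eps Q m Hm HQ.
    pose proof (dist_coords _ _ _ (HQ m Hm)) as [A1 A2].
    pose proof (dist_coords _ _ _ (HQ (nxt n m) (nxt_lt n m ltac:(lia)))) as [B1 B2].
    unfold fq, e, psub; simpl.
    apply Rabs_def2 in A1, A2, B1, B2. split; apply Rabs_def1; lra. }
  set (kap := Rmin d 1).
  assert (Hk : 0 < kap) by (apply Rmin_pos; lra).
  assert (Hkd : kap <= d) by apply Rmin_l. assert (Hk1 : kap <= 1) by apply Rmin_r.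
  destruct (fin_eps n (fun m ep => forall Q,
     (forall i, (i < n)%nat -> dist (Q i) (P i) < ep) ->
     Rabs (cross (e m) (fq Q m) / (l m * l m)) < d /\ 0 < dot (e m) (fq Q m)))
    as [e1 [He1 H1]].
  { intros m Hm. pose proof (chart_edge_pos m Hm) as Hpos.
    rewrite <- (chart_edge_sq m Hm). set (q := dot (e m) (e m)) in *.
    assert (Hq : 0 < kap * q) by (apply Rmult_lt_0_compat; auto).
    destruct (cross_dot_near (e m) (e m) (kap * q) Hq) as [e0 [He0 Hn0]].
    exists e0. split; auto. intros ep Hep Q HQ. destruct (Hclose ep Q m Hm HQ) as [C1 C2].
    destruct (Hn0 ep (e m) (fq Q m) Hep) as [N1 N2]; auto;
      try (rewrite Rminus_diag, Rabs_R0; lra).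
    split.
    - replace (cross (e m) (e m)) with 0 in N1 by (unfold cross; ring). rewrite Rminus_0_r in N1.
      unfold Rdiv. rewrite Rabs_mult, (Rabs_right (/ q)).
      2:{ apply Rle_ge. left. apply Rinv_0_lt_compat. auto. }
      apply (Rmult_lt_reg_r q); auto. rewrite Rmult_assoc, Rinv_l by lra. nra.
    - fold q in N2. apply Rabs_def2 in N2. nra. }
  destruct (cross_dot_near (e (S p)) (e p) _ chart_sg_cross) as [e2 [He2 Hn2]].
  exists (Rmin e1 e2). assert (Hr0 : 0 < Rmin e1 e2) by (apply Rmin_pos; auto). split; auto.
  intros Q HQ. split.
  - intros m Hm. apply (H1 (Rmin e1 e2)); auto. split; [auto|apply Rmin_l].
  - destruct (Hclose _ Q p ltac:(lia) HQ) as [A1 A2].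
    destruct (Hclose _ Q (S p) ltac:(lia) HQ) as [B1 B2].
    destruct (Hn2 (Rmin e1 e2) (fq Q (S p)) (fq Q p)) as [N _]; auto.
    { split; [auto|apply Rmin_r]. }
    apply Rabs_def2 in N. pose proof chart_sg_cross.
    assert (Hsg : sg = 1 \/ sg = -1) by (unfold sg; destruct (Rlt_dec _ _); auto).
    destruct Hsg as [E|E]; rewrite E in *; lra.
Qed.

(** The parameters of a nearby polygon are recovered from the turning angles [eta] of its free
    edges, because the matrix of [xi] on these edges is invertible. The vertices other than [S p]
    then agree by walking, and the apex is determined by its two distances and its side. *)
Lemma chart_surj (r : R) : 0 < r -> exists eps, 0 < eps /\
  forall Q, InL n l Q -> (forall i, (i < n)%nat -> dist (Q i) (P i) < eps) ->
  exists x, InBox k r x /\ forall i, (i < n)%nat -> chart_phi x i = Q i.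
Proof.
  intros Hr.
  destruct (fin_choice (fun _ : nat => 0) k (fun i0 y => forall i, (i < k)%nat ->
              rsum k (fun j => y j * xi j (fr i)) = unitv i0 i)) as [Y HY].
  { intros i0 _. apply (square_system k (fun j i => xi j (fr i)) chart_xi_inj (unitv i0)). }
  (* A parameter is a sum of angles weighted by entries of the inverse matrix [Y]. [B] exceeds the
     sum of the absolute weights, so angles below [r / B] give parameters below [r]. *)
  set (B := 1 + rsum k (fun j => rsum k (fun i => Rabs (Y i j)))).
  assert (HBj : forall j, (j < k)%nat -> rsum k (fun i => Rabs (Y i j)) < B).
  { intros j Hj. unfold B.
    pose proof (rsum_term_le k j (fun j => rsum k (fun i => Rabs (Y i j))) Hj) as H.
    cbv beta in H.
    assert (rsum k (fun i => Rabs (Y i j)) <= rsum k (fun j => rsum k (fun i => Rabs (Y i j)))).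
    { apply H. intros. apply rsum_nonneg. intros; apply Rabs_pos. }
    lra. }
  assert (HB : 0 < B).
  { unfold B. assert (0 <= rsum k (fun j => rsum k (fun i => Rabs (Y i j)))); [|lra].
    apply rsum_nonneg; intros; apply rsum_nonneg; intros; apply Rabs_pos. }
  destruct (asin_small (r / B)) as [d [Hd Hasin]]; [apply Rdiv_lt_0_compat; auto|].
  destruct (chart_edges_near d Hd) as [eps [Heps Hnear]].
  exists eps. split; auto. intros Q HQL HQ. destruct (Hnear Q HQ) as [Hm Hsg].
  set (eta := fun m => asin (cross (e m) (fq Q m) / (l m * l m))).
  set (x := fun j => if Nat.ltb j k then rsum k (fun i => eta (fr i) * Y i j) else 0).
  assert (Heta : forall m, (m < n)%nat -> Rabs (eta m) < r / B).
  { intros m Hmn. apply Hasin. apply Hm; auto. }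
  assert (HTh : forall i, (i < k)%nat -> Th (fr i) x = eta (fr i)).
  { intros i Hi. unfold Th.
    rewrite (rsum_ext k _ (fun j => rsum k (fun i' => eta (fr i') * (Y i' j * xi j (fr i))))).
    - rewrite rsum_swap.
      rewrite (rsum_ext k _ (fun i' => eta (fr i') * unitv i i')).
      + apply (rsum_unitv k i (fun i' => eta (fr i')) Hi).
      + intros i' Hi'. rewrite rsum_scal, HY by auto. unfold unitv.
        rewrite Nat.eqb_sym. reflexivity.
    - intros j Hj. unfold x. rewrite (proj2 (Nat.ltb_lt j k) Hj), <- rsum_scal_r.
      apply rsum_ext; intros; ring. }
  assert (HfQ : forall m, (m < n)%nat -> dot (fq Q m) (fq Q m) = l m * l m).
  { intros m Hmn. unfold fq. rewrite dot_psub_sym. apply dist_eq_iff; auto. apply HQL; auto. }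
  assert (HE : forall m, (m < n)%nat -> m <> p -> m <> S p ->
            Ex m x = fst (fq Q m) /\ Ey m x = snd (fq Q m)).
  { intros m Hmn H1 H2. unfold Ex, Ey.
    destruct (Nat.eq_dec m 0) as [->|H0].
    - rewrite chart_Th0, cos_0, sin_0. unfold e, fq, nxt. rewrite Nat.mod_small by lia.
      simpl (0 + 1)%nat. destruct HP as [P0 [P1 _]]. destruct HQL as [Q0 [Q1 _]].
      rewrite P0, P1, Q0, Q1. unfold psub; simpl. lra.
    - destruct (free_edge_spec m) as [i [Hi Ei]]; auto. rewrite <- Ei, HTh by auto. rewrite Ei.
      destruct (rotation_angle (e m) (fq Q m) (l m)) as [R1 R2]; auto.
      + apply chart_edge_sq; auto.
      + apply Hm; auto. }
  assert (HQ0 : Q 0%nat = (0, 0)) by apply HQL.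
  assert (Hlow : forall i, (i <= p)%nat -> Sx i x = fst (Q i) /\ Sy i x = snd (Q i)).
  { intros i Hi.
    pose proof (rsum_edges n i (fun m => fst (Q m)) ltac:(lia) ltac:(lia)) as R1.
    pose proof (rsum_edges n i (fun m => snd (Q m)) ltac:(lia) ltac:(lia)) as R2.
    cbv beta in R1, R2. rewrite HQ0, (Nat.mod_small i n) in R1, R2 by lia. simpl in R1, R2.
    rewrite Rminus_0_r in R1, R2. rewrite <- R1, <- R2.
    split; apply rsum_ext; intros m Hmi; apply (HE m); lia. }
  assert (Hhigh : forall i, (p + 2 <= i)%nat -> (i <= n)%nat ->
            Sx i x - Sx n x = fst (Q (i mod n)%nat) /\ Sy i x - Sy n x = snd (Q (i mod n)%nat)).
  { intros i Hi Hin.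
    assert (Hgen : forall (F f : nat -> R), (forall m, (m < n)%nat -> m <> p -> m <> S p ->
                F m = f (nxt n m) - f m) -> f 0%nat = 0 -> rsum i F - rsum n F = f (i mod n)%nat).
    { intros F f HF Hf0.
      pose proof (rsum_edges n i f Hin ltac:(lia)) as R1.
      pose proof (rsum_edges n n f (Nat.le_refl n) ltac:(lia)) as R2.
      rewrite Nat.Div0.mod_same in R2.
      replace n with (i + (n - i))%nat in R2 at 1 by lia.
      replace n with (i + (n - i))%nat at 1 by lia.
      rewrite rsum_app in R2 |- *.
      rewrite (rsum_ext (n - i) (fun m => F (i + m)%nat)
                 (fun m => f (nxt n (i + m)) - f (i + m)%nat)) by (intros; apply HF; lia).
      lra. }
    split.
    - apply (Hgen (fun m => Ex m x) (fun m => fst (Q m))); [|rewrite HQ0; auto].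
      intros m H1 H2 H3. apply HE; auto.
    - apply (Hgen (fun m => Ey m x) (fun m => snd (Q m))); [|rewrite HQ0; auto].
      intros m H1 H2 H3. apply HE; auto. }
  exists x. split.
  - split; intros j Hj; unfold x.
    + destruct (Nat.ltb_spec j k); [lia|auto].
    + rewrite (proj2 (Nat.ltb_lt j k) Hj).
      eapply Rle_lt_trans; [apply rsum_Rabs|].
      assert (HrB : 0 < r / B) by (apply Rdiv_lt_0_compat; auto).
      apply (Rle_lt_trans _ (r / B * rsum k (fun i => Rabs (Y i j)))).
      * rewrite <- rsum_scal. apply rsum_le. intros i Hi. rewrite Rabs_mult.
        apply Rmult_le_compat_r; [apply Rabs_pos|]. left. apply Heta. apply free_edge_range; auto.
      * replace r with (r / B * B) at 2 by (field; lra).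
        apply Rmult_lt_compat_l; auto.
  - intros i Hi. destruct (Nat.lt_trichotomy i (S p)) as [Hip|[->|Hip]].
    + rewrite chart_phi_le by lia. destruct (Hlow i ltac:(lia)) as [-> ->].
      destruct (Q i); reflexivity.
    + rewrite chart_phi_M.
      destruct (Hlow p (Nat.le_refl p)) as [L1 L2].
      destruct (Hhigh (p + 2)%nat (Nat.le_refl _) Hp2) as [G1 G2]. rewrite Sp2_mod in G1, G2.
      assert (Efp : fq Q p = psub (Q (S p)) (Q p)) by (unfold fq; rewrite nxt_p; auto).
      set (dd := psub (Q (nxt n (S p))) (Q p)).
      assert (Efq : fq Q (S p) = psub dd (fq Q p)).
      { rewrite Efp. unfold fq, dd, psub; simpl. f_equal; ring. }
      destruct (circle_inter dd (fq Q p) lp lq sg) as [K1 [K2 K3]].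
      * apply HfQ; lia.
      * rewrite <- Efq. apply HfQ; lia.
      * apply chart_sg_sq.
      * replace (cross dd (fq Q p)) with (cross (fq Q (S p)) (fq Q p)); auto.
        rewrite Efq. unfold cross, psub; simpl. ring.
      * assert (X1 : dx x = fst dd) by (unfold dx; rewrite G1, L1; reflexivity).
        assert (X2 : dy x = snd dd) by (unfold dy; rewrite G2, L2; reflexivity).
        assert (X3 : DD x = dot dd dd) by (unfold DD, dot; rewrite X1, X2; reflexivity).
        unfold Mx, My, rad, Ac. rewrite X3, X1, X2, L1, L2.
        cbv zeta in K3.
        set (aa := / 2 + (lp * lp - lq * lq) / 2 * / dot dd dd) in *.
        set (ss := sqrt (lp * lp * / dot dd dd - aa * aa)) in *.
        rewrite Efp in K3. apply pair_equal_spec in K3. destruct K3 as [K4 K5].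
        rewrite (surjective_pairing (Q (S p))), <- K4, <- K5. f_equal; ring.
    + rewrite chart_phi_ge by lia. destruct (Hhigh i ltac:(lia) ltac:(lia)) as [-> ->].
      rewrite Nat.mod_small by auto. destruct (Q i); reflexivity.
Qed.

Lemma chart_exists : exists r phi, ChartAt n l P r phi /\
  forall i, (i < n)%nat ->
    Jet1 k r (fun x => fst (phi x i)) (fst (P i)) (fun j => fst (T j i)) /\
    Jet1 k r (fun x => snd (phi x i)) (snd (P i)) (fun j => snd (T j i)).
Proof.
  destruct chart_jets as [r [Hr [Hpos HJ]]].
  exists r, chart_phi. split; auto.
  split; [auto|]. split; [|split; [|split; [|split]]].
  - intros i Hi. destruct (HJ i Hi) as [J1 J2]. apply Jet1_f0 in J1, J2.
    rewrite (surjective_pairing (chart_phi zerov i)), J1, J2. destruct (P i); reflexivity.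
  - intros x Hx. destruct (Hpos x Hx). apply chart_InL; auto.
  - intros i Hi. destruct (HJ i Hi) as [[f2 J1] [g2 J2]].
    split; eapply Jet_IsC2; eassumption.
  - exists T. split; auto. intros j i Hj Hi. destruct (HJ i Hi) as [[f2 J1] [g2 J2]].
    split; [exact (Jet_partial k r _ _ _ _ j Hr Hj J1)|exact (Jet_partial k r _ _ _ _ j Hr Hj J2)].
  - apply chart_surj; auto.
Qed.

End Chart.

(** * Cyclic polygons *)

Definition hangle (n : nat) (P : nat -> pt) (O : pt) (i : nat) : R :=
  epsi n P O i * alphai n P O i.

Lemma epsi_cases (n : nat) (P : nat -> pt) (O : pt) (i : nat) :
  epsi n P O i = 1 \/ epsi n P O i = -1.
Proof. unfold epsi. destruct (Rlt_dec _ _); auto. Qed.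

Lemma cross_center (a b O : pt) :
  cross (psub b a) (psub O a) = cross (psub a O) (psub b O).
Proof. unfold cross, psub; simpl; ring. Qed.

Section Circle.
Variables (n : nat) (l : nat -> R) (P : nat -> pt) (O : pt) (Rad : R).
Hypothesis Hn : (0 < n)%nat.
Hypothesis Hl : forall i, (i < n)%nat -> 0 < l i.
Hypothesis HP : InL n l P.
Hypothesis HC : OnCircle n P O Rad.

Lemma circle_sq (i : nat) : (i < n)%nat -> dot (psub (P i) O) (psub (P i) O) = Rad * Rad.
Proof. intros Hi. apply dist_eq_iff; apply HC; auto. Qed.

(** The chord formula gives [sin al], and the side on which [O] lies gives the sense of the
    rotation. An edge through [O] falls under [epsi = -1]; there [2 * al = PI], and both signs
    describe the same rotation. *)
Lemma circle_edge (i : nat) : (i < n)%nat ->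
  let a := psub (P i) O in let b := psub (P (nxt n i)) O in
  let al := alphai n P O i in let c := cross a b in
  0 < al <= PI / 2 /\ sin al = l i / (2 * Rad) /\ (c <> 0 -> al < PI / 2) /\
  cos (2 * hangle n P O i) * (Rad * Rad) = dot a b /\
  sin (2 * hangle n P O i) * (Rad * Rad) = c.
Proof.
  intros Hi a b al c.
  assert (HR : 0 < Rad) by apply HC.
  assert (Ha : dot a a = Rad * Rad) by (apply circle_sq; auto).
  assert (Hb : dot b b = Rad * Rad) by (apply circle_sq; apply nxt_lt; auto).
  assert (Hll : dot (psub b a) (psub b a) = l i * l i).
  { transitivity (dot (psub (P i) (P (nxt n i))) (psub (P i) (P (nxt n i)))).
    - unfold a, b, dot, psub; simpl; ring.
    - apply dist_eq_iff; auto. apply HP; auto. }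
  assert (HRR : 0 < Rad * Rad) by nra.
  set (z := dot a b / (Rad * Rad)). set (w := c / (Rad * Rad)).
  assert (Hzw : z * z + w * w = 1).
  { unfold z, w. transitivity (dot a a * dot b b / ((Rad * Rad) * (Rad * Rad))).
    - unfold c, cross, dot; field; lra.
    - rewrite Ha, Hb. field. lra. }
  assert (Hz : -1 <= z <= 1) by nra.
  assert (Hal : 2 * al = acos z).
  { unfold al, alphai. fold a b. unfold norm. rewrite Ha, Hb.
    rewrite sqrt_square by lra. unfold z. field. }
  assert (Hcos : cos (2 * al) = z) by (rewrite Hal; apply cos_acos; auto).
  assert (Hrange : 0 <= 2 * al <= PI) by (rewrite Hal; apply acos_bound).
  assert (Hz1 : z = 1 - 2 * ((l i / (2 * Rad)) * (l i / (2 * Rad)))).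
  { unfold z. assert (E : dot a b = (Rad * Rad + Rad * Rad - l i * l i) / 2).
    { rewrite <- Ha at 1. rewrite <- Hb, <- Hll. unfold dot, psub; simpl. field. }
    rewrite E. field. lra. }
  assert (Hsin0 : 0 <= sin al) by (apply sin_ge_0; lra).
  assert (Hq : 0 < l i / (2 * Rad)).
  { apply Rdiv_lt_0_compat; [auto|lra]. }
  assert (Hsin : sin al = l i / (2 * Rad)).
  { pose proof (cos_2a_sin al) as H2. rewrite Hcos, Hz1 in H2.
    assert (H3 : sin al * sin al = l i / (2 * Rad) * (l i / (2 * Rad))) by lra.
    apply Rsqr_inj; unfold Rsqr; lra. }
  assert (Hpos : 0 < al).
  { destruct (Req_dec al 0) as [E|E]; [|lra]. rewrite E, sin_0 in Hsin. lra. }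
  split; [lra|]. split; [auto|]. split; [|].
  - intros Hc. destruct (Req_dec al (PI / 2)) as [E|E]; [|lra]. exfalso. apply Hc.
    rewrite E in Hcos. replace (2 * (PI / 2)) with PI in Hcos by lra. rewrite cos_PI in Hcos.
    assert (w = 0) by nra. replace c with (w * (Rad * Rad)) by (unfold w; field; lra).
    rewrite H; ring.
  - assert (Heps : epsi n P O i = 1 /\ 0 < c \/ epsi n P O i = -1 /\ c <= 0).
    { unfold epsi. rewrite cross_center. fold a b c. destruct (Rlt_dec 0 c); [left|right]; lra. }
    assert (Hs2 : 0 <= sin (2 * al)) by (apply sin_ge_0; lra).
    assert (Hs2w : sin (2 * al) * sin (2 * al) = w * w).
    { pose proof (sin2_cos2 (2 * al)) as H. unfold Rsqr in H. rewrite Hcos in H. lra. }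
    assert (Hwc : c = w * (Rad * Rad)) by (unfold w; field; lra).
    assert (Hzc : dot a b = z * (Rad * Rad)) by (unfold z; field; lra).
    rewrite Hzc, Hwc. unfold hangle. fold al. destruct Heps as [[-> Hc]|[-> Hc]].
    + replace (2 * (1 * al)) with (2 * al) by ring. rewrite Hcos. split; auto.
      f_equal. assert (0 <= w) by (unfold w; apply Rle_mult_inv_pos; lra).
      apply Rsqr_inj; unfold Rsqr; auto.
    + replace (2 * (-1 * al)) with (- (2 * al)) by ring. rewrite cos_neg, sin_neg, Hcos.
      split; auto. f_equal.
      assert (w <= 0) by (assert (0 <= - c / (Rad * Rad)) by (apply Rle_mult_inv_pos; lra);
                          unfold w, Rdiv in *; lra).
      assert (E : sin (2 * al) = - w); [|lra].
      apply Rsqr_inj; unfold Rsqr; lra.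
Qed.

Lemma circle_rot (i : nat) : (i < n)%nat ->
  let a := psub (P i) O in let b := psub (P (nxt n i)) O in
  let t := 2 * hangle n P O i in
  fst b = cos t * fst a - sin t * snd a /\ snd b = cos t * snd a + sin t * fst a.
Proof.
  intros Hi a b t.
  destruct (circle_edge i Hi) as [_ [_ [_ [Hc Hs]]]]. fold a b t in Hc, Hs.
  pose proof (circle_sq i Hi) as Ha. fold a in Ha.
  assert (HR : 0 < Rad) by apply HC. assert (HRR : Rad * Rad <> 0) by nra.
  unfold dot, cross in *. split; apply (Rmult_eq_reg_r (Rad * Rad)); auto.
  - transitivity ((cos t * (Rad * Rad)) * fst a - (sin t * (Rad * Rad)) * snd a); [|ring].
    rewrite Hc, Hs, <- Ha. ring.
  - transitivity ((cos t * (Rad * Rad)) * snd a + (sin t * (Rad * Rad)) * fst a); [|ring].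
    rewrite Hc, Hs, <- Ha. ring.
Qed.

(** The rotations by [2 * hangle] carry each vertex to the next, so their product fixes the vector
    from [O] to vertex [0]. This is why the winding number is an integer. *)
Lemma circle_winding : exists w : Z, rsum n (hangle n P O) = IZR w * PI.
Proof.
  set (a := fun i => psub (P (i mod n)%nat) O).
  assert (H : forall i, (i <= n)%nat -> let t := 2 * rsum i (hangle n P O) in
            fst (a i) = cos t * fst (a 0%nat) - sin t * snd (a 0%nat) /\
            snd (a i) = cos t * snd (a 0%nat) + sin t * fst (a 0%nat)).
  { induction i as [|i IH]; intros Hi; cbv zeta; simpl rsum.
    - rewrite Rmult_0_r, cos_0, sin_0. lra.
    - destruct IH as [I1 I2]; [lia|].
      destruct (circle_rot i ltac:(lia)) as [R1 R2].
      assert (E : a (S i) = psub (P (nxt n i)) O) by (unfold a, nxt; rewrite Nat.add_1_r; auto).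
      assert (E' : a i = psub (P i) O) by (unfold a; rewrite Nat.mod_small by lia; auto).
      rewrite <- E, <- E' in R1, R2.
      rewrite Rmult_plus_distr_l, cos_plus, sin_plus, R1, R2, I1, I2. split; ring. }
  destruct (H n (Nat.le_refl n)) as [H1 H2].
  assert (E : a n = a 0%nat).
  { unfold a. rewrite Nat.Div0.mod_same, Nat.Div0.mod_0_l. auto. }
  rewrite E in H1, H2.
  assert (Ha : dot (a 0%nat) (a 0%nat) = Rad * Rad).
  { unfold a. rewrite Nat.mod_small by auto. apply circle_sq; auto. }
  assert (HR : 0 < Rad) by apply HC. unfold dot in Ha.
  set (t := rsum n (hangle n P O)) in *.
  assert (Hc : cos (2 * t) = 1).
  { apply (Rmult_eq_reg_r (Rad * Rad)); [|nra]. rewrite <- Ha.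
    transitivity (fst (a 0%nat) * (cos (2 * t) * fst (a 0%nat) - sin (2 * t) * snd (a 0%nat)) +
      snd (a 0%nat) * (cos (2 * t) * snd (a 0%nat) + sin (2 * t) * fst (a 0%nat))); [ring|].
    rewrite <- H1, <- H2. ring. }
  rewrite cos_2a_sin in Hc.
  apply sin_eq_0_0. nra.
Qed.

Lemma tan_hangle (i : nat) : tan (hangle n P O i) = epsi n P O i * tan (alphai n P O i).
Proof.
  unfold hangle. destruct (epsi_cases n P O i) as [-> | ->].
  - rewrite !Rmult_1_l; auto.
  - replace (-1 * alphai n P O i) with (- alphai n P O i) by ring. rewrite tan_neg. ring.
Qed.

End Circle.

(** The cyclic identities below hold summand by summand only up to a coboundary; proving them
    amounts to naming the potential [g]. *)
Lemma rsum_coboundary (n : nat) (g f : nat -> R) : (0 < n)%nat ->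
  (forall k, (k < n)%nat -> f k = g (nxt n k) - g k) -> rsum n f = 0.
Proof.
  intros Hn H. rewrite (rsum_ext n f _ H), rsum_edges, Nat.Div0.mod_same by lia. ring.
Qed.

Lemma prefix_nxt (n : nat) (d : nat -> R) : rsum n d = 0 ->
  forall k, (k < n)%nat -> rsum (nxt n k) d = rsum k d + d k.
Proof.
  intros Hd k Hk. unfold nxt. rewrite Nat.add_1_r.
  destruct (Nat.eq_dec (S k) n) as [E|E].
  - rewrite E, Nat.Div0.mod_same. subst n. simpl in *. lra.
  - rewrite Nat.mod_small by lia. reflexivity.
Qed.

(* Each step is the rotation by the angle [2 atan (t k)]. *)
Definition tan_rot (n : nat) (a : nat -> pt) (t : nat -> R) : Prop := forall k, (k < n)%nat ->
  fst (a (nxt n k)) = ((1 - t k * t k) * fst (a k) - 2 * t k * snd (a k)) / (1 + t k * t k) /\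
  snd (a (nxt n k)) = ((1 - t k * t k) * snd (a k) + 2 * t k * fst (a k)) / (1 + t k * t k).

(* The second variation of twice the area along one edge, [ct] being the cotangent of half of the
   oriented central angle; [u -> u'], [v -> v'] are displacements of the end points. *)
Definition eform (ct : R) (u u' v v' : pt) : R :=
  / 2 * (cross u v' + cross v u') - / 2 * ct * dot (psub u' u) (psub v' v).

Definition Hess (n : nat) (ct : nat -> R) (U V : nat -> pt) : R :=
  rsum n (fun k => eform (ct k) (U k) (U (nxt n k)) (V k) (V (nxt n k))).

Lemma Hess_sym (n : nat) (ct : nat -> R) (U V : nat -> pt) : Hess n ct U V = Hess n ct V U.
Proof. apply rsum_ext; intros. unfold eform, cross, dot, psub; simpl. ring. Qed.

(** Meant for [U = T j] with orthogonal [T]: pairing a vanishing combination with [T j] isolates the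
    coefficient [c j], which proves independence. *)
Lemma Hess_comb_zero (n m : nat) (ct : nat -> R) (U : nat -> pt) (c : nat -> R)
  (V : nat -> nat -> pt) : (0 < n)%nat ->
  (forall i, (i < n)%nat -> rsum m (fun j => c j * fst (V j i)) = 0 /\
                            rsum m (fun j => c j * snd (V j i)) = 0) ->
  rsum m (fun j => c j * Hess n ct U (V j)) = 0.
Proof.
  intros Hn H. unfold Hess.
  rewrite (rsum_ext m _ (fun j => rsum n (fun k => c j *
     eform (ct k) (U k) (U (nxt n k)) (V j k) (V j (nxt n k)))))
    by (intros; rewrite rsum_scal; reflexivity).
  rewrite rsum_swap. apply rsum_zero. intros k Hk.
  destruct (H k Hk) as [A1 A2]. destruct (H (nxt n k) (nxt_lt n k Hn)) as [B1 B2].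
  set (u := U k). set (u' := U (nxt n k)).
  rewrite (rsum_ext m _ (fun j =>
     (/ 2 * snd u' + / 2 * ct k * (fst u' - fst u)) * (c j * fst (V j k)) +
     (- / 2 * fst u' + / 2 * ct k * (snd u' - snd u)) * (c j * snd (V j k)) +
     (- / 2 * snd u - / 2 * ct k * (fst u' - fst u)) * (c j * fst (V j (nxt n k))) +
     (/ 2 * fst u - / 2 * ct k * (snd u' - snd u)) * (c j * snd (V j (nxt n k))))).
  - rewrite !rsum_plus, !rsum_scal, A1, A2, B1, B2. ring.
  - intros j _. unfold eform, cross, dot, psub; simpl. ring.
Qed.

(** * The Hessian as a diagonal form *)

Section TangentForm.
Variables (n : nat) (a : nat -> pt) (t : nat -> R) (R2 tau : R).
Hypothesis Hn : (3 <= n)%nat.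
Hypothesis Ht : forall k, (k < n)%nat -> t k <> 0.
Hypothesis Ha : forall k, (k < n)%nat -> dot (a k) (a k) = R2.
Hypothesis HR2 : 0 < R2.
Hypothesis Hrot : tan_rot n a t.

Let ct (k : nat) : R := / t k.
(** Up to a common factor, [s] and [s'] are the sine and the cosine of one polar angle, and each
    step of the polygon rotates this pair. *)
Let s (k : nat) : R := fst (a k) + tau * snd (a k).
Let s' (k : nat) : R := tau * fst (a k) - snd (a k).
Hypothesis Hs : forall k, (k < n)%nat -> s k <> 0.
Let c (k : nat) : R := - (s k * s (nxt n k) * (1 + t k * t k) / (2 * t k)).

Lemma one_plus_sq (x : R) : 1 + x * x <> 0.
Proof. nra. Qed.

(** The area corrected by the weighted squared lengths is a quadratic form that is critical at [a],
    and for a quadratic form this means that [a] lies in the kernel. That is what cancels the linear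
    part of the area. The fields [rot90 (a k)] and the constant fields below lie in the kernel by
    invariance under rigid motions. *)
Lemma Hess_kernel_a (V : nat -> pt) : Hess n ct a V = 0.
Proof.
  apply (rsum_coboundary n (fun k => - / 2 * cross (a k) (V k))); [lia|].
  intros k Hk. destruct (Hrot k Hk) as [E1 E2].
    unfold eform, ct, cross, dot, psub; simpl. rewrite E1, E2.
    field. auto using one_plus_sq.
Qed.

Lemma Hess_kernel_Ja (V : nat -> pt) : Hess n ct (fun k => rot90 (a k)) V = 0.
Proof.
  apply (rsum_coboundary n (fun k => / 2 * dot (a k) (V k))); [lia|].
  intros k Hk. destruct (Hrot k Hk) as [E1 E2].
    unfold eform, ct, rot90, cross, dot, psub; simpl. rewrite E1, E2.
    field. auto using one_plus_sq.
Qed.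

Lemma Hess_kernel_const (z : pt) (V : nat -> pt) : Hess n ct (fun _ => z) V = 0.
Proof.
  apply (rsum_coboundary n (fun k => / 2 * cross z (V k))); [lia|].
  intros k Hk. unfold eform, cross, dot, psub; simpl. ring.
Qed.

Lemma Hess_mod_kernel (z : pt) (r : R) (U V : nat -> pt) :
  Hess n ct (fun k => (fst (U k) - r * fst (rot90 (a k)) + fst z,
                       snd (U k) - r * snd (rot90 (a k)) + snd z)) V = Hess n ct U V.
Proof.
  transitivity (Hess n ct U V - r * Hess n ct (fun k => rot90 (a k)) V + Hess n ct (fun _ => z) V).
  - unfold Hess. rewrite <- rsum_scal, <- rsum_minus, <- rsum_plus.
    apply rsum_ext. intros k Hk. unfold eform, cross, dot, psub; simpl. ring.
  - rewrite Hess_kernel_Ja, Hess_kernel_const. ring.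
Qed.

Definition q_form (x q q' r r' : R) : R := / 2 * x * (q + q') * (r + r') - (q' - q) * (r' - r) / (2 * x).

Lemma s_rot (k : nat) : (k < n)%nat ->
  s (nxt n k) = ((1 - t k * t k) * s k + 2 * t k * s' k) / (1 + t k * t k) /\
  s' (nxt n k) = ((1 - t k * t k) * s' k - 2 * t k * s k) / (1 + t k * t k).
Proof.
  intros Hk. destruct (Hrot k Hk) as [E1 E2]. unfold s, s'. rewrite E1, E2.
  split; field; apply one_plus_sq.
Qed.

(* Since [s] is in the kernel of the form, the substitution [q = s h] turns it into a sum of
   squares of differences of [h]. *)
Lemma q_form_diagonal (h g : nat -> R) :
  rsum n (fun k => q_form (t k) (s k * h k) (s (nxt n k) * h (nxt n k))
                      (s k * g k) (s (nxt n k) * g (nxt n k))) =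
  rsum n (fun k => c k * (h (nxt n k) - h k) * (g (nxt n k) - g k)).
Proof.
  apply Rminus_diag_uniq. rewrite <- rsum_minus.
  apply (rsum_coboundary n (fun k => - (h k * g k * s k * s' k))); [lia|].
  intros k Hk. destruct (s_rot k Hk) as [E1 E2].
    unfold q_form, c. rewrite E1, E2. field. auto using one_plus_sq.
Qed.

Let hh (d : nat -> R) (k : nat) : R := rsum k d.
Let qq (d : nat -> R) (k : nat) : R := s k * hh d k.
Let dp (d : nat -> R) (k : nat) : R := t k * (qq d k + qq d (nxt n k)).
Let pp (d : nat -> R) (k : nat) : R := rsum k (dp d).
Let W (d : nat -> R) (k : nat) : pt :=
  (- pp d k * snd (a k) - qq d k * fst (a k), pp d k * fst (a k) - qq d k * snd (a k)).
Let xi (d : nat -> R) (k : nat) : R :=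
  (pp d (nxt n k) + pp d k) / 2 + (qq d (nxt n k) - qq d k) / (2 * t k).
(** The difference vector of [h = / s], that is of the constant radial component [q = 1]. Pairing
    with it expresses the closing condition of [pp], and its square is [2 * rsum n t]. *)
Let aa (k : nat) : R := / s (nxt n k) - / s k.

(** The conditions under which the prefix sums [hh d] and [pp d] are well defined around the
    cycle. *)
Definition admissible (d : nat -> R) : Prop := rsum n d = 0 /\ rsum n (dp d) = 0.

Lemma W_edge (d : nat -> R) (k : nat) : admissible d -> (k < n)%nat ->
  fst (W d (nxt n k)) - fst (W d k) = xi d k * - (snd (a (nxt n k)) - snd (a k)) /\
  snd (W d (nxt n k)) - snd (W d k) = xi d k * (fst (a (nxt n k)) - fst (a k)).
Proof.
  intros [_ H2] Hk. destruct (Hrot k Hk) as [E1 E2].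
  assert (Ep : pp d (nxt n k) = pp d k + dp d k) by (apply prefix_nxt; auto).
  unfold xi, W; simpl. rewrite Ep. unfold dp. rewrite E1, E2.
  split; field; auto using one_plus_sq.
Qed.

Lemma Hess_W (d g : nat -> R) : admissible d -> admissible g ->
  Hess n ct (W d) (W g) = R2 * dform n c d g.
Proof.
  intros [Hd1 Hd2] [Hg1 Hg2].
  assert (Ed : forall k, (k < n)%nat -> hh d (nxt n k) - hh d k = d k).
  { intros k Hk. unfold hh. rewrite prefix_nxt by auto. ring. }
  assert (Eg : forall k, (k < n)%nat -> hh g (nxt n k) - hh g k = g k).
  { intros k Hk. unfold hh. rewrite prefix_nxt by auto. ring. }
  transitivity (R2 * rsum n (fun k => c k * (hh d (nxt n k) - hh d k) * (hh g (nxt n k) - hh g k))).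
  2:{ f_equal. apply rsum_ext. intros k Hk. rewrite Ed, Eg by auto. ring. }
  rewrite <- q_form_diagonal, <- rsum_scal.
  apply Rminus_diag_uniq. unfold Hess. rewrite <- rsum_minus.
  (* The tangential components survive only in this potential: their increments are expressed by the
     radial ones. *)
  apply (rsum_coboundary n (fun k => - / 2 * R2 * (pp d k * qq g k + pp g k * qq d k))); [lia|].
  intros k Hk. destruct (Hrot k Hk) as [E1 E2].
  assert (Ep : pp d (nxt n k) = pp d k + dp d k) by (apply prefix_nxt; auto).
  assert (Ep' : pp g (nxt n k) = pp g k + dp g k) by (apply prefix_nxt; auto).
  change (s k * hh d k) with (qq d k). change (s k * hh g k) with (qq g k).
  change (s (nxt n k) * hh d (nxt n k)) with (qq d (nxt n k)).
  change (s (nxt n k) * hh g (nxt n k)) with (qq g (nxt n k)).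
  rewrite <- (Ha k Hk). unfold eform, W, ct, q_form, cross, dot, psub; simpl.
  rewrite Ep, Ep'. unfold dp. rewrite E1, E2.
  field. auto using one_plus_sq.
Qed.

Lemma dform_aa (d : nat -> R) : rsum n d = 0 -> dform n c aa d = rsum n (dp d).
Proof.
  intros Hd.
  transitivity (rsum n (fun k => c k * (/ s (nxt n k) - / s k) * (hh d (nxt n k) - hh d k))).
  - apply rsum_ext. intros k Hk. unfold hh. rewrite prefix_nxt by auto. unfold aa. ring.
  - rewrite <- (q_form_diagonal (fun k => / s k)). apply rsum_ext. intros k Hk.
    rewrite !Rinv_r by (apply Hs; auto; apply nxt_lt; lia).
    unfold q_form, dp, qq. field. auto.
Qed.

Lemma dform_aa_aa : dform n c aa aa = 2 * rsum n t.
Proof.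
  transitivity (rsum n (fun k => c k * (/ s (nxt n k) - / s k) * (/ s (nxt n k) - / s k))).
  - apply rsum_ext. reflexivity.
  - rewrite <- (q_form_diagonal (fun k => / s k) (fun k => / s k)), <- rsum_scal.
    apply rsum_ext. intros k Hk.
    rewrite !Rinv_r by (apply Hs; auto; apply nxt_lt; lia).
    unfold q_form. field. auto.
Qed.

Lemma c_nonzero (k : nat) : (k < n)%nat -> c k <> 0.
Proof.
  intros Hk. assert (H1 := Hs k Hk). assert (H2 := Hs _ (nxt_lt n k ltac:(lia))).
  assert (H3 := Ht k Hk). assert (H4 := one_plus_sq (t k)).
  unfold c, Rdiv. apply Ropp_neq_0_compat.
  repeat apply Rmult_integral_contrapositive_currified; auto.
  apply Rinv_neq_0_compat. lra.
Qed.

(** The square in question is the sum of the [/ c k], and [/ c k] is the increment of [s' k / s k],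
    a cotangent of the polar angle, divided by [K]. Geometrically this vector has radial components
    [s' k / K] up to a multiple of [s k], which are linear in [a k]: it represents a translation, up
    to a rotation. *)
Lemma inv_c_isotropic : dform n c (fun k => / c k) (fun k => / c k) = 0.
Proof.
  set (K := (1 + tau * tau) * R2).
  assert (HK : K <> 0) by (unfold K; nra).
  apply (rsum_coboundary n (fun k => / K * (s' k / s k))); [lia|].
  intros k Hk. pose proof (c_nonzero k Hk) as Hc.
  transitivity (/ c k); [field; auto|].
  assert (H1 := Hs k Hk). assert (H2 := Hs _ (nxt_lt n k ltac:(lia))).
  assert (H3 := Ht k Hk). assert (H4 := one_plus_sq (t k)).
  destruct (s_rot k Hk) as [E1 E2].
  assert (EK : K = s k * s k + s' k * s' k).
  { unfold K. rewrite <- (Ha k Hk). unfold s, s', dot. ring. }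
  assert (Ew : s' (nxt n k) * s k - s' k * s (nxt n k) = - (2 * t k / (1 + t k * t k)) * K).
  { rewrite EK, E1, E2. field. auto. }
  transitivity (/ K * ((s' (nxt n k) * s k - s' k * s (nxt n k)) / (s k * s (nxt n k)))).
  - rewrite Ew. unfold c. field. repeat split; auto.
  - field. repeat split; auto.
Qed.

Lemma tangent_basis : rsum n t <> 0 ->
  exists (T : nat -> nat -> pt) (lam : nat -> R),
    (forall j, T j 0%nat = (0, 0)) /\
    (forall j, (j < n - 3)%nat -> T j 1%nat = (0, 0)) /\
    (forall j m, (j < n - 3)%nat -> (m < n)%nat ->
       dot (psub (a (nxt n m)) (a m)) (psub (T j (nxt n m)) (T j m)) = 0) /\
    (forall i j, (i < n - 3)%nat -> (j < n - 3)%nat -> i <> j -> Hess n ct (T i) (T j) = 0) /\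
    (forall i, (i < n - 3)%nat -> Hess n ct (T i) (T i) = lam i) /\
    (forall i, (i < n - 3)%nat -> lam i <> 0) /\
    ncount n (fun k => is_neg (c k)) =
      ((if is_neg (rsum n t) then 1 else 0) + 1 + num_neg (n - 3) lam)%nat.
Proof.
  intros Hsum.
  assert (Hda : rsum n aa = 0) by (apply (rsum_coboundary n (fun k => / s k)); [lia|auto]).
  (* Pairing with [/ c k] is the plain sum, so orthogonality to it is the closing condition of
     [hh]. *)
  assert (Hu : forall x, dform n c x (fun k => / c k) = rsum n x).
  { intros x. apply rsum_ext. intros k Hk. field. apply c_nonzero; auto. }
  destruct (index_reduction n c aa (fun k => / c k)) as [b [[Ho Hne] [Hperp Hcount]]].
  - auto.
  - apply c_nonzero.
  - apply Rinv_neq_0_compat. apply c_nonzero. lia.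
  - apply inv_c_isotropic.
  - rewrite Hu. auto.
  - rewrite dform_aa_aa. lra.
  - assert (Hadm : forall j, (j < n - 3)%nat -> admissible (b j)).
    { intros j Hj. destruct (Hperp j Hj) as [H1 H2].
      assert (H3 : rsum n (b j) = 0) by (rewrite <- Hu, dform_sym; auto).
      split; auto. rewrite <- dform_aa by auto. auto. }
    (* Normalisation to the slice: subtracting a rotation with the angular velocity of edge [0]
       brings that edge to rest, and the translation [z] then brings vertex [0] to rest. Both
       changes lie in the kernel of the form. *)
    set (z := fun d => (xi d 0%nat * fst (rot90 (a 0%nat)) - fst (W d 0%nat),
                        xi d 0%nat * snd (rot90 (a 0%nat)) - snd (W d 0%nat))).
    set (T := fun j k => (fst (W (b j) k) - xi (b j) 0%nat * fst (rot90 (a k)) + fst (z (b j)),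
                          snd (W (b j) k) - xi (b j) 0%nat * snd (rot90 (a k)) + snd (z (b j)))).
    assert (HT : forall i j, (i < n - 3)%nat -> (j < n - 3)%nat ->
              Hess n ct (T i) (T j) = R2 * dform n c (b i) (b j)).
    { intros i j Hi Hj. unfold T. rewrite Hess_mod_kernel, Hess_sym, Hess_mod_kernel, Hess_sym.
      apply Hess_W; auto. }
    exists T, (fun j => R2 * dform n c (b j) (b j)).
    split; [|split; [|split; [|split; [|split; [|split]]]]].
    + intros j. unfold T, z; simpl. f_equal; ring.
    + intros j Hj. assert (E : nxt n 0 = 1%nat) by (unfold nxt; apply Nat.mod_small; lia).
      destruct (W_edge (b j) 0 (Hadm j Hj) ltac:(lia)) as [W1 W2]. rewrite E in W1, W2.
      unfold T, z. f_equal; unfold rot90; simpl fst in *; simpl snd in *; lra.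
    + intros j m Hj Hm. destruct (W_edge (b j) m (Hadm j Hj) Hm) as [W1 W2].
      set (f := psub (a (nxt n m)) (a m)).
      assert (E : psub (T j (nxt n m)) (T j m) =
         ((xi (b j) m - xi (b j) 0%nat) * - snd f, (xi (b j) m - xi (b j) 0%nat) * fst f)).
      { unfold psub at 1, T. cbn [fst snd]. unfold f, psub, rot90. cbn [fst snd].
        f_equal.
        - transitivity (fst (W (b j) (nxt n m)) - fst (W (b j) m) +
            xi (b j) 0%nat * (snd (a (nxt n m)) - snd (a m))); [ring|]. rewrite W1. ring.
        - transitivity (snd (W (b j) (nxt n m)) - snd (W (b j) m) -
            xi (b j) 0%nat * (fst (a (nxt n m)) - fst (a m))); [ring|]. rewrite W2. ring. }
      rewrite E. unfold dot; simpl. ring.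
    + intros i j Hi Hj Hij. rewrite HT, Ho by auto. ring.
    + intros i Hi. apply HT; auto.
    + intros i Hi. apply Rmult_integral_contrapositive_currified; [lra|auto].
    + rewrite Hcount, dform_aa_aa. f_equal; [f_equal|].
      * unfold is_neg. destruct (Rlt_dec (2 * rsum n t) 0); destruct (Rlt_dec (rsum n t) 0);
          auto; lra.
      * unfold num_neg. apply ncount_ext. intros i Hi. unfold is_neg.
        destruct (Rlt_dec (dform n c (b i) (b i)) 0); destruct (Rlt_dec (R2 * dform n c (b i) (b i)) 0);
          auto; nra.
Qed.

End TangentForm.

(** * Half turns and the signs of the coefficients *)

Lemma polar_angle (x y : R) : x <> 0 -> exists K f, x = K * sin f /\ y = K * cos f.
Proof.
  intros Hx. set (z := y / x). set (q := sqrt (1 + z²)).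
  assert (Hq : 0 < q) by (apply sqrt_lt_R0; pose proof (Rle_0_sqr z); lra).
  exists (x * q), (PI / 2 - atan z).
  rewrite sin_shift, cos_shift, cos_atan, sin_atan. fold q. unfold z. split; field; lra.
Qed.

Lemma sin_IZR_PI (m : Z) : sin (IZR m * PI) = 0.
Proof. apply sin_eq_0_1. exists m. reflexivity. Qed.

Lemma floor_PI (f : R) : sin f <> 0 ->
  exists m : Z, IZR m * PI < f < (IZR m + 1) * PI.
Proof.
  intros Hf. exists (Int_part (f / PI)). pose proof PI_RGT_0 as HPI.
  destruct (base_Int_part (f / PI)) as [H1 H2]. set (m := Int_part (f / PI)) in *.
  assert (E : f = f / PI * PI) by (field; lra).
  assert (Hle : IZR m * PI <= f) by (apply (Rle_trans _ (f / PI * PI)); [apply Rmult_le_compat_r|]; lra).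
  split.
  - destruct (Req_dec (IZR m * PI) f) as [Q|Q]; [|lra].
    exfalso. apply Hf. rewrite <- Q. apply sin_IZR_PI.
  - apply (Rle_lt_trans _ (f / PI * PI)); [|apply Rmult_lt_compat_r]; lra.
Qed.

Lemma sin_shift_sign (m : Z) (f : R) : IZR m * PI < f < (IZR m + 1) * PI ->
  0 < cos (IZR m * PI) * sin f.
Proof.
  intros H. set (g := f - IZR m * PI).
  assert (Hg : 0 < sin g) by (apply sin_gt_0; unfold g; lra).
  assert (E : sin f = cos (IZR m * PI) * sin g).
  { replace f with (IZR m * PI + g) by (unfold g; ring).
    rewrite sin_plus, sin_IZR_PI. ring. }
  rewrite E.
  assert (E2 : cos (IZR m * PI) * cos (IZR m * PI) = 1).
  { pose proof (sin2_cos2 (IZR m * PI)) as Q. unfold Rsqr in Q. rewrite sin_IZR_PI in Q. lra. }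
  rewrite <- Rmult_assoc, E2. lra.
Qed.

(** An angle growing by less than [PI] crosses at most one multiple of [PI], and the sine changes
    sign exactly when it does. *)
Lemma floor_step (m m' : Z) (f f' d : R) :
  IZR m * PI < f < (IZR m + 1) * PI -> IZR m' * PI < f' < (IZR m' + 1) * PI ->
  f' = f + d -> 0 < d < PI ->
  m' = m /\ 0 < sin f * sin f' \/ m' = (m + 1)%Z /\ sin f * sin f' < 0.
Proof.
  intros H H' E Hd. pose proof PI_RGT_0 as HPI.
  assert (H1 : IZR m < IZR m' + 1) by nra.
  assert (H2 : IZR m' < IZR m + 2) by nra.
  rewrite <- plus_IZR in H1, H2. apply lt_IZR in H1, H2.
  pose proof (sin_shift_sign m f H) as S1. pose proof (sin_shift_sign m' f' H') as S2.
  assert (Hm : m' = m \/ m' = (m + 1)%Z) by lia.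
  destruct Hm as [->| ->].
  - left. split; auto. destruct (Rlt_dec 0 (cos (IZR m * PI))); nra.
  - right. split; auto. rewrite plus_IZR in S2.
    replace ((IZR m + 1) * PI) with (IZR m * PI + PI) in S2 by ring.
    rewrite neg_cos in S2. destruct (Rlt_dec 0 (cos (IZR m * PI))); nra.
Qed.

(* Each step contributes [1] or [0] according to the sign of the rotation, minus the change of
   the number of half turns. *)
Lemma sign_count (n : nat) (F : nat -> R) (b : nat -> R) (w : Z) :
  (forall k, (k <= n)%nat -> sin (F k) <> 0) ->
  (forall k, (k < n)%nat -> F (S k) = F k + 2 * b k) ->
  (forall k, (k < n)%nat -> 0 < Rabs (b k) < PI / 2) ->
  F n = F 0%nat + 2 * (IZR w * PI) ->
  INR (ncount n (fun k => is_neg (- (sin (F k) * sin (F (S k)) / sin (2 * b k))))) =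
  INR (ncount n (fun k => if Rlt_dec 0 (b k) then true else false)) - 2 * IZR w.
Proof.
  intros Hs HF Hb Hw. pose proof PI_RGT_0 as HPI.
  destruct (fin_choice 0%Z (S n) (fun k m => IZR m * PI < F k < (IZR m + 1) * PI)) as [m Hm].
  { intros k Hk. apply floor_PI. apply Hs. lia. }
  assert (Hend : IZR (m n) - IZR (m 0%nat) = 2 * IZR w).
  { pose proof (Hm n ltac:(lia)) as H1. pose proof (Hm 0%nat ltac:(lia)) as H2.
    rewrite Hw in H1. rewrite <- minus_IZR. rewrite <- (mult_IZR 2 w). f_equal.
    assert (A1 : IZR (m n) < IZR (m 0%nat) + 1 + 2 * IZR w) by nra.
    assert (A2 : IZR (m 0%nat) + 2 * IZR w < IZR (m n) + 1) by nra.
    rewrite <- (mult_IZR 2 w), <- !plus_IZR in A1. rewrite <- (mult_IZR 2 w), <- !plus_IZR in A2.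
    apply lt_IZR in A1, A2. lia. }
  rewrite !ncount_rsum, <- Hend, <- (rsum_telescope n (fun k => IZR (m k))), <- rsum_minus.
  apply rsum_ext. intros k Hk. specialize (HF k Hk). specialize (Hb k Hk).
  pose proof (Hm k ltac:(lia)) as H1. pose proof (Hm (S k) ltac:(lia)) as H2.
  destruct (Rlt_dec 0 (b k)) as [Hp|Hp].
  - rewrite Rabs_right in Hb by lra.
    assert (Hsin : 0 < sin (2 * b k)) by (apply sin_gt_0; lra).
    destruct (floor_step _ _ _ _ _ H1 H2 HF ltac:(lra)) as [[-> Hx]|[-> Hx]].
    + assert (0 < sin (F k) * sin (F (S k)) / sin (2 * b k)) by (apply Rdiv_lt_0_compat; auto).
      unfold is_neg. destruct (Rlt_dec _ _); lra.
    + assert (0 < - (sin (F k) * sin (F (S k))) / sin (2 * b k)) by (apply Rdiv_lt_0_compat; lra).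
      rewrite plus_IZR. unfold is_neg, Rdiv in *. destruct (Rlt_dec _ _); lra.
  - assert (Hneg : b k < 0) by (destruct (Req_dec (b k) 0) as [E|E]; [rewrite E, Rabs_R0 in Hb; lra|lra]).
    rewrite Rabs_left in Hb by auto.
    assert (Hsin : 0 < - sin (2 * b k)).
    { rewrite <- sin_neg. apply sin_gt_0; lra. }
    assert (Hdiv : forall x, x / sin (2 * b k) = (- x) / - sin (2 * b k)) by (intros; field; lra).
    (* A negative rotation is read backwards, as a positive step from [F (S k)] to [F k]. *)
    destruct (floor_step _ _ _ _ (- (2 * b k)) H2 H1 ltac:(lra) ltac:(lra)) as [[E Hx]|[E Hx]].
    + rewrite E. assert (0 < (sin (F k) * sin (F (S k))) / - sin (2 * b k))
        by (apply Rdiv_lt_0_compat; lra).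
      rewrite Hdiv. unfold is_neg, Rdiv in *. destruct (Rlt_dec _ _); lra.
    + rewrite E, plus_IZR. assert (0 < - (sin (F k) * sin (F (S k))) / - sin (2 * b k))
        by (apply Rdiv_lt_0_compat; lra).
      rewrite Hdiv. unfold is_neg. destruct (Rlt_dec _ _); lra.
Qed.

(** * The area near a cyclic polygon and its index *)

Lemma generic_direction (n : nat) (a : nat -> pt) (R2 : R) : 0 < R2 ->
  (forall k, (k < n)%nat -> dot (a k) (a k) = R2) ->
  exists tau, forall k, (k < n)%nat -> fst (a k) + tau * snd (a k) <> 0.
Proof.
  (* A [tau] larger than every [Rabs (x / y)] avoids the finitely many slopes at which [x + tau * y]
     vanishes. For [y = 0] the expression is [x] itself, nonzero because [R2 > 0]. *)
  intros HR Ha. set (tau := 1 + rsum n (fun k => Rabs (fst (a k) / snd (a k)))).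
  exists tau. intros k Hk E.
  pose proof (rsum_term_le n k (fun k => Rabs (fst (a k) / snd (a k))) Hk
                (fun i _ => Rabs_pos _)) as Hle. cbv beta in Hle.
  assert (Ht : Rabs (fst (a k) / snd (a k)) < tau) by (unfold tau; lra).
  specialize (Ha k Hk). unfold dot in Ha.
  destruct (Req_dec (snd (a k)) 0) as [Ey|Ey].
  - rewrite Ey in *. assert (fst (a k) = 0) by lra. rewrite H in Ha. lra.
  - assert (Eq : fst (a k) / snd (a k) = - tau).
    { replace (fst (a k)) with (- tau * snd (a k)) by lra. field; auto. }
    rewrite Eq, Rabs_Ropp in Ht. pose proof (Rle_abs tau). lra.
Qed.

Lemma double_angle_tan (b : R) : cos b <> 0 ->
  cos (2 * b) = (1 - tan b * tan b) / (1 + tan b * tan b) /\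
  sin (2 * b) = 2 * tan b / (1 + tan b * tan b).
Proof.
  intros Hc.
  assert (H1 : cos b * cos b + sin b * sin b = 1).
  { pose proof (sin2_cos2 b) as E. unfold Rsqr in E. lra. }
  assert (H2 : 1 + tan b * tan b = / (cos b * cos b)).
  { unfold tan. transitivity ((cos b * cos b + sin b * sin b) / (cos b * cos b)).
    - field; auto.
    - rewrite H1. field; auto. }
  rewrite H2, cos_2a, sin_2a. unfold tan. split; field; auto.
Qed.

(* The linear part of the area at a cyclic polygon is cancelled by the length constraints. *)
Lemma area_expansion (n : nat) (P Q : nat -> pt) (O : pt) (t : nat -> R) : (3 <= n)%nat ->
  (forall k, (k < n)%nat -> t k <> 0) ->
  tan_rot n (fun k => psub (P k) O) t ->
  (forall k, (k < n)%nat -> dot (psub (Q k) (Q (nxt n k))) (psub (Q k) (Q (nxt n k))) =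
                            dot (psub (P k) (P (nxt n k))) (psub (P k) (P (nxt n k)))) ->
  let W := fun k => psub (Q k) (P k) in
  area n Q = area n P + / 2 * Hess n (fun k => / t k) W W.
Proof.
  intros Hn Ht Hrot Hlen W.
  pose proof (Hess_kernel_a n (fun k => psub (P k) O) t Hn Ht Hrot W) as HK.
  unfold area. rewrite <- Rmult_plus_distr_l. f_equal.
  rewrite <- (Rplus_0_r (_ + _)). rewrite <- (Rmult_0_r 2), <- HK. unfold Hess.
  rewrite <- rsum_scal, <- !rsum_plus. apply Rminus_diag_uniq. rewrite <- rsum_minus.
  apply (rsum_coboundary n (fun k => cross O (W k))); [lia|].
  intros k Hk. specialize (Hlen k Hk). specialize (Ht k Hk).
  unfold W, eform, cross, dot, psub in *. simpl in *.
  set (p1 := fst (P k)) in *. set (p2 := snd (P k)) in *.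
  set (p1' := fst (P (nxt n k))) in *. set (p2' := snd (P (nxt n k))) in *.
  set (q1 := fst (Q k)) in *. set (q2 := snd (Q k)) in *.
  set (q1' := fst (Q (nxt n k))) in *. set (q2' := snd (Q (nxt n k))) in *.
  apply Rminus_diag_uniq.
  (* What remains is the difference of the squared edge lengths of [Q] and [P] with the factor
     [/ 2 * / t k], hence zero. *)
  match goal with |- ?G = 0 => transitivity (/ 2 * / t k *
    (((q1 - q1') * (q1 - q1') + (q2 - q2') * (q2 - q2')) -
     ((p1 - p1') * (p1 - p1') + (p2 - p2') * (p2 - p2')))) end.
  - field. auto.
  - rewrite Hlen. ring.
Qed.

(** The reason why second derivatives of the chart disappear: at a common zero of the factors they
    are multiplied by zero. *)
Lemma Jet_prod0 (k : nat) (r : R) (f g : (nat -> R) -> R) f1 g1 :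
  Jet1 k r f 0 f1 -> Jet1 k r g 0 g1 ->
  Jet k r (fun y => f y * g y) 0 (fun _ => 0) (fun i j => f1 i * g1 j + f1 j * g1 i).
Proof.
  intros [f2 Hf] [g2 Hg].
  eapply Jet_val; [apply (Jet_mult _ _ _ _ _ _ _ _ _ _ Hf Hg)| | |]; intros; simpl; ring.
Qed.

Lemma area_jet (n k : nat) (r A0 : R) (ct : nat -> R) (P : nat -> pt)
  (phi : (nat -> R) -> nat -> pt) (T : nat -> nat -> pt) : (0 < n)%nat ->
  (forall i, (i < n)%nat ->
    Jet1 k r (fun x => fst (phi x i)) (fst (P i)) (fun j => fst (T j i)) /\
    Jet1 k r (fun x => snd (phi x i)) (snd (P i)) (fun j => snd (T j i))) ->
  let W := fun x i => psub (phi x i) (P i) in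
  Jet k r (fun x => A0 + / 2 * Hess n ct (W x) (W x)) A0 (fun _ => 0)
    (fun i j => Hess n ct (T i) (T j)).
Proof.
  intros Hn HJ W.
  assert (HW : forall i, (i < n)%nat ->
    Jet1 k r (fun x => fst (W x i)) 0 (fun j => fst (T j i)) /\
    Jet1 k r (fun x => snd (W x i)) 0 (fun j => snd (T j i))).
  { intros i Hi. destruct (HJ i Hi) as [J1 J2]. split.
    - eapply Jet1_val; [apply (Jet1_minus _ _ _ _ _ _ _ _ J1 (Jet1_const k r (fst (P i))))
                       |ring|intros; simpl; ring].
    - eapply Jet1_val; [apply (Jet1_minus _ _ _ _ _ _ _ _ J2 (Jet1_const k r (snd (P i))))
                       |ring|intros; simpl; ring]. }
  assert (HS : forall m, (m < n)%nat ->
    Jet k r (fun x => eform (ct m) (W x m) (W x (nxt n m)) (W x m) (W x (nxt n m))) 0 (fun _ => 0)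
      (fun i j => 2 * eform (ct m) (T i m) (T i (nxt n m)) (T j m) (T j (nxt n m)))).
  { intros m Hm. destruct (HW m Hm) as [A1 A2].
    destruct (HW (nxt n m) (nxt_lt n m Hn)) as [B1 B2].
    pose proof (Jet1_minus _ _ _ _ _ _ _ _ B1 A1) as D1.
    pose proof (Jet1_minus _ _ _ _ _ _ _ _ B2 A2) as D2.
    apply (Jet1_val _ _ _ _ _ 0 (fun j => fst (T j (nxt n m)) - fst (T j m))) in D1; auto; [|ring].
    apply (Jet1_val _ _ _ _ _ 0 (fun j => snd (T j (nxt n m)) - snd (T j m))) in D2; auto; [|ring].
    pose proof (Jet_minus _ _ _ _ _ _ _ _ _ _ (Jet_prod0 _ _ _ _ _ _ A1 B2)
                  (Jet_prod0 _ _ _ _ _ _ A2 B1)) as X1.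
    pose proof (Jet_scal _ _ (/ 2 * ct m) _ _ _ _
      (Jet_plus _ _ _ _ _ _ _ _ _ _ (Jet_prod0 _ _ _ _ _ _ D1 D1)
                  (Jet_prod0 _ _ _ _ _ _ D2 D2))) as X2.
    pose proof (Jet_minus _ _ _ _ _ _ _ _ _ _ X1 X2) as X. cbv beta in X.
    match type of X with Jet _ _ ?f _ _ _ =>
      replace (fun x => eform (ct m) (W x m) (W x (nxt n m)) (W x m) (W x (nxt n m))) with f end.
    - eapply Jet_val; [exact X| | |]; intros; unfold eform, cross, dot, psub; simpl; field.
    - apply functional_extensionality. intros x. unfold eform, cross, dot, psub; simpl. field. }
  pose proof (Jet_rsum k r n _ _ _ _ HS) as HR.
  pose proof (Jet_plus _ _ _ _ _ _ _ _ _ _ (Jet_const k r A0) (Jet_scal _ _ (/ 2) _ _ _ _ HR)) as X.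
  eapply Jet_val; [exact X| | |]; intros; cbv beta.
  - rewrite rsum_zero by auto. ring.
  - rewrite rsum_zero by auto. ring.
  - rewrite rsum_scal. unfold Hess. field.
Qed.

Lemma Jet_GradHess (k : nat) (r : R) f f0 f1 f2 : 0 < r ->
  Jet k r f f0 f1 f2 -> GradHessAt0 k f f1 f2.
Proof. intros Hr [D1 [D2 [H [_ [H1 H2]]]]]. exists r, D1, D2. auto. Qed.

Lemma SymEigenvalues_diag (k : nat) (H : nat -> nat -> R) (lam : nat -> R) :
  (forall i j, (i < k)%nat -> (j < k)%nat -> i <> j -> H i j = 0) ->
  (forall i, (i < k)%nat -> H i i = lam i) -> SymEigenvalues k H lam.
Proof.
  intros H0 H1. exists unitv. split; intros i j Hi Hj.
  - transitivity (rsum k (fun m => unitv m i * unitv j m)).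
    + apply rsum_ext. intros m Hm. f_equal. unfold unitv. rewrite Nat.eqb_sym. auto.
    + rewrite (rsum_unitv k j (fun m => unitv m i) Hj). reflexivity.
  - transitivity (lam i * unitv j i).
    + unfold unitv. destruct (Nat.eqb_spec i j) as [->|Hne].
      * rewrite H1 by auto. ring.
      * rewrite H0 by auto. ring.
    + rewrite <- (rsum_unitv k i (fun m => lam m * unitv j m) Hi).
      apply rsum_ext. intros m Hm. ring.
Qed.

(** Edges [p] and [S p] are parallel exactly when [t (S p) = - t p], that is when the polygon turns
    back on itself. If this happens from edge [1] on, the vertices alternate between [a 1] and
    [a 2]. Closing then means [a 0 = a 1], impossible since [t 0 <> 0], or [a 0 = a 2], in which
    case [rsum n t = t 0 + t 1 = 0]. *)
Lemma edges_not_parallel (n : nat) (a : nat -> pt) (t : nat -> R) (R2 : R) :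
  (3 <= n)%nat -> 0 < R2 -> (forall k, (k < n)%nat -> t k <> 0) ->
  (forall k, (k < n)%nat -> dot (a k) (a k) = R2) ->
  tan_rot n a t -> rsum n t <> 0 ->
  exists p, (1 <= p)%nat /\ (p + 2 <= n)%nat /\
    cross (psub (a (nxt n p)) (a p)) (psub (a (nxt n (S p))) (a (S p))) <> 0.
Proof.
  intros Hn HR Ht Ha Hrot Hsum.
  destruct (Forall_Exists_dec (fun p => cross (psub (a (nxt n p)) (a p))
     (psub (a (nxt n (S p))) (a (S p))) = 0) (fun p => Req_EM_T _ 0) (seq 1 (n - 2))) as [H|H].
  2:{ apply Exists_exists in H. destruct H as [p [Hp H]]. apply in_seq in Hp.
      exists p. repeat split; auto; lia. }
  exfalso. rewrite Forall_forall in H.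
  assert (Hc : forall p, (1 <= p)%nat -> (p + 2 <= n)%nat -> t (S p) = - t p).
  { intros p Hp1 Hp2. specialize (H p ltac:(apply in_seq; lia)).
    assert (E : nxt n p = S p) by (unfold nxt; rewrite Nat.mod_small; lia).
    destruct (Hrot p ltac:(lia)) as [A1 A2]. destruct (Hrot (S p) ltac:(lia)) as [B1 B2].
    rewrite E in *. specialize (Ha p ltac:(lia)).
    assert (Z : cross (psub (a (S p)) (a p)) (psub (a (nxt n (S p))) (a (S p))) *
       ((1 + t p * t p) * (1 + t (S p) * t (S p))) =
       4 * t p * t (S p) * (t p + t (S p)) * R2).
    { rewrite <- Ha. unfold cross, psub, dot; simpl. rewrite B1, B2, A1, A2.
      field. auto using one_plus_sq. }
    rewrite H, Rmult_0_l in Z. symmetry in Z.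
    pose proof (Ht p ltac:(lia)). pose proof (Ht (S p) ltac:(lia)).
    apply Rmult_integral in Z. destruct Z as [Z|Z]; [|lra].
    apply Rmult_integral in Z. destruct Z as [Z|Z]; [|lra].
    apply Rmult_integral in Z. destruct Z as [Z|Z]; lra. }
  assert (Hm : forall x y : pt, fst x = fst y -> snd x = snd y -> x = y).
  { intros [? ?] [? ?]; simpl; intros; subst; auto. }
  assert (E0 : nxt n 0 = 1%nat) by (unfold nxt; apply Nat.mod_small; lia).
  assert (E1 : nxt n 1 = (2 mod n)%nat) by reflexivity.
  assert (Hst : forall i, (1 <= i)%nat -> (i <= n)%nat ->
    (rsum i t = t 0%nat /\ a (i mod n)%nat = a 1%nat /\ ((i < n)%nat -> t i = t 1%nat)) \/
    (rsum i t = t 0%nat + t 1%nat /\ a (i mod n)%nat = a (nxt n 1) /\ ((i < n)%nat -> t i = - t 1%nat))).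
  { induction i as [|i IH]; intros Hi1 Hi2; [lia|].
    destruct (Nat.eq_dec i 0) as [->|Hi0].
    - left. rewrite Nat.mod_small by lia. simpl. repeat split; auto. ring.
    - destruct (Hrot i ltac:(lia)) as [A1 A2].
      assert (En : nxt n i = (S i mod n)%nat) by (unfold nxt; rewrite Nat.add_1_r; auto).
      rewrite En in A1, A2.
      assert (Hnext : (S i < n)%nat -> t (S i) = - t i) by (intros; apply Hc; lia).
      destruct IH as [[I1 [I2 I3]]|[I1 [I2 I3]]]; [lia|lia| |];
        rewrite (Nat.mod_small i n) in I2 by lia; specialize (I3 ltac:(lia));
        rewrite I2, I3 in A1, A2; simpl rsum; rewrite I1, I3; rewrite I3 in Hnext.
      + right. split; [auto|split; [|intros X; rewrite (Hnext X); auto]].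
        destruct (Hrot 1%nat ltac:(lia)) as [B1 B2]. apply Hm; congruence.
      + left. split; [ring|split; [|intros X; rewrite (Hnext X); ring]].
        destruct (Hrot 1%nat ltac:(lia)) as [B1 B2].
        apply Hm; [rewrite A1|rewrite A2]; rewrite B1, B2; field;
          pose proof (one_plus_sq (t 1%nat)); lra. }
  destruct (Hrot 0%nat ltac:(lia)) as [C1 C2]. rewrite E0 in C1, C2.
  assert (H0 := Ha 0%nat ltac:(lia)). assert (Ht0 := Ht 0%nat ltac:(lia)). unfold dot in H0.
  pose proof (one_plus_sq (t 0%nat)) as N0. pose proof (one_plus_sq (t 1%nat)) as N1.
  set (x := fst (a 0%nat)) in *. set (y := snd (a 0%nat)) in *.
  destruct (Hst n ltac:(lia) (Nat.le_refl n)) as [[I1 [I2 _]]|[I1 [I2 _]]];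
    rewrite Nat.Div0.mod_same in I2.
  - assert (Z : (x * snd (a 1%nat) - y * fst (a 1%nat)) * (1 + t 0%nat * t 0%nat) = 2 * t 0%nat * R2).
    { rewrite C1, C2, <- H0. field; auto. }
    rewrite <- I2 in Z. fold x y in Z.
    replace ((x * y - y * x) * (1 + t 0%nat * t 0%nat)) with 0 in Z by ring.
    assert (t 0%nat * R2 <> 0) by (apply Rmult_integral_contrapositive_currified; lra). lra.
  - destruct (Hrot 1%nat ltac:(lia)) as [B1 B2]. rewrite <- I2 in B1, B2. fold x y in B1, B2.
    rewrite C1, C2 in B1, B2.
    set (t0 := t 0%nat) in *. set (t1 := t 1%nat) in *.
    match type of B1 with _ = ?r1 => match type of B2 with _ = ?r2 =>
      assert (Z : (x * r1 + y * r2) * ((1 + t0 * t0) * (1 + t1 * t1)) =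
        ((1 + t0 * t0) * (1 + t1 * t1) - 2 * ((t0 + t1) * (t0 + t1))) * (x * x + y * y))
        by (field; auto) end end.
    rewrite <- B1, <- B2, H0 in Z.
    assert (Z' : (t0 + t1) * (t0 + t1) * R2 = 0) by lra.
    rewrite I1 in Hsum.
    assert ((t0 + t1) * (t0 + t1) * R2 <> 0); [|auto].
    repeat apply Rmult_integral_contrapositive_currified; auto; lra.
Qed.

Lemma cyclic_morse (n : nat) (l : nat -> R) (P : nat -> pt) (O : pt) (Rad : R) :
  (3 <= n)%nat -> (forall i, (i < n)%nat -> 0 < l i) ->
  InL n l P -> OnCircle n P O Rad ->
  (forall i, (i < n)%nat -> cross (psub (P i) O) (psub (P (nxt n i)) O) <> 0) ->
  tanSum n P O <> 0 ->
  exists mu, NondegCritIndex n l P mu /\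
    INR mu = INR (eP n P O) - 1 - 2 * windingP n P O
             - (if Rlt_dec 0 (tanSum n P O) then 0 else 1).
Proof.
  intros Hn Hl HP HC Hcr Hts.
  assert (Hn0 : (0 < n)%nat) by lia.
  pose proof PI_RGT_0 as HPI.
  set (a := fun k => psub (P k) O). set (R2 := Rad * Rad).
  set (b := hangle n P O). set (t := fun k => tan (b k)).
  assert (HR : 0 < Rad) by apply HC. assert (HR2 : 0 < R2) by (unfold R2; nra).
  assert (Hal : forall k, (k < n)%nat -> 0 < alphai n P O k < PI / 2).
  { intros k Hk. destruct (circle_edge n l P O Rad Hn0 Hl HP HC k Hk) as [H1 [_ [H2 _]]].
    specialize (H2 (Hcr k Hk)). lra. }
  assert (Hb : forall k, (k < n)%nat -> 0 < Rabs (b k) < PI / 2).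
  { intros k Hk. unfold b, hangle. rewrite Rabs_mult.
    replace (Rabs (epsi n P O k)) with 1.
    - specialize (Hal k Hk). rewrite Rabs_right; lra.
    - destruct (epsi_cases n P O k) as [-> | ->]; [rewrite Rabs_R1|rewrite Rabs_left]; lra. }
  assert (Hcosb : forall k, (k < n)%nat -> 0 < cos (b k)).
  { intros k Hk. specialize (Hb k Hk). destruct Hb as [_ Hb]. apply Rabs_def2 in Hb.
    apply cos_gt_0; lra. }
  assert (Hsinb : forall k, (k < n)%nat -> sin (2 * b k) <> 0).
  { intros k Hk E. destruct (circle_edge n l P O Rad Hn0 Hl HP HC k Hk) as [_ [_ [_ [_ H]]]].
    apply (Hcr k Hk). rewrite <- H. fold b. rewrite E. ring. }
  assert (Ht : forall k, (k < n)%nat -> t k <> 0).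
  { intros k Hk E. apply (Hsinb k Hk). pose proof (Hcosb k Hk).
    rewrite (proj2 (double_angle_tan (b k) ltac:(lra))). fold (t k). rewrite E. unfold Rdiv. ring. }
  assert (Ha : forall k, (k < n)%nat -> dot (a k) (a k) = R2)
    by (intros; apply (circle_sq n P O Rad); auto).
  assert (Hrot : tan_rot n a t).
  { intros k Hk. destruct (circle_rot n l P O Rad Hn0 Hl HP HC k Hk) as [E1 E2].
    pose proof (Hcosb k Hk).
    destruct (double_angle_tan (b k) ltac:(lra)) as [D1 D2].
    fold b in E1, E2. rewrite D1, D2 in E1, E2. fold (a k) in E1, E2. fold (t k) in E1, E2.
    change (psub (P (nxt n k)) O) with (a (nxt n k)) in E1, E2. rewrite E1, E2.
    split; field; apply one_plus_sq. }
  assert (Hsum : rsum n t = tanSum n P O).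
  { apply rsum_ext. intros k Hk. apply tan_hangle. }
  destruct (generic_direction n a R2 HR2 Ha) as [tau Hs].
  destruct (tangent_basis n a t R2 tau Hn Ht Ha HR2 Hrot Hs) as
    [T [lam [HT0 [HT1 [HTe [Ho [Hd [Hlam Hcount]]]]]]]].
  { rewrite Hsum; auto. }
  destruct (edges_not_parallel n a t R2 Hn HR2 Ht Ha Hrot) as [p [Hp1 [Hp2 Hpar]]].
  { rewrite Hsum; auto. }
  assert (Hedge : forall i j, psub (a i) (a j) = psub (P i) (P j)).
  { intros i j. unfold a, psub; simpl. f_equal; ring. }
  assert (HTe' : forall j m, (j < n - 3)%nat -> (m < n)%nat ->
     dot (psub (P (nxt n m)) (P m)) (psub (T j (nxt n m)) (T j m)) = 0).
  { intros. rewrite <- Hedge. auto. }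
  assert (HTi : forall c : nat -> R,
    (forall i, (i < n)%nat -> rsum (n - 3) (fun j => c j * fst (T j i)) = 0 /\
                              rsum (n - 3) (fun j => c j * snd (T j i)) = 0) ->
    forall j, (j < n - 3)%nat -> c j = 0).
  { intros c Hc j Hj.
    pose proof (Hess_comb_zero n (n - 3) (fun k => / t k) (T j) c T Hn0 Hc) as H0.
    rewrite (rsum_ext (n - 3) _ (fun i => (c i * lam i) * unitv j i)) in H0.
    - rewrite (rsum_unitv (n - 3) j (fun i => c i * lam i) Hj) in H0.
      apply Rmult_integral in H0. destruct H0; auto. exfalso; apply (Hlam j Hj); auto.
    - intros i Hi. unfold unitv. destruct (Nat.eqb_spec i j) as [->|Hne].
      + rewrite Hd by auto. ring.
      + rewrite Ho by auto. ring. }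
  rewrite !Hedge in Hpar.
  destruct (chart_exists n l P p T Hn Hl HP Hp1 Hp2 Hpar (fun j _ => HT0 j) HT1 HTe' HTi)
    as [r [phi [Hchart HJ]]].
  exists (num_neg (n - 3) lam). split.
  - exists r, phi, (fun _ => 0), (fun i j => Hess n (fun k => / t k) (T i) (T j)), lam.
    split; [auto|]. split; [|split; [|split; [|split]]]; auto.
    + assert (Hr : 0 < r) by apply Hchart.
      apply (Jet_GradHess (n - 3) r _ (area n P)); auto.
      eapply Jet_ext; [auto| |exact (area_jet n (n - 3) r (area n P) (fun k => / t k) P phi T Hn0 HJ)].
      intros x Hx. cbv beta. apply (area_expansion n P (phi x) O t); auto.
      intros k Hk. transitivity (l k * l k).
      * apply dist_eq_iff; auto. apply Hchart; auto.
      * symmetry. apply dist_eq_iff; auto. apply HP; auto.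
    + apply SymEigenvalues_diag; auto.
  - destruct (circle_winding n l P O Rad Hn0 Hl HP HC) as [w Hw].
    assert (Hwind : windingP n P O = IZR w).
    { unfold windingP. rewrite (rsum_ext n _ (fun i => 2 * hangle n P O i))
        by (intros; unfold hangle; ring).
      rewrite rsum_scal, Hw. field. lra. }
    set (s := fun k => fst (a k) + tau * snd (a k)) in *.
    set (s' := fun k => tau * fst (a k) - snd (a k)).
    destruct (polar_angle (s 0%nat) (s' 0%nat)) as [K [f [Ef1 Ef2]]]; [apply Hs; auto|].
    assert (HK : K <> 0).
    { intros E. apply (Hs 0%nat Hn0). fold (s 0%nat). rewrite Ef1, E. ring. }
    (* A lift of the polar angle, not reduced modulo [2 * PI]: it advances by [2 * b i] at each
       step, so its total increase records the winding number. *)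
    set (F := fun i => f + 2 * rsum i b).
    assert (HF : forall i, (i <= n)%nat ->
      s (i mod n)%nat = K * sin (F i) /\ s' (i mod n)%nat = K * cos (F i)).
    { induction i as [|i IH]; intros Hi.
      - rewrite Nat.mod_small by lia. unfold F; simpl.
        replace (f + 2 * 0) with f by ring. auto.
      - destruct IH as [I1 I2]; [lia|]. rewrite (Nat.mod_small i n) in I1, I2 by lia.
        destruct (circle_rot n l P O Rad Hn0 Hl HP HC i ltac:(lia)) as [E1 E2].
        fold b in E1, E2. fold (a i) in E1, E2. fold (a (nxt n i)) in E1, E2.
        replace (S i mod n)%nat with (nxt n i) by (unfold nxt; rewrite Nat.add_1_r; auto).
        replace (F (S i)) with (F i + 2 * b i) by (unfold F; simpl; ring).
        rewrite sin_plus, cos_plus. split.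
        + transitivity (cos (2 * b i) * s i + sin (2 * b i) * s' i).
          * unfold s, s'. rewrite E1, E2. ring.
          * rewrite I1, I2. ring.
        + transitivity (cos (2 * b i) * s' i - sin (2 * b i) * s i).
          * unfold s, s'. rewrite E1, E2. ring.
          * rewrite I1, I2. ring. }
    assert (Hsc := sign_count n F b w).
    assert (E1 : INR (ncount n (fun k => is_neg (- (sin (F k) * sin (F (S k)) / sin (2 * b k))))) =
       INR (ncount n (fun k => if Rlt_dec 0 (b k) then true else false)) - 2 * IZR w).
    { apply Hsc; auto.
      - intros k Hk E. destruct (HF k Hk) as [H _]. rewrite E in H.
        apply (Hs (k mod n)%nat); [apply Nat.mod_upper_bound; lia|].
        fold (s (k mod n)%nat). lra.
      - intros k Hk. unfold F; simpl. ring.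
      - unfold F; simpl. unfold b. rewrite Hw. ring. }
    assert (E2 : ncount n (fun k => if Rlt_dec 0 (b k) then true else false) = eP n P O).
    { apply ncount_ext. intros k Hk. specialize (Hal k Hk). unfold b, hangle, epsi.
      destruct (Rlt_dec 0 (cross (psub (P (nxt n k)) (P k)) (psub O (P k))));
        destruct (Rlt_dec 0 _); auto; lra. }
    rewrite E2 in E1.
    assert (E3 : ncount n (fun k => is_neg (- (s k * s (nxt n k) * (1 + t k * t k) / (2 * t k)))) =
                 ncount n (fun k => is_neg (- (sin (F k) * sin (F (S k)) / sin (2 * b k))))).
    { apply ncount_ext. intros k Hk.
      destruct (HF k ltac:(lia)) as [H1 _]. destruct (HF (S k) ltac:(lia)) as [H2 _].
      rewrite (Nat.mod_small k n) in H1 by lia.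
      replace (S k mod n)%nat with (nxt n k) in H2 by (unfold nxt; rewrite Nat.add_1_r; auto).
      pose proof (Hcosb k Hk) as Hcb. pose proof (Ht k Hk) as Htk.
      pose proof (one_plus_sq (t k)) as Hot. pose proof (Hsinb k Hk) as Hsk.
      assert (E : - (s k * s (nxt n k) * (1 + t k * t k) / (2 * t k)) =
        (K * K) * - (sin (F k) * sin (F (S k)) / sin (2 * b k))).
      { rewrite H1, H2, (proj2 (double_angle_tan (b k) ltac:(lra))). fold (t k).
        field. auto. }
      rewrite E. unfold is_neg.
      set (q := - (sin (F k) * sin (F (S k)) / sin (2 * b k))).
      assert (0 < K * K) by (apply Rsqr_pos_lt; auto).
      destruct (Rlt_dec (K * K * q) 0); destruct (Rlt_dec q 0); auto; nra. }
    change (ncount n (fun k => is_neg (- (s k * s (nxt n k) * (1 + t k * t k) / (2 * t k)))) =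
      ((if is_neg (rsum n t) then 1 else 0) + 1 + num_neg (n - 3) lam)%nat) in Hcount.
    rewrite E3 in Hcount. rewrite Hcount, !plus_INR, Hsum in E1.
    rewrite Hwind. unfold is_neg in E1.
    destruct (Rlt_dec (tanSum n P O) 0); destruct (Rlt_dec 0 (tanSum n P O)); simpl in E1; lra.
Qed.

(** * Genericity *)

Definition close (n : nat) (d : R) (l' l : nat -> R) : Prop :=
  forall i, (i < n)%nat -> Rabs (l' i - l i) < d.

(** The interior of [G]. Passing to it makes openness automatic and leaves only density to be
    proved. *)
Definition inner (n : nat) (G : (nat -> R) -> Prop) (l : nat -> R) : Prop :=
  exists d, 0 < d /\ forall l', close n d l' l -> G l'.

Lemma close_trans (n : nat) (d d' : R) (x y z : nat -> R) :
  close n d x y -> close n d' y z -> close n (d + d') x z.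
Proof.
  intros H1 H2 i Hi. specialize (H1 i Hi). specialize (H2 i Hi).
  replace (x i - z i) with ((x i - y i) + (y i - z i)) by ring.
  eapply Rle_lt_trans; [apply Rabs_triang|]. lra.
Qed.

Lemma close_le (n : nat) (d d' : R) (x y : nat -> R) : d <= d' -> close n d x y -> close n d' x y.
Proof. intros Hd H i Hi. specialize (H i Hi). lra. Qed.

Lemma close_refl (n : nat) (d : R) (x : nat -> R) : 0 < d -> close n d x x.
Proof. intros H i _. rewrite Rminus_diag, Rabs_R0. auto. Qed.

Lemma inner_self (n : nat) (G : (nat -> R) -> Prop) (l : nat -> R) : inner n G l -> G l.
Proof. intros [d [Hd H]]. apply H. apply close_refl; auto. Qed.

Lemma inner_OpenDense (n : nat) (G : (nat -> R) -> Prop) :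
  (forall l, (forall i, (i < n)%nat -> 0 < l i) -> forall eps, 0 < eps ->
     exists l', inner n G l' /\ close n eps l' l) ->
  OpenDensePos n (inner n G).
Proof.
  intros H. split; auto.
  intros l [d [Hd Hl]]. exists (d / 2). split; [lra|].
  intros l' Hl'. exists (d / 2). split; [lra|]. intros l'' Hl''. apply Hl.
  replace d with (d / 2 + d / 2) by field. apply (close_trans n _ _ l'' l' l); auto.
Qed.

Lemma positive_margin (n : nat) (l : nat -> R) : (forall i, (i < n)%nat -> 0 < l i) ->
  exists d, 0 < d /\ forall i, (i < n)%nat -> d < l i.
Proof.
  intros H. destruct (fin_eps n (fun i e => e < l i)) as [d [Hd H1]].
  - intros i Hi. exists (l i / 2). specialize (H i Hi). split; [lra|]. intros; lra.
  - exists d. split; auto. intros i Hi. apply (H1 d); auto. lra.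
Qed.

(** Density has to be tested only at points of a set already known to be dense. The margin keeps the
    intermediate lengths positive. *)
Lemma OpenDense_refine (n : nat) (V W : (nat -> R) -> Prop) :
  OpenDensePos n V ->
  (forall l, (forall i, (i < n)%nat -> 0 < l i) -> V l -> forall eps, 0 < eps ->
     exists l', inner n W l' /\ close n eps l' l) ->
  OpenDensePos n (inner n W).
Proof.
  intros [_ Hd] H. apply inner_OpenDense. intros l Hl eps He.
  destruct (positive_margin n l Hl) as [d [Hd0 Hm]].
  destruct (Hd l Hl (Rmin (eps / 2) d)) as [l1 [HV Hc]]; [apply Rmin_pos; lra|].
  pose proof (Rmin_l (eps / 2) d). pose proof (Rmin_r (eps / 2) d).
  destruct (H l1) with (eps := eps / 2) as [l2 [HW Hc2]]; auto; [|lra|].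
  - intros i Hi. specialize (Hc i Hi). specialize (Hm i Hi). apply Rabs_def2 in Hc. lra.
  - exists l2. split; auto. replace eps with (eps / 2 + eps / 2) by field.
    apply (close_trans n _ _ l2 l1 l); auto. intros i Hi. specialize (Hc i Hi). lra.
Qed.

Lemma OpenDense_and (n : nat) (V W : (nat -> R) -> Prop) :
  OpenDensePos n V -> OpenDensePos n W -> OpenDensePos n (fun l => V l /\ W l).
Proof.
  intros [Vo Vd] [Wo Wd]. split.
  - intros l [HV HW]. destruct (Vo l HV) as [d1 [Hd1 H1]]. destruct (Wo l HW) as [d2 [Hd2 H2]].
    exists (Rmin d1 d2). split; [apply Rmin_pos; auto|].
    pose proof (Rmin_l d1 d2). pose proof (Rmin_r d1 d2).
    intros l' H'. split; [apply H1|apply H2]; intros i Hi; specialize (H' i Hi); lra.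
  - intros l Hl eps He.
    destruct (positive_margin n l Hl) as [d [Hd0 Hm]].
    destruct (Vd l Hl (Rmin (eps / 2) d)) as [l1 [HV Hc]]; [apply Rmin_pos; lra|].
    pose proof (Rmin_l (eps / 2) d). pose proof (Rmin_r (eps / 2) d).
    destruct (Vo l1 HV) as [d1 [Hd1 H1]].
    destruct (Wd l1) with (eps := Rmin (eps / 2) d1) as [l2 [HW Hc2]].
    + intros i Hi. specialize (Hc i Hi). specialize (Hm i Hi). apply Rabs_def2 in Hc. lra.
    + apply Rmin_pos; lra.
    + pose proof (Rmin_l (eps / 2) d1). pose proof (Rmin_r (eps / 2) d1).
      exists l2. split.
      * split; auto. apply H1. intros i Hi. specialize (Hc2 i Hi). lra.
      * intros i Hi. specialize (Hc i Hi). specialize (Hc2 i Hi).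
        replace (l2 i - l i) with ((l2 i - l1 i) + (l1 i - l i)) by ring.
        eapply Rle_lt_trans; [apply Rabs_triang|]. lra.
Qed.

Lemma OpenDense_list (n : nat) {A : Type} (V : A -> (nat -> R) -> Prop) (L : list A) :
  (forall a, OpenDensePos n (V a)) -> OpenDensePos n (fun l => forall a, In a L -> V a l).
Proof.
  intros H. induction L as [|a L IH].
  - split.
    + intros l _. exists 1. split; [lra|]. intros l' _ a [].
    + intros l _ eps He. exists l. split; [intros a []|]. apply close_refl; auto.
  - destruct (OpenDense_and n _ _ (H a) IH) as [Ho Hd]. split.
    + intros l Hl. destruct (Ho l) as [d [Hd0 H1]].
      * split; [apply Hl; left; auto|intros b Hb; apply Hl; right; auto].
      * exists d. split; auto. intros l' Hc. destruct (H1 l' Hc) as [H2 H3].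
        intros b [<-|Hb]; auto.
    + intros l Hl eps He. destruct (Hd l Hl eps He) as [l' [[H1 H2] Hc]].
      exists l'. split; auto. intros b [<-|Hb]; auto.
Qed.

(** The signs [eps_k] depend on the polygon, not on the lengths, so genericity is imposed for each
    of the finitely many sign patterns. *)
Fixpoint boolseqs (n : nat) : list (list bool) :=
  match n with
  | O => [[]]
  | S n => map (cons true) (boolseqs n) ++ map (cons false) (boolseqs n)
  end.

Lemma boolseqs_complete (L : list bool) : In L (boolseqs (length L)).
Proof.
  induction L as [|b L IH]; simpl; auto.
  apply in_or_app. destruct b; [left|right]; apply in_map; auto.
Qed.

Definition sgn (L : list bool) (k : nat) : R := if nth k L true then 1 else -1.

Lemma sgn_abs (L : list bool) (k : nat) : Rabs (sgn L k) = 1.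
Proof. unfold sgn. destruct (nth k L true); [apply Rabs_R1|rewrite Rabs_left; lra]. Qed.

Lemma Rabs_sgn_mult (L : list bool) (k : nat) (x : R) : Rabs (sgn L k * x) = Rabs x.
Proof. rewrite Rabs_mult, sgn_abs. ring. Qed.

(** Half-open buckets of width [D / INR N]: the right end point [D] occupies bucket [N], so there
    are [N + 1] buckets and [N + 2] points are needed. *)
Lemma pigeonhole_close (N : nat) (D : R) (s : nat -> R) : (0 < N)%nat -> 0 < D ->
  (forall i, (i < N + 2)%nat -> 0 <= s i <= D) ->
  exists i j, (i < j < N + 2)%nat /\ Rabs (s i - s j) <= D / INR N.
Proof.
  intros HN HD Hs. apply NNPP. intros Hno.
  assert (Hfar : forall i j, (i < j < N + 2)%nat -> D / INR N < Rabs (s i - s j)).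
  { intros i j Hij. apply Rnot_le_lt. intros Hle. apply Hno. exists i, j. auto. }
  assert (HNR : 0 < INR N) by (apply lt_0_INR; auto).
  set (g := D / INR N). assert (Hg : 0 < g) by (apply Rdiv_lt_0_compat; auto).
  set (bucket := fun i => Z.to_nat (Int_part (s i / g))).
  assert (Hb : forall i, (i < N + 2)%nat ->
            INR (bucket i) * g <= s i < (INR (bucket i) + 1) * g /\ (bucket i < N + 1)%nat).
  { intros i Hi. specialize (Hs i Hi).
    destruct (base_Int_part (s i / g)) as [H1 H2].
    assert (Hq : 0 <= s i / g) by (apply Rle_mult_inv_pos; lra).
    assert (Hz : (0 <= Int_part (s i / g))%Z).
    { assert (-1 < IZR (Int_part (s i / g))) by lra. apply lt_IZR in H. lia. }
    assert (E : INR (bucket i) = IZR (Int_part (s i / g))).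
    { unfold bucket. rewrite INR_IZR_INZ, Z2Nat.id; auto. }
    assert (Es : s i = s i / g * g) by (field; lra).
    rewrite <- E in H1, H2.
    assert (Hlo : INR (bucket i) * g <= s i) by (rewrite Es; apply Rmult_le_compat_r; lra).
    split; [split; auto|].
    - rewrite Es at 1. apply Rmult_lt_compat_r; lra.
    - apply INR_lt. rewrite plus_INR. simpl (INR 1).
      assert (ED : D = INR N * g) by (unfold g; field; lra).
      assert (INR (bucket i) * g <= INR N * g) by lra.
      apply Rmult_le_reg_r in H; auto. lra. }
  assert (Hnd : NoDup (map bucket (seq 0 (N + 2)))).
  { apply NoDup_map_NoDup_ForallPairs; [|apply seq_NoDup].
    intros i j Hi Hj E. apply in_seq in Hi, Hj.
    destruct (Hb i ltac:(lia)) as [B1 _]. destruct (Hb j ltac:(lia)) as [B2 _].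
    rewrite E in B1.
    assert (Hlt : Rabs (s i - s j) < g) by (apply Rabs_def1; lra).
    destruct (Nat.lt_trichotomy i j) as [H|[H|H]]; auto; exfalso.
    - specialize (Hfar i j ltac:(lia)). fold g in Hfar. lra.
    - specialize (Hfar j i ltac:(lia)). fold g in Hfar. rewrite Rabs_minus_sym in Hfar. lra. }
  assert (Hincl : incl (map bucket (seq 0 (N + 2))) (seq 0 (N + 1))).
  { intros x Hx. apply in_map_iff in Hx. destruct Hx as [i [<- Hi]]. apply in_seq in Hi.
    apply in_seq. destruct (Hb i ltac:(lia)). lia. }
  pose proof (NoDup_incl_length Hnd Hincl) as Hlen.
  rewrite length_map, !length_seq in Hlen. lia.
Qed.

Lemma sin_MVT (a b : R) : exists c, sin b - sin a = cos c * (b - a) /\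
  Rmin a b <= c <= Rmax a b.
Proof.
  destruct (Rtotal_order a b) as [H|[<-|H]].
  - destruct (MVT_cor2 sin cos a b H) as [c [Hc1 Hc2]].
    + intros; apply derivable_pt_lim_sin.
    + exists c. rewrite Rmin_left, Rmax_right by lra. lra.
  - exists a. rewrite Rmin_left, Rmax_left by lra. lra.
  - destruct (MVT_cor2 sin cos b a H) as [c [Hc1 Hc2]].
    + intros; apply derivable_pt_lim_sin.
    + exists c. rewrite Rmin_right, Rmax_left by lra. lra.
Qed.

Lemma sin_lipschitz (a b : R) : Rabs (sin b - sin a) <= Rabs (b - a).
Proof.
  destruct (sin_MVT a b) as [c [-> _]]. rewrite Rabs_mult.
  assert (Rabs (cos c) <= 1) by (apply Rabs_le; apply COS_bound).
  pose proof (Rabs_pos (b - a)). nra.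
Qed.

Lemma cos_lipschitz (a b : R) : Rabs (cos b - cos a) <= Rabs (b - a).
Proof.
  rewrite !cos_sin. eapply Rle_trans; [apply sin_lipschitz|]. right. f_equal. ring.
Qed.

Lemma sin_expansive (a b kap : R) : 0 < kap -> 0 < a < PI / 2 -> 0 < b < PI / 2 ->
  kap <= cos a -> kap <= cos b -> Rabs (b - a) * kap <= Rabs (sin b - sin a).
Proof.
  intros Hk Ha Hb Hca Hcb. destruct (sin_MVT a b) as [c [-> Hc]].
  assert (Hcc : kap <= cos c).
  { unfold Rmin, Rmax in Hc. destruct (Rle_dec a b).
    - apply (Rle_trans _ (cos b)); auto. apply cos_decr_1; lra.
    - apply (Rle_trans _ (cos a)); auto. apply cos_decr_1; lra. }
  rewrite Rabs_mult, (Rabs_right (cos c)) by lra. pose proof (Rabs_pos (b - a)). nra.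
Qed.

Lemma sin_taylor (a b : R) : Rabs (sin b - sin a - cos a * (b - a)) <= (b - a) * (b - a).
Proof.
  destruct (sin_MVT a b) as [c [-> Hc]].
  replace (cos c * (b - a) - cos a * (b - a)) with ((cos c - cos a) * (b - a)) by ring.
  rewrite Rabs_mult. pose proof (cos_lipschitz a c) as H1.
  assert (H2 : Rabs (c - a) <= Rabs (b - a)).
  { unfold Rmin, Rmax in Hc. destruct (Rle_dec a b).
    - rewrite !Rabs_right; lra.
    - rewrite !Rabs_left1; lra. }
  assert (E : (b - a) * (b - a) = Rabs (b - a) * Rabs (b - a)).
  { rewrite <- Rabs_mult. symmetry. apply Rabs_right. apply Rle_ge, Rle_0_sqr. }
  rewrite E. apply Rmult_le_compat_r; [apply Rabs_pos|lra].
Qed.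

(** Only a longest edge can be a diameter. A strict maximum keeps the half angles of all other edges
    uniformly away from [PI / 2]. *)
Definition strict_max (n : nat) (M : nat) (l : nat -> R) : Prop :=
  (M < n)%nat /\ forall k, (k < n)%nat -> k <> M -> l k < l M.

Lemma max_exists (n : nat) (l : nat -> R) : (0 < n)%nat ->
  exists M, (M < n)%nat /\ forall k, (k < n)%nat -> l k <= l M.
Proof.
  induction n as [|n IH]; intros Hn; [lia|].
  destruct (Nat.eq_dec n 0) as [->|Hn0].
  - exists 0%nat. split; auto. intros k Hk. replace k with 0%nat by lia. lra.
  - destruct IH as [M [HM H]]; [lia|]. destruct (Rle_dec (l n) (l M)) as [Hle|Hgt].
    + exists M. split; [lia|]. intros k Hk. destruct (Nat.eq_dec k n) as [->|]; auto. apply H; lia.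
    + exists n. split; [lia|]. intros k Hk. destruct (Nat.eq_dec k n) as [->|]; [lra|].
      apply (Rle_trans _ (l M)); [apply H; lia|lra].
Qed.

Lemma strict_max_OpenDense (n : nat) : (0 < n)%nat ->
  OpenDensePos n (inner n (fun l => exists M, strict_max n M l)).
Proof.
  intros Hn. apply inner_OpenDense. intros l Hl eps He.
  destruct (max_exists n l Hn) as [M [HM Hmax]].
  exists (fun k => if Nat.eqb k M then l k + eps / 2 else l k). split.
  - exists (eps / 4). split; [lra|]. intros l' Hc. exists M. split; auto.
    intros k Hk Hne. pose proof (Hc k Hk) as H1. pose proof (Hc M HM) as H2.
    cbv beta in H1, H2. rewrite Nat.eqb_refl in H2.
    destruct (Nat.eqb_spec k M); [lia|].
    apply Rabs_def2 in H1, H2. specialize (Hmax k Hk). lra.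
  - intros k Hk. cbv beta. destruct (Nat.eqb k M).
    + rewrite Rabs_right; lra.
    + rewrite Rminus_diag, Rabs_R0; lra.
Qed.

Lemma rsum_sgn_close (n : nat) (L : list bool) (d : R) (l l' : nat -> R) :
  close n d l' l -> 0 < d ->
  Rabs (rsum n (fun k => sgn L k * l' k) - rsum n (fun k => sgn L k * l k)) <= INR n * d.
Proof.
  intros Hc Hd. rewrite <- rsum_minus. eapply Rle_trans; [apply rsum_Rabs|].
  rewrite <- rsum_const. apply rsum_le. intros k Hk. specialize (Hc k Hk).
  rewrite <- Rmult_minus_distr_l, Rabs_sgn_mult. lra.
Qed.

(** Excludes the limit of infinite radius, in which the polygon becomes straight and its signed
    lengths add up to zero. *)
Lemma signed_sum_OpenDense (n : nat) (L : list bool) : (0 < n)%nat ->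
  OpenDensePos n (inner n (fun l => rsum n (fun k => sgn L k * l k) <> 0)).
Proof.
  intros Hn. assert (HnR : 0 < INR n) by (apply lt_0_INR; auto).
  assert (Hopen : forall l, rsum n (fun k => sgn L k * l k) <> 0 ->
            inner n (fun l => rsum n (fun k => sgn L k * l k) <> 0) l).
  { intros l Hl. set (S0 := rsum n (fun k => sgn L k * l k)) in *.
    assert (HS : 0 < Rabs S0) by (apply Rabs_pos_lt; auto).
    exists (Rabs S0 / (2 * INR n)).
    assert (Hd : 0 < Rabs S0 / (2 * INR n)) by (apply Rdiv_lt_0_compat; lra).
    split; auto. intros l' Hc E.
    pose proof (rsum_sgn_close n L _ l l' Hc Hd) as H. fold S0 in H. rewrite E in H.
    replace (INR n * (Rabs S0 / (2 * INR n))) with (Rabs S0 / 2) in H by (field; lra).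
    rewrite Rminus_0_l, Rabs_Ropp in H. lra. }
  apply inner_OpenDense. intros l Hl eps He.
  destruct (Req_EM_T (rsum n (fun k => sgn L k * l k)) 0) as [E|E].
  - exists (fun k => l k + eps / 2 * unitv 0 k). split.
    + apply Hopen. 
      rewrite (rsum_ext n _ (fun k => sgn L k * l k + (sgn L k * (eps / 2)) * unitv 0 k))
        by (intros; ring).
      rewrite rsum_plus, E, (rsum_unitv n 0 (fun k => sgn L k * (eps / 2))) by auto.
      unfold sgn. destruct (nth 0 L true); lra.
    + intros k Hk. cbv beta. replace (l k + eps / 2 * unitv 0 k - l k) with (eps / 2 * unitv 0 k) by ring.
      unfold unitv. destruct (Nat.eqb k 0); rewrite Rabs_right; lra.
  - exists l. split; auto. apply close_refl; auto.
Qed.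

(* [s] is the inverse of the diameter, [al] the half central angles. *)
Definition cyc_data (n : nat) (L : list bool) (l : nat -> R) (s : R) (al : nat -> R) : Prop :=
  0 < s /\ (forall k, (k < n)%nat -> 0 < al k <= PI / 2 /\ sin (al k) = s * l k) /\
  exists w : Z, rsum n (fun k => sgn L k * al k) = IZR w * PI.

Definition bad_diameter (n : nat) (L : list bool) (l : nat -> R) : Prop :=
  exists s al, cyc_data n L l s al /\ exists k, (k < n)%nat /\ al k = PI / 2.

Definition bad_tangent (n : nat) (L : list bool) (l : nat -> R) : Prop :=
  exists s al, cyc_data n L l s al /\ (forall k, (k < n)%nat -> al k < PI / 2) /\
    rsum n (fun k => sgn L k * tan (al k)) = 0.

(** Bounds shared by all length vectors in a neighbourhood; [rho], taken below [1], measures the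
    lead of the longest edge [M]. *)
Record region (n M : nat) (lo hi rho : R) (l : nat -> R) : Prop := {
  reg_bounds : forall k, (k < n)%nat -> lo <= l k <= hi;
  reg_max : forall k, (k < n)%nat -> k <> M -> l k <= rho * l M }.

Lemma region_exists (n M : nat) (l : nat -> R) :
  (forall k, (k < n)%nat -> 0 < l k) -> strict_max n M l ->
  exists d lo hi rho, 0 < d /\ 0 < lo <= hi /\ 0 < rho < 1 /\
    forall l', close n d l' l -> region n M lo hi rho l'.
Proof.
  intros Hl [HM Hmax].
  destruct (positive_margin n l Hl) as [d1 [Hd1 H1]].
  destruct (fin_eps n (fun k e => k <> M -> e < l M - l k)) as [d2 [Hd2 H2]].
  { intros k Hk. destruct (Nat.eq_dec k M) as [->|Hne].
    - exists 1. split; [lra|]. intros; lia.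
    - exists ((l M - l k) / 2). specialize (Hmax k Hk Hne). split; [lra|]. intros; lra. }
  assert (HlM : 0 < l M) by auto.
  set (d := Rmin (d1 / 2) (d2 / 4)).
  assert (Hda : d <= d1 / 2) by apply Rmin_l. assert (Hdb : d <= d2 / 4) by apply Rmin_r.
  assert (Hd : 0 < d) by (apply Rmin_pos; lra).
  (* The gap between [l M] and the other lengths exceeds [d2]. Perturbations up to [d2 / 4] on both
     sides leave at least [d2 / 2], and [q * l' k <= d2 / 4], so [l' k * (1 + q) <= l' M]. *)
  set (q := d2 / (4 * l M)).
  assert (Hq : 0 < q) by (apply Rdiv_lt_0_compat; lra).
  assert (Eq : q * l M = d2 / 4) by (unfold q; field; lra).
  set (rho := / (1 + q)).
  assert (Hrho : 0 < rho) by (apply Rinv_0_lt_compat; lra).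
  assert (Erho : rho * (1 + q) = 1) by (unfold rho; field; lra).
  assert (Hdl : d1 < l M) by auto.
  exists d, (d1 / 2), (l M + d), rho. split; auto. split; [lra|]. split; [nra|].
  intros l' Hc. split.
  - intros k Hk. specialize (Hc k Hk). apply Rabs_def2 in Hc. specialize (H1 k Hk).
    destruct (Nat.eq_dec k M) as [->|Hne]; [lra|]. specialize (Hmax k Hk Hne). lra.
  - intros k Hk Hne. pose proof (Hc k Hk) as C1. pose proof (Hc M HM) as C2.
    apply Rabs_def2 in C1, C2. specialize (H2 d2 ltac:(lra) k Hk Hne).
    assert (H3 : l' k * (1 + q) <= l' M).
    { assert (l' k <= l M) by lra. assert (0 <= q) by lra.
      assert (q * l' k <= q * l M) by (apply Rmult_le_compat_l; lra). lra. }
    replace (l' k) with (rho * (l' k * (1 + q))).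
    + apply Rmult_le_compat_l; lra.
    + transitivity (l' k * (rho * (1 + q))); [ring|]. rewrite Erho. ring.
Qed.

(** The winding number is locally constant: two closing angle sums that differ by less than [PI] are
    equal. *)
Lemma IZR_small_eq (w w' : Z) (x : R) : Rabs x < PI -> IZR w * PI - IZR w' * PI = x -> x = 0.
Proof.
  intros Hx E. pose proof PI_RGT_0. apply Rabs_def2 in Hx.
  assert (E1 : IZR (w - w') * PI = x) by (rewrite minus_IZR; lra).
  assert (A1 : IZR (w - w') < 1) by nra. assert (A2 : -1 < IZR (w - w')) by nra.
  apply lt_IZR in A1, A2. assert (E0 : (w - w' = 0)%Z) by lia. rewrite E0 in E1. lra.
Qed.

Ltac rmin := eauto 3 using Rle_trans, Rmin_l, Rmin_r.

Lemma cos_lower (a rho : R) : 0 < a <= PI / 2 -> 0 < rho < 1 -> sin a <= rho ->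
  a < PI / 2 /\ 1 - rho * rho <= cos a.
Proof.
  intros Ha Hr Hs.
  assert (Hlt : a < PI / 2).
  { destruct (Req_dec a (PI / 2)) as [E|E]; [|lra]. rewrite E, sin_PI2 in Hs. lra. }
  split; auto.
  assert (Hc : 0 <= cos a) by (apply cos_ge_0; lra).
  assert (Hs0 : 0 <= sin a) by (apply sin_ge_0; lra).
  pose proof (sin2_cos2 a) as H. unfold Rsqr in H.
  pose proof (COS_bound a). nra.
Qed.

Lemma small_factor (K b : R) : 0 <= K -> 0 < b ->
  exists d0, 0 < d0 /\ forall d, 0 < d <= d0 -> K * d < b.
Proof.
  intros HK Hb. exists (b / (K + 1)).
  assert (H : 0 < b / (K + 1)) by (apply Rdiv_lt_0_compat; lra). split; auto.
  intros d Hd. assert (E : (K + 1) * (b / (K + 1)) = b) by (field; lra). nra.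
Qed.

Lemma Rabs_triang_bound (x y X Y : R) : Rabs x <= X -> Rabs y <= Y -> Rabs (x + y) <= X + Y.
Proof. intros. eapply Rle_trans; [apply Rabs_triang|lra]. Qed.

Lemma Rabs_mult_bound (x y X Y : R) : Rabs x <= X -> Rabs y <= Y -> Rabs (x * y) <= X * Y.
Proof. intros. rewrite Rabs_mult. apply Rmult_le_compat; auto; apply Rabs_pos. Qed.

Lemma unitv_01 (m k : nat) : 0 <= unitv m k <= 1.
Proof. unfold unitv. destruct (Nat.eqb k m); lra. Qed.

(** * Edges through the centre *)

Section Pair.
Variables (n M m : nat) (L : list bool) (lo hi rho : R).
Hypothesis HM : (M < n)%nat.
Hypothesis Hm : (m < n)%nat.
Hypothesis HmM : m <> M.
Hypothesis Hlo : 0 < lo <= hi.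
Hypothesis Hrho : 0 < rho < 1.

Lemma cyc_s_bound (l : nat -> R) (s : R) (al : nat -> R) :
  region n M lo hi rho l -> cyc_data n L l s al -> s * l M <= 1 /\ s <= / lo /\
  forall k, (k < n)%nat -> k <> M -> al k < PI / 2 /\ 1 - rho * rho <= cos (al k).
Proof.
  intros [Hb Hmx] [Hs [Hal _]].
  destruct (Hal M HM) as [_ EM]. pose proof (SIN_bound (al M)) as HS.
  assert (H1 : s * l M <= 1) by lra.
  pose proof (Hb M HM) as HbM.
  split; auto. split.
  - apply (Rmult_le_reg_r lo); [lra|]. rewrite Rinv_l by lra.
    assert (s * lo <= s * l M) by (apply Rmult_le_compat_l; lra). lra.
  - intros k Hk Hne. destruct (Hal k Hk) as [Hr Es]. apply cos_lower; auto.
    rewrite Es. specialize (Hmx k Hk Hne).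
    assert (s * l k <= s * (rho * l M)) by (apply Rmult_le_compat_l; lra). nra.
Qed.

Let kap := 1 - rho * rho.
(** Controls the error in [sin (al k) = s * l k]: the change of [s], at most [2 * d / (lo * lo)], is
    multiplied by a length up to [hi], and the length error [2 * d] by an [s] up to [/ lo]. *)
Let C := 2 * hi / (lo * lo) + 2 / lo.

(** When the longest edge is a diameter, [s = / l M], so lengthening another edge [m] by [tau]
    changes [s] only by order [d], and likewise every half angle but that of [m]. The common angle
    sum then pins this angle as well, although its sine must grow by about [s1 * tau]. Hence [tau]
    is of order [d]. *)
Lemma bad_diameter_pair (l1 l2 : nat -> R) (s1 s2 : R) (al1 al2 : nat -> R) (k1 k2 : nat)
  (tau d : R) :
  region n M lo hi rho l1 -> region n M lo hi rho l2 ->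
  cyc_data n L l1 s1 al1 -> cyc_data n L l2 s2 al2 ->
  (k1 < n)%nat -> (k2 < n)%nat -> al1 k1 = PI / 2 -> al2 k2 = PI / 2 ->
  0 <= tau -> 0 < d ->
  (forall k, (k < n)%nat -> Rabs (l2 k - l1 k - tau * unitv m k) <= 2 * d) ->
  INR n * (C * d / kap) + tau / lo / kap <= 3 ->
  tau <= hi * (INR n * (C * d / kap) + C * d).
Proof.
  intros R1 R2 Y1 Y2 Hk1 Hk2 E1 E2 Htau Hd Hdiff Hsmall.
  assert (Hkap : 0 < kap) by (unfold kap; nra).
  destruct (cyc_s_bound l1 s1 al1 R1 Y1) as [B1 [S1 A1]].
  destruct (cyc_s_bound l2 s2 al2 R2 Y2) as [B2 [S2 A2]].
  destruct Y1 as [P1 [Z1 [w1 W1]]]. destruct Y2 as [P2 [Z2 [w2 W2]]].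
  destruct R1 as [Bd1 _]. destruct R2 as [Bd2 _].
  assert (F1 : k1 = M).
  { destruct (Nat.eq_dec k1 M); auto. destruct (A1 k1 Hk1 n0). lra. }
  assert (F2 : k2 = M).
  { destruct (Nat.eq_dec k2 M); auto. destruct (A2 k2 Hk2 n0). lra. }
  subst k1 k2.
  assert (EM1 : s1 * l1 M = 1) by (destruct (Z1 M HM) as [_ <-]; rewrite E1; apply sin_PI2).
  assert (EM2 : s2 * l2 M = 1) by (destruct (Z2 M HM) as [_ <-]; rewrite E2; apply sin_PI2).
  assert (Hil : 0 < / lo) by (apply Rinv_0_lt_compat; lra).
  assert (Hs : Rabs (s2 - s1) <= / lo * / lo * (2 * d)).
  { replace (s2 - s1) with (s1 * s2 * (l1 M - l2 M)).
    - apply Rabs_mult_bound.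
      + rewrite Rabs_right by nra. apply Rmult_le_compat; lra.
      + specialize (Hdiff M HM). unfold unitv in Hdiff.
        destruct (Nat.eqb_spec M m); [lia|]. rewrite Rabs_minus_sym.
        replace (l2 M - l1 M) with (l2 M - l1 M - tau * 0) by ring. auto.
    - transitivity (s2 * (s1 * l1 M) - s1 * (s2 * l2 M)); [ring|]. rewrite EM1, EM2. ring. }
  assert (Hsd : forall k, (k < n)%nat ->
     Rabs (sin (al2 k) - sin (al1 k) - s1 * (tau * unitv m k)) <= C * d).
  { intros k Hk. destruct (Z1 k Hk) as [_ ->]. destruct (Z2 k Hk) as [_ ->].
    replace (s2 * l2 k - s1 * l1 k - s1 * (tau * unitv m k)) with
      ((s2 - s1) * l2 k + s1 * (l2 k - l1 k - tau * unitv m k)) by ring.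
    replace (C * d) with (/ lo * / lo * (2 * d) * hi + / lo * (2 * d)) by (unfold C; field; lra).
    apply Rabs_triang_bound; apply Rabs_mult_bound; auto.
    - specialize (Bd2 k Hk). rewrite Rabs_right; lra.
    - rewrite Rabs_right; lra. }
  assert (HC : 0 < C * d).
  { unfold C. apply Rmult_lt_0_compat; auto.
    apply Rplus_lt_0_compat; apply Rdiv_lt_0_compat; nra. }
  set (D := fun k => al2 k - al1 k).
  assert (HDk : forall k, (k < n)%nat -> Rabs (D k) <= C * d / kap + tau / lo / kap * unitv m k).
  { intros k Hk. destruct (Nat.eq_dec k M) as [->|Hne].
    - unfold D. rewrite E1, E2, Rminus_diag, Rabs_R0.
      assert (0 < C * d / kap) by (apply Rdiv_lt_0_compat; auto).
      assert (0 <= tau / lo / kap) by (repeat apply Rle_mult_inv_pos; lra).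
      pose proof (unitv_01 m M). nra.
    - destruct (A1 k Hk Hne) as [L1 K1]. destruct (A2 k Hk Hne) as [L2 K2].
      destruct (Z1 k Hk) as [[G1 _] _]. destruct (Z2 k Hk) as [[G2 _] _].
      pose proof (sin_expansive (al1 k) (al2 k) kap Hkap ltac:(lra) ltac:(lra) K1 K2) as HE.
      specialize (Hsd k Hk).
      assert (HB : Rabs (sin (al2 k) - sin (al1 k)) <= C * d + / lo * (tau * unitv m k)).
      { replace (sin (al2 k) - sin (al1 k)) with
          ((sin (al2 k) - sin (al1 k) - s1 * (tau * unitv m k)) + s1 * (tau * unitv m k)) by ring.
        apply Rabs_triang_bound; auto. pose proof (unitv_01 m k).
        rewrite Rabs_right by (apply Rle_ge; repeat apply Rmult_le_pos; lra).
        apply Rmult_le_compat_r; [apply Rmult_le_pos; lra|auto]. }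
      unfold D. apply (Rmult_le_reg_r kap); auto. eapply Rle_trans; [exact HE|].
      eapply Rle_trans; [exact HB|]. right. field. split; lra. }
  assert (Hsum0 : rsum n (fun k => sgn L k * D k) = 0).
  { apply (IZR_small_eq w2 w1).
    - apply (Rle_lt_trans _ 3); [|pose proof PI2_3_2; lra].
      eapply Rle_trans; [apply rsum_Rabs|].
      eapply Rle_trans; [|exact Hsmall].
      rewrite <- rsum_const, <- (rsum_unitv n m (fun _ => tau / lo / kap) Hm), <- rsum_plus.
      apply rsum_le. intros k Hk. rewrite Rabs_sgn_mult. auto.
    - rewrite <- W1, <- W2, <- rsum_minus. apply rsum_ext. intros; unfold D; ring. }
  assert (HDm : Rabs (D m) <= INR n * (C * d / kap)).
  { rewrite <- (Rabs_sgn_mult L m).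
    assert (E : sgn L m * D m = - rsum n (fun k => sgn L k * (D k * (1 - unitv m k)))).
    { rewrite <- (rsum_unitv n m (fun k => sgn L k * D k) Hm) at 1.
      rewrite <- Rminus_0_l, <- Hsum0, <- rsum_minus. apply rsum_ext. intros; ring. }
    rewrite E, Rabs_Ropp. eapply Rle_trans; [apply rsum_Rabs|]. rewrite <- rsum_const.
    apply rsum_le. intros k Hk. rewrite Rabs_sgn_mult. specialize (HDk k Hk).
    unfold unitv in *. destruct (Nat.eqb k m).
    - rewrite Rminus_diag, Rmult_0_r, Rabs_R0. left. apply Rdiv_lt_0_compat; auto.
    - rewrite Rminus_0_r, Rmult_1_r. lra. }
  assert (Hfin : s1 * tau <= INR n * (C * d / kap) + C * d).
  { specialize (Hsd m Hm). unfold unitv in Hsd. rewrite Nat.eqb_refl, Rmult_1_r in Hsd.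
    pose proof (sin_lipschitz (al1 m) (al2 m)) as HL. fold (D m) in HL.
    set (X := sin (al2 m) - sin (al1 m)) in *.
    pose proof (Rle_abs (- (X - s1 * tau))) as HX. rewrite Rabs_Ropp in HX.
    pose proof (Rle_abs X). lra. }
  assert (Hs1 : 1 <= s1 * hi).
  { specialize (Bd1 M HM). rewrite <- EM1. apply Rmult_le_compat_l; lra. }
  apply (Rle_trans _ (s1 * hi * tau)); [nra|].
  replace (s1 * hi * tau) with (hi * (s1 * tau)) by ring.
  apply Rmult_le_compat_l; lra.
Qed.

End Pair.

(** If no interior point of the good set lay near [l], both [l] and its shift by [T] in the length
    [m] would have bad lengths within every [dl]. The comparison of two such vectors bounds the
    fixed [T] by a constant times [dl]. *)
Lemma bad_diameter_OpenDense (n : nat) (L : list bool) : (2 <= n)%nat ->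
  OpenDensePos n (inner n (fun l => ~ bad_diameter n L l)).
Proof.
  intros Hn. apply (OpenDense_refine n _ _ (strict_max_OpenDense n ltac:(lia))).
  intros l Hl HV eps He. apply inner_self in HV. destruct HV as [M HMx].
  destruct (region_exists n M l Hl HMx) as [d [lo [hi [rho [Hd [Hlo [Hrho Hreg]]]]]]].
  destruct HMx as [HM _].
  assert (Hexm : exists m, (m < n)%nat /\ m <> M).
  { destruct (Nat.eq_dec M 0); [exists 1%nat|exists 0%nat]; lia. }
  destruct Hexm as [m [Hm HmM]].
  set (kap := 1 - rho * rho). assert (Hkap : 0 < kap) by (unfold kap; nra).
  set (C := 2 * hi / (lo * lo) + 2 / lo).
  assert (HC : 0 < C) by (unfold C; apply Rplus_lt_0_compat; apply Rdiv_lt_0_compat; nra).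
  (* The first two bounds keep the shifted lengths in the neighbourhoods. The third keeps the angle
     change due to the shift at most [1], which leaves [2] for the errors in [dl] below the total
     [3 < PI]. *)
  set (T := Rmin (eps / 2) (Rmin (d / 4) (kap * lo))).
  assert (HT : 0 < T) by (repeat apply Rmin_pos; try lra; apply Rmult_lt_0_compat; lra).
  assert (T1 : T <= eps / 2) by rmin.
  assert (T2 : T <= d / 4) by rmin.
  assert (T3 : T <= kap * lo) by rmin.
  assert (HnR : 0 <= INR n) by apply pos_INR.
  assert (HCk : 0 < C / kap) by (apply Rdiv_lt_0_compat; auto).
  destruct (small_factor (INR n * (C / kap)) 2) as [e1 [He1 Q1]];
    [apply Rmult_le_pos; lra|lra|].
  destruct (small_factor (hi * (INR n * (C / kap) + C)) T) as [e2 [He2 Q2]].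
  { apply Rmult_le_pos; [lra|]. apply Rplus_le_le_0_compat; [apply Rmult_le_pos|]; lra. }
  { auto. }
  set (dl := Rmin (d / 2) (Rmin e1 e2)).
  assert (Hdl : 0 < dl) by (repeat apply Rmin_pos; lra).
  assert (D1 : dl <= d / 2) by rmin.
  assert (D2 : dl <= e1) by rmin.
  assert (D3 : dl <= e2) by rmin.
  specialize (Q1 dl ltac:(lra)). specialize (Q2 dl ltac:(lra)).
  set (lt := fun k => l k + T * unitv m k).
  assert (Hclt : forall e, T < e -> close n e lt l).
  { intros e HTe k Hk. unfold lt. replace (l k + T * unitv m k - l k) with (T * unitv m k) by ring.
    pose proof (unitv_01 m k). rewrite Rabs_right by (apply Rle_ge, Rmult_le_pos; lra).
    assert (T * unitv m k <= T * 1) by (apply Rmult_le_compat_l; lra). lra. }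
  apply NNPP. intros Hno.
  assert (Hbad : forall l', close n eps l' l -> exists l'', close n dl l'' l' /\ bad_diameter n L l'').
  { intros l' Hl'. apply NNPP. intros Hn2. apply Hno. exists l'. split; auto.
    exists dl. split; auto. intros l'' Hc Hb. apply Hn2. exists l''. auto. }
  destruct (Hbad l) as [l1 [C1 [s1 [al1 [Y1 [k1 [Hk1 E1]]]]]]]; [apply close_refl; auto|].
  destruct (Hbad lt) as [l2 [C2 [s2 [al2 [Y2 [k2 [Hk2 E2]]]]]]]; [apply Hclt; lra|].
  assert (R1 : region n M lo hi rho l1) by (apply Hreg; apply (close_le n dl d); [lra|auto]).
  assert (R2 : region n M lo hi rho l2).
  { apply Hreg. pose proof (close_trans n _ _ _ _ _ C2 (Hclt (d - dl) ltac:(lra))) as H.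
    replace (dl + (d - dl)) with d in H by ring. auto. }
  pose proof (bad_diameter_pair n M m L lo hi rho HM Hm HmM Hlo Hrho l1 l2 s1 s2 al1 al2 k1 k2
    T dl R1 R2 Y1 Y2 Hk1 Hk2 E1 E2 ltac:(lra) Hdl) as HP.
  fold kap C in HP.
  assert (Hfin : T <= hi * (INR n * (C * dl / kap) + C * dl)).
  { apply HP.
    - intros k Hk. specialize (C1 k Hk). specialize (C2 k Hk). unfold lt in C2.
      apply Rabs_le. apply Rabs_def2 in C1, C2. lra.
    - replace (INR n * (C * dl / kap)) with (INR n * (C / kap) * dl) by (field; lra).
      assert (T / lo / kap <= 1); [|lra].
      apply (Rmult_le_reg_r (kap * lo)); [apply Rmult_lt_0_compat; lra|].
      replace (T / lo / kap * (kap * lo)) with T by (field; lra). lra. }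
  replace (hi * (INR n * (C * dl / kap) + C * dl)) with
    (hi * (INR n * (C / kap) + C) * dl) in Hfin by (field; lra).
  lra.
Qed.

(** * Vanishing tangent sums *)

Section TangentPair.
Variables (n M m : nat) (L : list bool) (lo hi rho S1 : R).
Hypothesis HM : (M < n)%nat.
Hypothesis Hm : (m < n)%nat.
Hypothesis Hlo : 0 < lo <= hi.
Hypothesis Hrho : 0 < rho < 1.
Hypothesis HS1 : 0 < S1.

Definition tangent_data (l : nat -> R) (s : R) (al : nat -> R) : Prop :=
  cyc_data n L l s al /\ (forall k, (k < n)%nat -> al k < PI / 2) /\
  rsum n (fun k => sgn L k * tan (al k)) = 0.

(** A vanishing tangent sum bounds the tangent at the longest edge by those at the others, so its
    cosine stays away from zero too. It also says [sum sgn_k l_k / cos_k = 0], which makes the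
    signed sum of lengths of order [s * s]; a lower bound on that sum is therefore one on [s]. *)
Lemma tangent_bounds : exists kap sg0, 0 < kap /\ 0 < sg0 /\
  forall l s al, region n M lo hi rho l -> tangent_data l s al ->
    S1 <= Rabs (rsum n (fun k => sgn L k * l k)) ->
    (forall k, (k < n)%nat -> kap <= cos (al k)) /\ sg0 <= s.
Proof.
  assert (HnR : 0 < INR n) by (apply lt_0_INR; apply (Nat.le_lt_trans _ M); auto using Nat.le_0_l).
  set (k1 := 1 - rho * rho). assert (Hk1 : 0 < k1) by (unfold k1; nra).
  set (B := INR n * / k1).
  assert (Hik1 : 0 < / k1) by (apply Rinv_0_lt_compat; auto).
  assert (HB : 0 < B) by (apply Rmult_lt_0_compat; auto).
  set (kap := Rmin k1 (/ (1 + B * B))).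
  assert (Hkap : 0 < kap) by (apply Rmin_pos; [auto|apply Rinv_0_lt_compat; nra]).
  set (G := INR n * (hi * hi * hi) / kap).
  assert (HG : 0 < G).
  { unfold G. apply Rdiv_lt_0_compat; auto. repeat apply Rmult_lt_0_compat; lra. }
  exists kap, (Rmin 1 (S1 / G)). split; auto. split.
  { apply Rmin_pos; [lra|apply Rdiv_lt_0_compat; auto]. }
  intros l s al HR [HY [Hal Htan]] HS.
  destruct (cyc_s_bound n M L lo hi rho HM Hlo Hrho l s al HR HY) as [_ [_ Hcos]].
  destruct HY as [Hs [Hsin _]]. destruct HR as [Hb _].
  assert (Hcp : forall k, (k < n)%nat -> 0 < cos (al k)).
  { intros k Hk. destruct (Hsin k Hk) as [[H1 H2] _]. specialize (Hal k Hk). apply cos_gt_0; lra. }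
  assert (Htp : forall k, (k < n)%nat -> 0 < tan (al k)).
  { intros k Hk. destruct (Hsin k Hk) as [_ E]. specialize (Hb k Hk).
    unfold tan. apply Rdiv_lt_0_compat; auto. rewrite E. apply Rmult_lt_0_compat; lra. }
  assert (HtM : tan (al M) <= B).
  { rewrite <- (Rabs_right (tan (al M))) by (specialize (Htp M HM); lra).
    rewrite <- (Rabs_sgn_mult L M).
    assert (E : sgn L M * tan (al M) =
                - rsum n (fun k => sgn L k * (tan (al k) * (1 - unitv M k)))).
    { rewrite <- (rsum_unitv n M (fun k => sgn L k * tan (al k)) HM) at 1.
      rewrite <- Rminus_0_l, <- Htan, <- rsum_minus. apply rsum_ext. intros; ring. }
    rewrite E, Rabs_Ropp. eapply Rle_trans; [apply rsum_Rabs|]. unfold B. rewrite <- rsum_const.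
    apply rsum_le. intros k Hk. rewrite Rabs_sgn_mult. unfold unitv.
    destruct (Nat.eqb_spec k M) as [->|Hne].
    - rewrite Rminus_diag, Rmult_0_r, Rabs_R0. lra.
    - rewrite Rminus_0_r, Rmult_1_r. specialize (Htp k Hk). rewrite Rabs_right by lra.
      destruct (Hcos k Hk Hne) as [_ Hc]. fold k1 in Hc.
      pose proof (SIN_bound (al k)) as HSB. unfold tan, Rdiv.
      destruct (Hsin k Hk) as [_ E1]. specialize (Hb k Hk).
      assert (0 <= sin (al k)) by (rewrite E1; apply Rmult_le_pos; lra).
      rewrite <- (Rmult_1_l (/ k1)). apply Rmult_le_compat; try lra.
      + left. apply Rinv_0_lt_compat. auto.
      + apply Rinv_le_contravar; auto. }
  assert (HcM : / (1 + B * B) <= cos (al M)).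
  { specialize (Hcp M HM). specialize (Htp M HM). pose proof (COS_bound (al M)).
    pose proof (sin2_cos2 (al M)) as H1. unfold Rsqr in H1.
    set (T := tan (al M)) in *. set (cc := cos (al M)) in *.
    assert (E : cc * cc * (1 + T * T) = 1).
    { transitivity (sin (al M) * sin (al M) + cc * cc); [|auto].
      unfold T, tan. fold cc. field. lra. }
    apply (Rmult_le_reg_r (1 + B * B)); [nra|]. rewrite Rinv_l by nra.
    apply (Rle_trans _ (cc * cc * (1 + T * T))); [lra|]. assert (T * T <= B * B) by nra.
    apply (Rle_trans _ (cc * cc * (1 + B * B))); [nra|].
    apply Rmult_le_compat_r; nra. }
  assert (Hck : forall k, (k < n)%nat -> kap <= cos (al k)).
  { intros k Hk. destruct (Nat.eq_dec k M) as [->|Hne].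
    - eapply Rle_trans; [apply Rmin_r|auto].
    - eapply Rle_trans; [apply Rmin_l|]. apply Hcos; auto. }
  split; auto.
  assert (E : rsum n (fun k => sgn L k * l k) =
              - rsum n (fun k => sgn L k * (l k * ((1 - cos (al k)) / cos (al k))))).
  { assert (E0 : rsum n (fun k => sgn L k * (l k / cos (al k))) = 0).
    { apply (Rmult_eq_reg_l s); [|lra]. rewrite Rmult_0_r, <- Htan, <- rsum_scal.
      apply rsum_ext. intros k Hk. destruct (Hsin k Hk) as [_ E1]. unfold tan. rewrite E1.
      field. specialize (Hcp k Hk). lra. }
    rewrite <- Rminus_0_l, <- E0, <- rsum_minus. apply rsum_ext. intros k Hk. field.
    specialize (Hcp k Hk). lra. }
  assert (Hle : S1 <= G * (s * s)).
  { eapply Rle_trans; [exact HS|]. rewrite E, Rabs_Ropp. eapply Rle_trans; [apply rsum_Rabs|].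
    replace (G * (s * s)) with (INR n * (hi * hi * hi / kap * (s * s))) by (unfold G; field; lra).
    rewrite <- rsum_const. apply rsum_le. intros k Hk. rewrite Rabs_sgn_mult.
    specialize (Hcp k Hk). specialize (Hck k Hk). specialize (Hb k Hk).
    pose proof (COS_bound (al k)) as HCB. destruct (Hsin k Hk) as [_ E1].
    pose proof (sin2_cos2 (al k)) as H1. unfold Rsqr in H1.
    set (cc := cos (al k)) in *.
    assert (H2 : 0 <= (1 - cc) / cc) by (apply Rle_mult_inv_pos; lra).
    rewrite Rabs_right by (apply Rle_ge, Rmult_le_pos; lra).
    assert (H3 : 1 - cc <= (s * hi) * (s * hi)).
    { assert (s * l k <= s * hi) by (apply Rmult_le_compat_l; lra).
      assert (0 <= s * l k) by (apply Rmult_le_pos; lra). rewrite E1 in H1. nra. }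
    assert (H4 : (1 - cc) / cc <= (s * hi) * (s * hi) * / kap).
    { apply Rmult_le_compat; try lra.
      - left; apply Rinv_0_lt_compat; auto.
      - apply Rinv_le_contravar; auto. }
    apply (Rle_trans _ (hi * ((s * hi) * (s * hi) * / kap))).
    - apply Rmult_le_compat; lra.
    - right. field. lra. }
  (* For [s <= 1] the bound [S1 <= G * (s * s)] weakens to [S1 <= G * s], whence the constant
     [Rmin 1 (S1 / G)]. *)
  destruct (Rle_dec 1 s) as [H1|H1]; [eapply Rle_trans; [apply Rmin_l|auto]|].
  eapply Rle_trans; [apply Rmin_r|].
  apply (Rmult_le_reg_l G); auto. replace (G * (S1 / G)) with S1 by (field; lra).
  eapply Rle_trans; [exact Hle|]. apply Rmult_le_compat_l; nra.
Qed.

(** The envelope argument. The angle sum has derivative [sum sgn_k l_k / cos_k] in [s], and the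
    tangent condition makes it zero at the first polygon. Since both angle sums agree, the first
    order effect of the lengths, at least [tau] up to errors of order [d], is balanced by second
    order terms alone. These have size [E * E], where [E] bounds every change of angle. *)
Lemma bad_tangent_pair (kap sg0 : R) (l1 l2 : nat -> R) (s1 s2 : R) (al1 al2 : nat -> R)
  (tau d : R) : 0 < kap -> 0 < sg0 ->
  region n M lo hi rho l1 -> region n M lo hi rho l2 ->
  tangent_data l1 s1 al1 -> tangent_data l2 s2 al2 ->
  (forall k, (k < n)%nat -> kap <= cos (al1 k)) -> (forall k, (k < n)%nat -> kap <= cos (al2 k)) ->
  sg0 <= s2 -> 0 <= tau -> 0 < d ->
  (forall k, (k < n)%nat -> Rabs (l2 k - l1 k - tau * unitv m k) <= 2 * d) ->
  let E := (Rabs (s2 - s1) * hi + / lo * (tau + 2 * d)) / kap in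
  INR n * E <= 3 ->
  sg0 * (tau - INR n * (2 * d / kap)) <= INR n * (E * E / kap).
Proof.
  intros Hkap Hsg0 R1 R2 [Y1 [Lt1 Tn1]] [Y2 [Lt2 Tn2]] K1 K2 Hs2 Htau Hd Hdiff E Hsmall.
  destruct (cyc_s_bound n M L lo hi rho HM Hlo Hrho l1 s1 al1 R1 Y1) as [_ [S1b _]].
  destruct Y1 as [P1 [Z1 [w1 W1]]]. destruct Y2 as [P2 [Z2 [w2 W2]]].
  destruct R1 as [Bd1 _]. destruct R2 as [Bd2 _].
  set (D := fun k => al2 k - al1 k).
  assert (HD : forall k, (k < n)%nat -> Rabs (D k) <= E).
  { intros k Hk. destruct (Z1 k Hk) as [[G1 _] E1]. destruct (Z2 k Hk) as [[G2 _] E2].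
    specialize (Lt1 k Hk). specialize (Lt2 k Hk). specialize (Hdiff k Hk).
    pose proof (sin_expansive (al1 k) (al2 k) kap Hkap ltac:(lra) ltac:(lra) (K1 k Hk) (K2 k Hk)) as HE.
    unfold E, D. apply (Rmult_le_reg_r kap); auto. eapply Rle_trans; [exact HE|].
    unfold Rdiv. rewrite (Rmult_assoc _ (/ kap) kap), Rinv_l, Rmult_1_r by lra.
    rewrite E1, E2. replace (s2 * l2 k - s1 * l1 k) with ((s2 - s1) * l2 k + s1 * (l2 k - l1 k)) by ring.
    apply Rabs_triang_bound; apply Rabs_mult_bound.
    - lra.
    - specialize (Bd2 k Hk). rewrite Rabs_right; lra.
    - rewrite Rabs_right; lra.
    - replace (l2 k - l1 k) with (tau * unitv m k + (l2 k - l1 k - tau * unitv m k)) by ring.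
      apply Rabs_triang_bound; auto. pose proof (unitv_01 m k).
      rewrite Rabs_right by (apply Rle_ge, Rmult_le_pos; lra).
      assert (tau * unitv m k <= tau * 1) by (apply Rmult_le_compat_l; lra). lra. }
  assert (Hsum0 : rsum n (fun k => sgn L k * D k) = 0).
  { apply (IZR_small_eq w2 w1).
    - apply (Rle_lt_trans _ 3); [|pose proof PI2_3_2; lra].
      eapply Rle_trans; [apply rsum_Rabs|]. eapply Rle_trans; [|exact Hsmall].
      rewrite <- rsum_const. apply rsum_le. intros k Hk. rewrite Rabs_sgn_mult. auto.
    - rewrite <- W1, <- W2, <- rsum_minus. apply rsum_ext. intros; unfold D; ring. }
  set (c := fun k => cos (al1 k)).
  assert (Hc : forall k, (k < n)%nat -> 0 < c k) by (intros k Hk; specialize (K1 k Hk); unfold c; lra).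
  assert (El1 : rsum n (fun k => sgn L k * (l1 k / c k)) = 0).
  { apply (Rmult_eq_reg_l s1); [|lra]. rewrite Rmult_0_r, <- Tn1, <- rsum_scal.
    apply rsum_ext. intros k Hk. destruct (Z1 k Hk) as [_ E1]. unfold tan. rewrite E1.
    fold (c k). field. specialize (Hc k Hk). lra. }
  set (X := rsum n (fun k => sgn L k * ((l2 k - l1 k) / c k))).
  assert (HX : s2 * X = rsum n (fun k => sgn L k * ((sin (al2 k) - sin (al1 k) - c k * D k) / c k))).
  (* Both added sums vanish, by the tangent condition of the first polygon and by the equality of
     the angle sums. They remove the first order in [s2 - s1] and in the angles, leaving the Taylor
     remainders of the sine. *)
  { transitivity (s2 * X + (s2 - s1) * rsum n (fun k => sgn L k * (l1 k / c k)) -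
                  rsum n (fun k => sgn L k * D k)).
    - rewrite El1, Hsum0. ring.
    - unfold X. rewrite <- !rsum_scal, <- rsum_plus, <- rsum_minus. apply rsum_ext. intros k Hk.
      destruct (Z1 k Hk) as [_ ->]. destruct (Z2 k Hk) as [_ ->]. field. specialize (Hc k Hk). lra. }
  assert (Hic : forall k, (k < n)%nat -> 0 < / c k <= / kap).
  { intros k Hk. split; [apply Rinv_0_lt_compat; auto|]. apply Rinv_le_contravar; auto. apply K1; auto. }
  assert (HXu : Rabs (s2 * X) <= INR n * (E * E / kap)).
  { rewrite HX. eapply Rle_trans; [apply rsum_Rabs|]. rewrite <- rsum_const.
    apply rsum_le. intros k Hk. rewrite Rabs_sgn_mult. unfold Rdiv. specialize (HD k Hk).
    apply Rabs_mult_bound.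
    - eapply Rle_trans; [apply sin_taylor|]. fold (D k).
      rewrite <- (Rabs_right (D k * D k)) by (apply Rle_ge, Rle_0_sqr).
      apply Rabs_mult_bound; auto.
    - destruct (Hic k Hk). rewrite Rabs_right; lra. }
  assert (HXl : tau - INR n * (2 * d / kap) <= Rabs X).
  { assert (EX : X = sgn L m * (tau / c m) +
       rsum n (fun k => sgn L k * ((l2 k - l1 k - tau * unitv m k) / c k))).
    { rewrite <- (rsum_unitv n m (fun k => sgn L k * (tau / c k)) Hm), <- rsum_plus.
      apply rsum_ext. intros k Hk. field. specialize (Hc k Hk). lra. }
    assert (Hr : Rabs (rsum n (fun k => sgn L k * ((l2 k - l1 k - tau * unitv m k) / c k)))
                 <= INR n * (2 * d / kap)).
    { eapply Rle_trans; [apply rsum_Rabs|]. rewrite <- rsum_const. apply rsum_le. intros k Hk.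
      rewrite Rabs_sgn_mult. apply Rabs_mult_bound; auto. destruct (Hic k Hk). rewrite Rabs_right; lra. }
    assert (Hm1 : tau <= Rabs (sgn L m * (tau / c m))).
    { rewrite Rabs_sgn_mult. pose proof (COS_bound (al1 m)) as HB. fold (c m) in HB.
      specialize (Hc m Hm). eapply Rle_trans; [|apply Rle_abs].
      apply (Rmult_le_reg_r (c m)); auto. replace (tau / c m * c m) with tau by (field; lra). nra. }
    set (r := rsum n (fun k => sgn L k * ((l2 k - l1 k - tau * unitv m k) / c k))) in *.
    assert (Rabs (sgn L m * (tau / c m)) <= Rabs X + Rabs r).
    { replace (sgn L m * (tau / c m)) with (X + - r) by (rewrite EX; ring).
      apply Rabs_triang_bound; [lra|rewrite Rabs_Ropp; lra]. }
    lra. }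
  rewrite Rabs_mult, (Rabs_right s2) in HXu by lra.
  destruct (Rle_dec 0 (tau - INR n * (2 * d / kap))) as [H0|H0].
  - eapply Rle_trans; [|exact HXu]. apply Rmult_le_compat; lra.
  - assert (0 <= s2 * Rabs X) by (apply Rmult_le_pos; [lra|apply Rabs_pos]).
    assert (sg0 * (tau - INR n * (2 * d / kap)) <= 0) by nra. lra.
Qed.

End TangentPair.

(** Otherwise [N + 2] length vectors, spaced by [g = T / N] in one coordinate, all have bad vectors
    within [dl]. Two of their inverse diameters, confined to an interval of length [D], differ by at
    most [D / N]. The envelope bound then makes a spacing of order [/ N] at most of order
    [/ (N * N)], up to terms that can be absorbed. *)
Lemma bad_tangent_OpenDense (n : nat) (L : list bool) : (2 <= n)%nat ->
  OpenDensePos n (inner n (fun l => ~ bad_tangent n L l)).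
Proof.
  intros Hn. apply (OpenDense_refine n _ _ (OpenDense_and n _ _
    (strict_max_OpenDense n ltac:(lia)) (signed_sum_OpenDense n L ltac:(lia)))).
  intros l Hl [HV HW] eps He. apply inner_self in HV, HW. destruct HV as [M HMx].
  destruct (region_exists n M l Hl HMx) as [d0 [lo [hi [rho [Hd0 [Hlo [Hrho Hreg]]]]]]].
  destruct HMx as [HM _].
  assert (HnR : 0 < INR n) by (apply lt_0_INR; lia).
  set (S0 := Rabs (rsum n (fun k => sgn L k * l k))).
  assert (HS0 : 0 < S0) by (apply Rabs_pos_lt; auto).
  destruct (tangent_bounds n M L lo hi rho (S0 / 2) HM Hlo Hrho ltac:(lra))
    as [kap [sg0 [Hkap [Hsg0 Hbd]]]].
  set (d := Rmin d0 (S0 / (2 * INR n))).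
  assert (Hd : 0 < d) by (apply Rmin_pos; [auto|apply Rdiv_lt_0_compat; lra]).
  assert (Hdd0 : d <= d0) by rmin.
  assert (HdS : INR n * d <= S0 / 2).
  { apply (Rle_trans _ (INR n * (S0 / (2 * INR n)))).
    - apply Rmult_le_compat_l; [lra|apply Rmin_r].
    - right. field. lra. }
  assert (HSl : forall l', close n d l' l -> S0 / 2 <= Rabs (rsum n (fun k => sgn L k * l' k))).
  { intros l' Hc. pose proof (rsum_sgn_close n L d l l' Hc Hd) as H.
    set (x := rsum n (fun k => sgn L k * l' k)) in *. set (y := rsum n (fun k => sgn L k * l k)) in *.
    assert (Rabs y <= Rabs x + Rabs (x - y)).
    { replace y with (x + - (x - y)) at 1 by ring.
      apply Rabs_triang_bound; [lra|rewrite Rabs_Ropp; lra]. }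
    fold S0 in H0. lra. }
  set (K1 := (hi + 2 * / lo) / kap).
  assert (Hil : 0 < / lo) by (apply Rinv_0_lt_compat; lra).
  assert (HK1 : 0 < K1) by (apply Rdiv_lt_0_compat; lra).
  set (K2 := INR n * (K1 * K1 / kap) / sg0).
  assert (HK2 : 0 < K2).
  { apply Rdiv_lt_0_compat; auto. apply Rmult_lt_0_compat; auto. apply Rdiv_lt_0_compat; nra. }
  set (K3 := INR n * (2 / kap)).
  assert (HK3 : 0 < K3) by (apply Rmult_lt_0_compat; auto; apply Rdiv_lt_0_compat; lra).
  assert (HnK : 0 < INR n * K1) by (apply Rmult_lt_0_compat; auto).
  (* The choices are made in this order: [T] gives [3 * K2 * (tau * tau) <= tau / 4] for
     [tau <= 2 * T]; [N] makes the term in the change [u] of [s] at most [g / 4]; [dl] does the same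
     for the rest. As [g <= tau], the three together stay below [tau]. The conditions with
     [INR n * K1] make each of the three contributions to the angle change at most [1]. *)
  destruct (small_factor (24 * K2) 1) as [e1 [He1 Q1]]; [lra|lra|].
  destruct (small_factor (2 * (INR n * K1)) 1) as [e2 [He2 Q2]]; [lra|lra|].
  set (T := Rmin (Rmin (eps / 4) (d / 8)) (Rmin e1 e2)).
  assert (HT : 0 < T) by (repeat apply Rmin_pos; lra).
  assert (T1 : T <= eps / 4) by rmin.
  assert (T2 : T <= d / 8) by rmin.
  assert (T3 : T <= e1) by rmin.
  assert (T4 : T <= e2) by rmin.
  specialize (Q1 T ltac:(lra)). specialize (Q2 T ltac:(lra)).
  set (D := / lo).
  assert (HNex : exists N, (0 < N)%nat /\ 12 * K2 * (D * D) <= T * INR N /\ INR n * K1 * D <= INR N).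
  { destruct (INR_unbounded (12 * K2 * (D * D) / T)) as [N1 HN1].
    destruct (INR_unbounded (INR n * K1 * D)) as [N2 HN2].
    exists (N1 + N2 + 1)%nat. split; [lia|]. rewrite !plus_INR. simpl (INR 1).
    pose proof (pos_INR N1). pose proof (pos_INR N2). split; [|lra].
    replace (12 * K2 * (D * D)) with (T * (12 * K2 * (D * D) / T)) by (field; lra).
    apply Rmult_le_compat_l; lra. }
  destruct HNex as [N [HN [HN1 HN2]]].
  assert (HNR : 1 <= INR N) by (apply (le_INR 1); lia).
  set (g := T / INR N). assert (Hg : 0 < g) by (apply Rdiv_lt_0_compat; lra).
  assert (EgN : g * INR N = T) by (unfold g; field; lra).
  destruct (small_factor (3 * K2 + K3) (g / 4)) as [e3 [He3 Q3]]; [lra|lra|].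
  destruct (small_factor (INR n * K1) 1) as [e4 [He4 Q4]]; [lra|lra|].
  set (dl := Rmin (Rmin 1 (d / 2)) (Rmin e3 e4)).
  assert (Hdl : 0 < dl) by (repeat apply Rmin_pos; lra).
  assert (D1 : dl <= 1) by rmin.
  assert (D2 : dl <= d / 2) by rmin.
  assert (D3 : dl <= e3) by rmin.
  assert (D4 : dl <= e4) by rmin.
  specialize (Q3 dl ltac:(lra)). specialize (Q4 dl ltac:(lra)).
  set (m := 0%nat). assert (Hm : (m < n)%nat) by (unfold m; lia).
  set (lt := fun (i : nat) k => l k + INR i * g * unitv m k).
  assert (Hig : forall i, (i < N + 2)%nat -> 0 <= INR i * g <= 2 * T).
  { intros i Hi. split; [apply Rmult_le_pos; [apply pos_INR|lra]|].
    rewrite <- EgN. replace (2 * (g * INR N)) with (2 * INR N * g) by ring.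
    apply Rmult_le_compat_r; [lra|]. apply (Rle_trans _ (INR (N + 1))); [apply le_INR; lia|].
    rewrite plus_INR. simpl (INR 1). lra. }
  assert (Hclt : forall i e, (i < N + 2)%nat -> 2 * T < e -> close n e (lt i) l).
  { intros i e Hi HTe k Hk. unfold lt. specialize (Hig i Hi).
    replace (l k + INR i * g * unitv m k - l k) with (INR i * g * unitv m k) by ring.
    pose proof (unitv_01 m k). rewrite Rabs_right by (apply Rle_ge, Rmult_le_pos; lra).
    assert (INR i * g * unitv m k <= INR i * g * 1) by (apply Rmult_le_compat_l; lra). lra. }
  apply NNPP. intros Hno.
  destruct (fin_choice (zerov, (0, zerov)) (N + 2) (fun i q => let '(l', (s, al)) := q in
     close n dl l' (lt i) /\ tangent_data n L l' s al)) as [q Hq].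
  { intros i Hi. apply NNPP. intros Hn2. apply Hno. exists (lt i). split.
    - exists dl. split; auto. intros l' Hc [s [al Hb]]. apply Hn2. exists (l', (s, al)). split; auto.
    - apply Hclt; auto. lra. }
  set (ll := fun i => fst (q i)). set (ss := fun i => fst (snd (q i))). set (aa := fun i => snd (snd (q i))).
  assert (HQ : forall i, (i < N + 2)%nat -> close n dl (ll i) (lt i) /\ tangent_data n L (ll i) (ss i) (aa i)).
  { intros i Hi. specialize (Hq i Hi). unfold ll, ss, aa. destruct (q i) as [x [y z]]. exact Hq. }
  assert (Hcl : forall i, (i < N + 2)%nat -> close n d (ll i) l).
  { intros i Hi. destruct (HQ i Hi) as [Hc _].
    pose proof (close_trans n _ _ _ _ _ Hc (Hclt i (d - dl) Hi ltac:(lra))) as H.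
    replace (dl + (d - dl)) with d in H by ring. auto. }
  assert (Hrg : forall i, (i < N + 2)%nat -> region n M lo hi rho (ll i)).
  { intros i Hi. apply Hreg. apply (close_le n d d0); auto. }
  destruct (pigeonhole_close N D ss HN) as [i [j [Hij Hss]]].
  { unfold D; auto. }
  { intros i Hi. destruct (HQ i Hi) as [_ [HY _]].
    destruct (cyc_s_bound n M L lo hi rho HM Hlo Hrho _ _ _ (Hrg i Hi) HY) as [_ [Hb _]].
    destruct HY as [Hs _]. unfold D. lra. }
  assert (Hi : (i < N + 2)%nat) by lia. assert (Hj : (j < N + 2)%nat) by lia.
  destruct (HQ i Hi) as [Ci Ti]. destruct (HQ j Hj) as [Cj Tj].
  destruct (Hbd _ _ _ (Hrg i Hi) Ti (HSl _ (Hcl i Hi))) as [Bi _].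
  destruct (Hbd _ _ _ (Hrg j Hj) Tj (HSl _ (Hcl j Hj))) as [Bj Sj].
  set (tau := (INR j - INR i) * g).
  assert (Htau1 : g <= tau).
  { unfold tau. rewrite <- minus_INR by lia. assert (1 <= INR (j - i)) by (apply (le_INR 1); lia).
    nra. }
  assert (Htau2 : tau <= 2 * T) by (unfold tau; pose proof (Hig i Hi); pose proof (Hig j Hj); lra).
  pose proof (bad_tangent_pair n M m L lo hi rho HM Hm Hlo Hrho kap sg0 (ll i) (ll j) (ss i) (ss j)
     (aa i) (aa j) tau dl Hkap Hsg0 (Hrg i Hi) (Hrg j Hj) Ti Tj Bi Bj Sj ltac:(lra) Hdl) as HP.
  cbv zeta in HP.
  set (u := Rabs (ss j - ss i)) in *.
  assert (Hu : u <= D / INR N) by (unfold u; rewrite Rabs_minus_sym; auto).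
  assert (Hu0 : 0 <= u) by apply Rabs_pos.
  set (E := (u * hi + / lo * (tau + 2 * dl)) / kap) in *.
  set (z := u + tau + dl).
  assert (HE : 0 <= E <= K1 * z).
  { split.
    - apply Rle_mult_inv_pos; auto. apply Rplus_le_le_0_compat; apply Rmult_le_pos; lra.
    - unfold E, K1, z. replace ((hi + 2 * / lo) / kap * (u + tau + dl)) with
        (((hi + 2 * / lo) * (u + tau + dl)) / kap) by (field; lra).
      apply Rmult_le_compat_r; [left; apply Rinv_0_lt_compat; auto|].
      assert (0 <= hi * (tau + dl)) by (apply Rmult_le_pos; lra).
      assert (0 <= / lo * (2 * u + tau)) by (apply Rmult_le_pos; lra). lra. }
  assert (HuN : INR n * K1 * u <= 1).
  { apply (Rle_trans _ (INR n * K1 * (D / INR N))); [apply Rmult_le_compat_l; lra|].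
    apply (Rmult_le_reg_r (INR N)); [lra|].
    replace (INR n * K1 * (D / INR N) * INR N) with (INR n * K1 * D) by (field; lra). lra. }
  assert (HtN : INR n * K1 * tau <= 1).
  { apply (Rle_trans _ (INR n * K1 * (2 * T))); [apply Rmult_le_compat_l; lra|lra]. }
  assert (HE3 : INR n * E <= 3).
  { apply (Rle_trans _ (INR n * (K1 * z))); [apply Rmult_le_compat_l; lra|]. unfold z. lra. }
  assert (HP2 : sg0 * (tau - INR n * (2 * dl / kap)) <= INR n * (E * E / kap)).
  { apply HP; auto. intros k Hk. specialize (Ci k Hk). specialize (Cj k Hk). unfold lt in Ci, Cj.
    replace (ll j k - ll i k - tau * unitv m k) with
      ((ll j k - (l k + INR j * g * unitv m k)) + - (ll i k - (l k + INR i * g * unitv m k)))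
      by (unfold tau; ring).
    replace (2 * dl) with (dl + dl) by ring.
    apply Rabs_triang_bound; [lra|rewrite Rabs_Ropp; lra]. }
  assert (Hmain : tau <= K2 * (z * z) + K3 * dl).
  { assert (H1 : INR n * (E * E / kap) <= sg0 * (K2 * (z * z))).
    { replace (sg0 * (K2 * (z * z))) with (INR n * ((K1 * z) * (K1 * z) / kap)) by (unfold K2; field; lra).
      apply Rmult_le_compat_l; [lra|]. apply Rmult_le_compat_r; [left; apply Rinv_0_lt_compat; auto|].
      apply Rmult_le_compat; lra. }
    replace (INR n * (2 * dl / kap)) with (K3 * dl) in HP2 by (unfold K3; field; lra).
    assert (H2 : sg0 * (tau - K3 * dl) <= sg0 * (K2 * (z * z))) by lra.
    apply Rmult_le_reg_l in H2; auto. lra. }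
  assert (Hz : z * z <= 3 * (u * u + tau * tau + dl * dl)).
  { unfold z. pose proof (Rle_0_sqr (u - tau)). pose proof (Rle_0_sqr (u - dl)).
    pose proof (Rle_0_sqr (tau - dl)). unfold Rsqr in *. lra. }
  assert (F1 : 3 * K2 * (u * u) <= g / 4).
  { apply (Rle_trans _ (3 * K2 * ((D / INR N) * (D / INR N)))).
    - apply Rmult_le_compat_l; [lra|]. apply Rmult_le_compat; lra.
    - apply (Rmult_le_reg_r (4 * (INR N * INR N))); [nra|].
      replace (3 * K2 * (D / INR N * (D / INR N)) * (4 * (INR N * INR N))) with (12 * K2 * (D * D))
        by (field; lra).
      replace (g / 4 * (4 * (INR N * INR N))) with (g * INR N * INR N) by field.
      rewrite EgN. auto. }
  assert (F2 : 3 * K2 * (tau * tau) <= tau / 4).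
  { assert (3 * K2 * tau <= 3 * K2 * (2 * T)) by (apply Rmult_le_compat_l; lra). nra. }
  assert (F3 : 3 * K2 * (dl * dl) + K3 * dl <= g / 4).
  { assert (dl * dl <= dl) by nra. assert (3 * K2 * (dl * dl) <= 3 * K2 * dl) by (apply Rmult_le_compat_l; lra).
    lra. }
  assert (F4 : K2 * (z * z) <= K2 * (3 * (u * u + tau * tau + dl * dl))) by (apply Rmult_le_compat_l; lra).
  lra.
Qed.

Definition sign_list (n : nat) (P : nat -> pt) (O : pt) : list bool :=
  map (fun i => if Rlt_dec 0 (cross (psub (P (nxt n i)) (P i)) (psub O (P i)))
                then true else false) (seq 0 n).

Lemma sgn_sign_list (n : nat) (P : nat -> pt) (O : pt) (k : nat) : (k < n)%nat ->
  sgn (sign_list n P O) k = epsi n P O k.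
Proof.
  intros Hk. unfold sgn, sign_list, epsi.
  set (f := fun i => if Rlt_dec 0 (cross (psub (P (nxt n i)) (P i)) (psub O (P i)))
                     then true else false).
  rewrite (nth_indep _ true (f 0%nat)) by (rewrite length_map, length_seq; auto).
  rewrite map_nth, seq_nth by auto. unfold f. simpl.
  destruct (Rlt_dec _ _); reflexivity.
Qed.

(** A cyclic polygon supplies [cyc_data] with [s = / (2 * Rad)] and its own sign pattern. A
    vanishing cross product gives [sin (2 * al) = 0], which for [0 < al <= PI / 2] means that the
    edge is a diameter. *)
Lemma generic_cyclic (n : nat) (l : nat -> R) (P : nat -> pt) (O : pt) (Rad : R) :
  (0 < n)%nat -> (forall i, (i < n)%nat -> 0 < l i) -> InL n l P -> OnCircle n P O Rad ->
  ~ bad_diameter n (sign_list n P O) l -> ~ bad_tangent n (sign_list n P O) l ->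
  (forall i, (i < n)%nat -> cross (psub (P i) O) (psub (P (nxt n i)) O) <> 0) /\
  tanSum n P O <> 0.
Proof.
  intros Hn Hl HP HC HA HB.
  assert (HR : 0 < Rad) by apply HC.
  assert (HY : cyc_data n (sign_list n P O) l (/ (2 * Rad)) (alphai n P O)).
  { split; [apply Rinv_0_lt_compat; lra|]. split.
    - intros k Hk. destruct (circle_edge n l P O Rad Hn Hl HP HC k Hk) as [H1 [H2 _]].
      split; auto. rewrite H2. unfold Rdiv. ring.
    - destruct (circle_winding n l P O Rad Hn Hl HP HC) as [w Hw]. exists w. rewrite <- Hw.
      apply rsum_ext. intros k Hk. rewrite sgn_sign_list by auto. reflexivity. }
  assert (Hcr : forall i, (i < n)%nat -> cross (psub (P i) O) (psub (P (nxt n i)) O) <> 0).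
  { intros i Hi E. apply HA. exists (/ (2 * Rad)), (alphai n P O). split; auto.
    exists i. split; auto.
    destruct (circle_edge n l P O Rad Hn Hl HP HC i Hi) as [H1 [_ [_ [_ H2]]]].
    rewrite E in H2. apply Rmult_integral in H2. destruct H2 as [H2|H2]; [|nra].
    destruct (Req_dec (alphai n P O i) (PI / 2)) as [|Hne]; auto. exfalso.
    assert (H3 : 0 < sin (2 * alphai n P O i)) by (apply sin_gt_0; lra).
    unfold hangle in H2. destruct (epsi_cases n P O i) as [E1|E1]; rewrite E1 in H2.
    - rewrite Rmult_1_l in H2. lra.
    - replace (2 * (-1 * alphai n P O i)) with (- (2 * alphai n P O i)) in H2 by ring.
      rewrite sin_neg in H2. lra. }
  split; auto. intros E. apply HB. exists (/ (2 * Rad)), (alphai n P O).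
  split; auto. split.
  - intros k Hk. destruct (circle_edge n l P O Rad Hn Hl HP HC k Hk) as [_ [_ [H2 _]]]. auto.
  - rewrite <- E. apply rsum_ext. intros k Hk. rewrite sgn_sign_list by auto. reflexivity.
Qed.

Theorem mainTheorem8 (n : nat) (Hn : (3 <= n)%nat) :
  exists U : (nat -> R) -> Prop,
    OpenDensePos n U /\
    forall l : nat -> R,
      (forall i, (i < n)%nat -> 0 < l i) -> U l ->
      forall (P : nat -> pt) (O : pt) (Rad : R),
        InL n l P -> OnCircle n P O Rad ->
        exists mu : nat,
          NondegCritIndex n l P mu /\
          INR mu = INR (eP n P O) - 1 - 2 * windingP n P O
                   - (if Rlt_dec 0 (tanSum n P O) then 0 else 1).
Proof.
  exists (fun l => (forall L, In L (boolseqs n) -> inner n (fun l => ~ bad_diameter n L l) l) /\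
                   (forall L, In L (boolseqs n) -> inner n (fun l => ~ bad_tangent n L l) l)).
  split.
  - apply OpenDense_and.
    + apply (OpenDense_list n (fun L => inner n (fun l => ~ bad_diameter n L l))).
      intros L. apply bad_diameter_OpenDense. lia.
    + apply (OpenDense_list n (fun L => inner n (fun l => ~ bad_tangent n L l))).
      intros L. apply bad_tangent_OpenDense. lia.
  - intros l Hl [HA HB] P O Rad HP HC.
    assert (HL : In (sign_list n P O) (boolseqs n)).
    { pose proof (boolseqs_complete (sign_list n P O)) as H.
      unfold sign_list at 2 in H. rewrite length_map, length_seq in H. auto. }
    destruct (generic_cyclic n l P O Rad ltac:(lia) Hl HP HC) as [H1 H2].
    + exact (inner_self n _ l (HA _ HL)).
    + exact (inner_self n _ l (HB _ HL)).
    + exact (cyclic_morse n l P O Rad Hn Hl HP HC H1 H2).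
Qed.
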